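(* Let $0<r<R<\infty$. For all $\delta\in\mathbb{R}$ and $\nu\ge|\delta|$, the zeros of $\widetilde{\mathfrak{h}}_{\nu,\delta}(z)$ (in the complex plane) are all real and simple.
   Context: $J_\nu,Y_\nu$ are Bessel functions of the first and second kind of order $\nu$. The function $\widetilde{\mathfrak{h}}_{\nu,\delta}$ is $$\begin{aligned}\widetilde{\mathfrak{h}}_{\nu,\delta}(z)=&\;J_\nu'(Rz)Y_\nu'(rz)-J_\nu'(rz)Y_\nu'(Rz)+\frac{\delta^2}{Rr\,z^{2}}\left(J_\nu(Rz)Y_\nu(rz)-J_\nu(rz)Y_\nu(Rz)\right)\\&-\frac{\delta}{Rz}\left(J_\nu(Rz)Y_\nu'(rz)-J_\nu'(rz)Y_\nu(Rz)\right)-\frac{\delta}{rz}\left(J_\nu'(Rz)Y_\nu(rz)-J_\nu(rz)Y_\nu'(Rz)\right),\end{aligned}$$ initially for $z>0$ and then extended analytically to the complex plane: it extends to an even single-valued analytic function on $\mathbb{C}\setminus\{0\}$ (and, when $\nu=|\delta|$, to an entire function). Equivalently, for $x>0$, $\widetilde{\mathfrak{h}}_{\nu,\delta}(x)=(Rr)^{\delta}x^{2\delta}\left(j_\nu'(Rx)y_\nu'(rx)-j_\nu'(rx)y_\nu'(Rx)\right)$ with $j_\nu(x)=x^{-\delta}J_\nu(x)$, $y_\nu(x)=x^{-\delta}Y_\nu(x)$. *)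

(* Defs.v *)
From Stdlib Require Import Reals ZArith ClassicalEpsilon.
From Coquelicot Require Import Coquelicot.
Open Scope R_scope.

(* The entire function 1/Gamma, by Euler's limit
   1/Gamma(x) = lim_n x (x+1) ... (x+n) / (n! n^x);
   it vanishes at the nonpositive integers. *)
Definition rgamma (x : R) : R :=
  real (Lim_seq (fun n : nat =>
    prod_f_R0 (fun k => x + INR k) n / (INR (fact n) * Rpower (INR n) x))).

(* Meaningful for x > 0 only. *)
Definition BesselJ (nu x : R) : R :=
  Series (fun k : nat =>
    (-1) ^ k / INR (fact k) * rgamma (INR k + nu + 1)
      * Rpower (x / 2) (2 * INR k + nu)).

Definition BesselY_quot (nu x : R) : R :=
  (BesselJ nu x * cos (nu * PI) - BesselJ (- nu) x) / sin (nu * PI).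

(* Meaningful for x > 0 only. *)
Definition BesselY (nu x : R) : R :=
  if excluded_middle_informative (exists n : Z, nu = IZR n)
  then real (Lim (fun mu => BesselY_quot mu x) nu)
  else BesselY_quot nu x.

Definition BesselJ' (nu : R) : R -> R := Derive (BesselJ nu).
Definition BesselY' (nu : R) : R -> R := Derive (BesselY nu).

(* rin and rout are the radii r < R; x > 0. *)
Definition htilde_pos (rin rout nu delta x : R) : R :=
  BesselJ' nu (rout * x) * BesselY' nu (rin * x)
  - BesselJ' nu (rin * x) * BesselY' nu (rout * x)
  + delta ^ 2 / (rout * rin * x ^ 2)
    * (BesselJ nu (rout * x) * BesselY nu (rin * x)
       - BesselJ nu (rin * x) * BesselY nu (rout * x))
  - delta / (rout * x)
    * (BesselJ nu (rout * x) * BesselY' nu (rin * x)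
       - BesselJ' nu (rin * x) * BesselY nu (rout * x))
  - delta / (rin * x)
    * (BesselJ' nu (rout * x) * BesselY nu (rin * x)
       - BesselJ nu (rin * x) * BesselY' nu (rout * x)).

Definition analytic_at (f : C -> C) (z : C) : Prop :=
  exists (a : nat -> C) (e : R), 0 < e /\
    forall w : C, Cmod (w - z)%C < e ->
      is_pseries (K := C_AbsRing) (V := C_NormedModule) a (w - z)%C (f w).

(* The whole plane when nu = |delta|, the punctured plane otherwise. *)
Definition htilde_domain (nu delta : R) (z : C) : Prop :=
  nu = Rabs delta \/ z <> RtoC 0.

Definition is_htilde_extension (rin rout nu delta : R) (H : C -> C) : Prop :=
  (forall z : C, htilde_domain nu delta z -> analytic_at H z) /\
  (forall x : R, 0 < x -> H (RtoC x) = RtoC (htilde_pos rin rout nu delta x)).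

(* By the identity theorem the extension is unique on htilde_domain; only the
   value at 0 when nu <> |delta|, outside the domain, is arbitrary. *)
Definition htilde (rin rout nu delta : R) : C -> C :=
  epsilon (inhabits (fun _ : C => RtoC 0))
    (is_htilde_extension rin rout nu delta).

Definition simple_zero (f : C -> C) (z : C) : Prop :=
  f z = RtoC 0 /\
  exists l : C,
    is_derive (K := C_AbsRing) (V := C_NormedModule) f z l /\ l <> RtoC 0.

(* Main.v *)
Require Import Defs.
From Stdlib Require Import Reals ZArith Factorial Lra Lia ClassicalEpsilon.
From Coquelicot Require Import Coquelicot.
Open Scope R_scope.

(** On [rin <= t <= rout], put [tau = ln (t / rin)] and let [u] solve
    [u'' = (nu^2 - l rin^2 exp (2 tau)) u] with [u 0 = 1], [u' 0 = delta]; this is Bessel's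
    equation in [t] for [l = z^2]. Let [w = u' - delta u], so that [w 0 = 0], and
    [F l = w (ln (rout / rin))], an entire function of [l] with real Taylor coefficients.
    Since [BesselJ nu] and [BesselY nu] have a nonzero Wronskian [c / x], constancy of
    Wronskians gives [htilde z = c F (z^2) / (rin rout z^2)], and this formula is the analytic
    extension. A zero [l] of [F] is an eigenvalue of a regular Sturm-Liouville problem:
    [(conj u * w)' = |w|^2 + (nu^2 - delta^2) |u|^2 - l rin^2 exp (2 tau) |u|^2] forces [l] to
    be real and nonnegative, and [(w u_l - u w_l)' = rin^2 exp (2 tau) u^2] forces it to be
    simple. If [nu = |delta|], then [F 0 = 0] and this simple zero is cancelled by [z^2]. *)

(** The logarithmic variable removes the first-order term of Bessel's equation: [x d/dx] becomes the
    plain derivative, so Wronskians are constant without a weight and the equation at [l = 0] has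
    elementary solutions. The Bessel functions are treated in the same spirit, each paired with
    [f1 = x f']; the boundary operator [f1 - delta f] then turns the formula of [htilde_pos] into a
    determinant. Two definitions shape the work. At integer order [BesselY] is a limit in the order,
    so a nonzero Wronskian there rests on the derivative of 1/Gamma, also at its zeros. And [htilde]
    is chosen by [epsilon]: nothing is known of it off the positive axis until an extension is
    exhibited and the identity theorem shows that the choice agrees with it. Complex analysis is
    kept small by expanding [u] in powers of [l] with real coefficients: its real part, its
    imaginary part and its derivative in [l] are real series with the same terms and different
    multipliers. *)

(** * Term-by-term differentiation of real series *)

Lemma MVT_Rabs (f df : R -> R) (a b K : R) :
  (forall t, Rmin a b <= t <= Rmax a b -> is_derive f t (df t)) ->
  (forall t, Rmin a b <= t <= Rmax a b -> Rabs (df t) <= K) ->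
  Rabs (f b - f a) <= K * Rabs (b - a).
Proof.
  intros Hd Hb.
  destruct (MVT_gen f a b df) as [c [Hc E]].
  - intros t Ht; apply Hd; lra.
  - intros t Ht. apply continuity_pt_filterlim.
    apply (ex_derive_continuous f). exists (df t); auto.
  - rewrite E, Rabs_mult. apply Rmult_le_compat_r; [apply Rabs_pos | auto].
Qed.

Lemma Rabs_between (x y t e : R) :
  Rabs (y - x) < e -> Rmin x y <= t <= Rmax x y -> Rabs (t - x) < e.
Proof.
  intros H Ht. apply Rabs_lt_between in H. apply Rabs_lt_between.
  unfold Rmin, Rmax in Ht. destruct (Rle_dec x y); lra.
Qed.

Lemma ex_series_le_R (a b : nat -> R) :
  (forall n, Rabs (a n) <= b n) -> ex_series b -> ex_series a.
Proof. intros H. apply (ex_series_le (V := R_CompleteNormedModule) a b); exact H. Qed.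

(** The tail of [a] is dominated by the tail of [M]. The bound depends on [M] alone, so a majorant
    valid at all points yields uniform convergence of the partial sums. *)
Lemma Series_remainder_le (a M : nat -> R) (n : nat) :
  (forall k, Rabs (a k) <= M k) -> ex_series M ->
  Rabs (Series a - sum_f_R0 a n) <= Series M - sum_f_R0 M n.
Proof.
  intros H HM.
  assert (Ha : ex_series a) by (eapply ex_series_le_R; eauto).
  rewrite (Series_incr_n a (S n)), (Series_incr_n M (S n)); try lia; auto.
  simpl pred. ring_simplify (sum_f_R0 M n + Series (fun k => M (S n + k)%nat) - sum_f_R0 M n).
  replace (sum_f_R0 a n + Series (fun k => a (S n + k)%nat) - sum_f_R0 a n)
    with (Series (fun k => a (S n + k)%nat)) by ring.
  assert (HM' : ex_series (fun k => M (S n + k)%nat)) by (apply (ex_series_incr_n M (S n)); auto).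
  eapply Rle_trans; [apply Series_Rabs|].
  - eapply ex_series_le_R; [|exact HM']. intros k; rewrite Rabs_Rabsolu; apply H.
  - apply Series_le; [|exact HM']. intros k; split; [apply Rabs_pos | apply H].
Qed.

(** The majorant is only asked of the derived series. Convergence of the original series spreads
    from the centre [x] to the whole interval, because [g k y - g k x] is at most [M k * e] by the
    mean value theorem. *)
Lemma is_derive_Series (g d : nat -> R -> R) (M : nat -> R) (x e : R) :
  0 < e ->
  (forall k y, Rabs (y - x) < e -> is_derive (g k) y (d k y)) ->
  (forall k y, Rabs (y - x) < e -> Rabs (d k y) <= M k) ->
  ex_series M -> ex_series (fun k => g k x) ->
  is_derive (fun y => Series (fun k => g k y)) x (Series (fun k => d k x)).
Proof.
  intros He Hd Hb HM Hx.
  apply is_derive_Reals.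
  set (e' := mkposreal e He).
  apply (CVU_derivable (fun n y => sum_f_R0 (fun k => g k y) n)
           (fun n y => sum_f_R0 (fun k => d k y) n)
           (fun y => Series (fun k => g k y)) (fun y => Series (fun k => d k y)) x e').
  - intros eps Heps.
    assert (HS : is_series M (Series M)) by (apply Series_correct; auto).
    apply is_series_Reals in HS. destruct (HS eps Heps) as [N HN].
    exists N. intros n y Hn Hy.
    eapply Rle_lt_trans.
    + apply Series_remainder_le with (M := M); [intros k; apply Hb; exact Hy | exact HM].
    + specialize (HN n Hn). unfold Rdist in HN. rewrite Rabs_minus_sym in HN.
      eapply Rle_lt_trans; [apply Rle_abs | exact HN].
  - intros y Hy.
    assert (Hey : ex_series (fun k => g k y)).
    { apply ex_series_ext with (fun k => g k x + (g k y - g k x)).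
      { intros k; simpl; ring. }
      apply (ex_series_plus (fun k => g k x) (fun k => g k y - g k x)); auto.
      apply ex_series_le_R with (fun k => M k * e).
      - intros k. eapply Rle_trans.
        + apply (MVT_Rabs (g k) (d k) x y (M k)).
          * intros t Ht; apply Hd; eapply Rabs_between; eauto.
          * intros t Ht; apply Hb; eapply Rabs_between; eauto.
        + apply Rmult_le_compat_l; [|apply Rlt_le, Hy].
          eapply Rle_trans; [apply Rabs_pos | apply (Hb k x)].
          replace (x - x) with 0 by ring; rewrite Rabs_R0; auto.
      - apply ex_series_ext with (fun k => scal e (M k)).
        { intros k; unfold scal; simpl; unfold mult; simpl; ring. }
        apply (ex_series_scal e M HM). }
    apply is_series_Reals, Series_correct, Hey.
  - intros n y Hy.
    induction n as [|n IH]; simpl.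
    + apply is_derive_Reals, Hd, Hy.
    + apply derivable_pt_lim_plus; auto. apply is_derive_Reals, Hd, Hy.
  - unfold Boule; simpl. replace (x - x) with 0 by ring; rewrite Rabs_R0; auto.
Qed.

(** * The reciprocal gamma function *)

(** Comparison with a telescoping series: [1/(k+1) - 1/(k+2)] equals [1/((k+1)(k+2))], and
    [k + 2 <= 2 (k + 1)]. *)
Lemma ex_series_inv_sqr : ex_series (fun k : nat => / (INR k + 1) ^ 2).
Proof.
  assert (H : is_series (fun k : nat => / (INR k + 1) - / (INR k + 2)) 1).
  { apply (is_lim_seq_ext (fun n => 1 - / (INR n + 2)) (sum_n (fun k : nat => / (INR k + 1) - / (INR k + 2))) 1).
    - intros n; rewrite sum_n_Reals. induction n as [|n IH].
      + simpl; lra.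
      + rewrite tech5, <- IH, S_INR.
        pose proof (pos_INR n). field; lra.
    - replace (Finite 1) with (Rbar_minus 1 0) by (simpl; f_equal; ring).
      apply is_lim_seq_minus'; [apply is_lim_seq_const|].
      apply is_lim_seq_ext with (fun n => / INR (n + 2)).
      + intros n; rewrite plus_INR; simpl; f_equal; ring.
      + apply (is_lim_seq_incr_n (fun n => / INR n) 2).
        replace (Finite 0) with (Rbar_inv p_infty) by reflexivity.
        apply is_lim_seq_inv; [apply is_lim_seq_INR | discriminate]. }
  apply ex_series_le_R with (fun k => 2 * (/ (INR k + 1) - / (INR k + 2))).
  - intros k. pose proof (pos_INR k).
    rewrite Rabs_pos_eq by (left; apply Rinv_0_lt_compat; nra).
    apply Rminus_le_0.
    replace (2 * (/ (INR k + 1) - / (INR k + 2)) - / (INR k + 1) ^ 2)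
      with (INR k / ((INR k + 1) ^ 2 * (INR k + 2))) by (field; lra).
    apply Rmult_le_pos; auto. left; apply Rinv_0_lt_compat; nra.
  - exists (2 * 1). apply (is_series_scal 2 _ _ H).
Qed.

(** Logarithm of a factor of Euler's product: with [n = k + 1], 1/Gamma(x) is [x] times the product
    of [(1 + x/n) (1 + 1/n)^(-x)]. *)
Definition gterm (k : nat) (x : R) : R :=
  ln (1 + x / (INR k + 1)) - x * ln (1 + / (INR k + 1)).

Definition dgterm (k : nat) (x : R) : R :=
  / (INR k + 1 + x) - ln (1 + / (INR k + 1)).

Lemma is_derive_gterm (k : nat) (x : R) :
  0 <= x -> is_derive (gterm k) x (dgterm k x).
Proof.
  intros Hx. pose proof (pos_INR k). unfold gterm, dgterm.
  assert (0 <= x / (INR k + 1)) by (apply Rmult_le_pos; [lra | left; apply Rinv_0_lt_compat; lra]).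
  auto_derive.
  - lra.
  - field; split; lra.
Qed.

Lemma ln_le_sub1 (y : R) : 0 < y -> ln y <= y - 1.
Proof.
  intros Hy. pose proof (exp_ineq1_le (ln y)) as H. rewrite exp_ln in H by auto. lra.
Qed.

(** With [n = k + 1], [ln (1 + 1/n)] lies between [1/(n+1)] and [1/n]. Hence [dgterm] is at most
    [1/n - 1/(n+1)] and at least [1/(n+X) - 1/n], both of order [1/n^2]. *)
Lemma dgterm_bound (k : nat) (x X : R) :
  0 <= x <= X -> Rabs (dgterm k x) <= (1 + X) * / (INR k + 1) ^ 2.
Proof.
  intros [Hx HX]. pose proof (pos_INR k) as Hk. unfold dgterm.
  set (n := INR k + 1) in *. assert (Hn : 1 <= n) by (unfold n; lra).
  assert (H1 : ln (1 + / n) <= / n).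
  { eapply Rle_trans; [apply ln_le_sub1|lra].
    assert (0 < / n) by (apply Rinv_0_lt_compat; lra). lra. }
  assert (H2 : / (n + 1) <= ln (1 + / n)).
  { assert (E : 1 + / n = / (n / (n + 1))) by (field; lra).
    rewrite E, ln_Rinv by (apply Rdiv_lt_0_compat; lra).
    assert (ln (n / (n + 1)) <= n / (n + 1) - 1) by (apply ln_le_sub1, Rdiv_lt_0_compat; lra).
    replace (/ (n + 1)) with (1 - n / (n + 1)) by (field; lra). lra. }
  assert (H3 : / (n + x) <= / n) by (apply Rinv_le_contravar; lra).
  assert (H4 : / (n + X) <= / (n + x)) by (apply Rinv_le_contravar; lra).
  assert (Hn2 : 0 < / n ^ 2) by (apply Rinv_0_lt_compat; nra).
  assert (H5 : / n - / (n + 1) <= / n ^ 2).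
  { apply Rminus_le_0. replace (/ n ^ 2 - (/ n - / (n + 1))) with (/ (n ^ 2 * (n + 1))) by (field; lra).
    left; apply Rinv_0_lt_compat; nra. }
  assert (H6 : / n - / (n + X) <= X * / n ^ 2).
  { apply Rminus_le_0.
    replace (X * / n ^ 2 - (/ n - / (n + X))) with (X * X * / (n ^ 2 * (n + X))) by (field; lra).
    apply Rmult_le_pos; [nra | left; apply Rinv_0_lt_compat; nra]. }
  assert (H7 : 0 <= X * / n ^ 2) by nra.
  apply Rabs_le. split; lra.
Qed.

Lemma gterm_0 (k : nat) : gterm k 0 = 0.
Proof.
  unfold gterm. unfold Rdiv. rewrite Rmult_0_l, Rplus_0_r, ln_1. ring.
Qed.

Lemma gterm_bound (k : nat) (x : R) :
  0 <= x -> Rabs (gterm k x) <= (1 + x) * x * / (INR k + 1) ^ 2.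
Proof.
  intros Hx.
  pose proof (MVT_Rabs (gterm k) (dgterm k) 0 x ((1 + x) * / (INR k + 1) ^ 2)) as H.
  rewrite gterm_0, !Rminus_0_r, (Rabs_pos_eq x) in H by auto.
  rewrite Rmin_left, Rmax_right in H by auto.
  eapply Rle_trans; [apply H|].
  - intros t Ht; apply is_derive_gterm; lra.
  - intros t Ht; apply dgterm_bound; lra.
  - right; ring.
Qed.

Definition zeta2 : R := Series (fun k : nat => / (INR k + 1) ^ 2).

Definition lnG (x : R) : R := Series (fun k => gterm k x).
Definition dlnG (x : R) : R := Series (fun k => dgterm k x).

Lemma ex_series_scal_R (c : R) (a : nat -> R) : ex_series a -> ex_series (fun k => c * a k).
Proof. exact (ex_series_scal c a). Qed.

Lemma Series_bound (c : R) (a b : nat -> R) :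
  (forall k, Rabs (a k) <= c * b k) -> ex_series b ->
  Rabs (Series a) <= c * Series b.
Proof.
  intros H Hb.
  pose proof (ex_series_scal_R c b Hb) as Hc.
  rewrite <- Series_scal_l.
  eapply Rle_trans; [apply Series_Rabs|].
  - eapply ex_series_le_R; [|exact Hc]. intros k; simpl; rewrite Rabs_Rabsolu; apply H.
  - apply Series_le; [|exact Hc]. intros k; split; [apply Rabs_pos | apply H].
Qed.

Lemma ex_series_gterm (x : R) : 0 <= x -> ex_series (fun k => gterm k x).
Proof.
  intros Hx. eapply ex_series_le_R; [intros k; apply gterm_bound; auto|].
  apply ex_series_scal_R, ex_series_inv_sqr.
Qed.

Lemma is_derive_lnG (x : R) : 0 < x -> is_derive lnG x (dlnG x).
Proof.
  intros Hx.
  apply (is_derive_Series gterm dgterm (fun k => (1 + 2 * x) * / (INR k + 1) ^ 2) x x Hx).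
  - intros k y Hy; apply Rabs_lt_between in Hy. apply is_derive_gterm; lra.
  - intros k y Hy; apply Rabs_lt_between in Hy. apply dgterm_bound; lra.
  - apply ex_series_scal_R, ex_series_inv_sqr.
  - apply ex_series_gterm; lra.
Qed.

Definition eulerseq (x : R) (n : nat) : R :=
  prod_f_R0 (fun k => x + INR k) n / (INR (fact n) * Rpower (INR n) x).

(** The product of the [1 + 1/(k+1)] for [k <= n] telescopes to [n + 2], while Euler's denominator
    carries the power of [n + 1]; the second term of the exponent is this mismatch, which tends to
    0. *)
Lemma eulerseq_exp (x : R) (n : nat) : 0 < x ->
  eulerseq x (S n) =
  x * exp (sum_f_R0 (fun k => gterm k x) n + x * (ln (INR n + 2) - ln (INR n + 1))).
Proof.
  intros Hx.
  assert (H : forall n, prod_f_R0 (fun k => x + INR k) (S n) =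
    INR (fact (S n)) * (x * exp (sum_f_R0 (fun k => gterm k x) n + x * ln (INR n + 2)))).
  { clear n; induction n as [|n IH].
    - simpl. unfold gterm. simpl.
      replace (0 + 1) with 1 by ring. rewrite Rinv_1. replace (1 + 1) with 2 by ring.
      unfold Rdiv; rewrite Rinv_1, Rmult_1_r, Rplus_0_l.
      replace (ln (1 + x) - x * ln 2 + x * ln 2) with (ln (1 + x)) by ring.
      rewrite exp_ln by lra. ring.
    - change (prod_f_R0 (fun k => x + INR k) (S (S n))) with
        (prod_f_R0 (fun k => x + INR k) (S n) * (x + INR (S (S n)))).
      rewrite IH, tech5, (fact_simpl (S n)), mult_INR. unfold gterm at 3.
      rewrite !S_INR. pose proof (pos_INR n).
      set (m := INR n) in *. set (s := sum_f_R0 _ n).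
      replace (1 + / (m + 1 + 1)) with ((m + 1 + 2) / (m + 2)) by (field; lra).
      rewrite ln_div by lra.
      replace (s + (ln (1 + x / (m + 1 + 1)) - x * (ln (m + 1 + 2) - ln (m + 2))) + x * ln (m + 1 + 2))
        with ((s + x * ln (m + 2)) + ln (1 + x / (m + 1 + 1))) by ring.
      rewrite (exp_plus (s + x * ln (m + 2))), exp_ln.
      + field; lra.
      + assert (0 < x / (m + 1 + 1)) by (apply Rdiv_lt_0_compat; lra). lra. }
  unfold eulerseq. rewrite H. unfold Rpower. rewrite S_INR.
  set (s := sum_f_R0 _ n).
  replace (s + x * (ln (INR n + 2) - ln (INR n + 1)))
    with ((s + x * ln (INR n + 2)) + - (x * ln (INR n + 1))) by ring.
  rewrite (exp_plus (s + _)), (exp_Ropp (x * _)). field.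
  split; [apply Rgt_not_eq, exp_pos | apply INR_fact_neq_0].
Qed.

Lemma is_lim_seq_ln_succ : is_lim_seq (fun n => ln (INR n + 2) - ln (INR n + 1)) 0.
Proof.
  apply is_lim_seq_le_le with (fun _ => 0) (fun n => / INR (S n)).
  - intros n. pose proof (pos_INR n). rewrite S_INR. split.
    + apply Rlt_le, Rlt_0_minus, ln_increasing; lra.
    + rewrite <- ln_div by lra.
      eapply Rle_trans; [apply ln_le_sub1, Rdiv_lt_0_compat; lra|].
      right; field; lra.
  - apply is_lim_seq_const.
  - apply (is_lim_seq_incr_1 (fun n => / INR n)).
    replace (Finite 0) with (Rbar_inv p_infty) by reflexivity.
    apply is_lim_seq_inv; [apply is_lim_seq_INR | discriminate].
Qed.

Lemma is_lim_eulerseq_pos (x : R) : 0 < x -> is_lim_seq (eulerseq x) (x * exp (lnG x)).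
Proof.
  intros Hx. apply is_lim_seq_incr_1.
  eapply is_lim_seq_ext; [intros n; symmetry; apply eulerseq_exp; auto|].
  apply (is_lim_seq_scal_l _ x (Finite (exp (lnG x)))).
  apply (is_lim_seq_continuous exp).
  { apply derivable_continuous_pt, derivable_pt_exp. }
  replace (lnG x) with (lnG x + x * 0) by ring.
  apply is_lim_seq_plus'.
  - assert (H : is_series (fun k => gterm k x) (lnG x)) by (apply Series_correct, ex_series_gterm; lra).
    apply (is_lim_seq_ext (sum_n (fun k => gterm k x)) _ (lnG x)); [|exact H].
    intros n; apply sum_n_Reals.
  - apply (is_lim_seq_scal_l _ x (Finite 0)), is_lim_seq_ln_succ.
Qed.

(** The recurrence of 1/Gamma at finite [n]: the products for [x] and [x + 1] differ only in their
    end factors. *)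
Lemma eulerseq_succ (x : R) (n : nat) : (0 < n)%nat -> x + INR n + 1 <> 0 ->
  eulerseq x n = x * eulerseq (x + 1) n * (INR n / (x + INR n + 1)).
Proof.
  intros Hn H0.
  assert (HP : x * prod_f_R0 (fun k => x + 1 + INR k) n =
    prod_f_R0 (fun k => x + INR k) n * (x + INR n + 1)).
  { clear; induction n as [|n IH].
    - simpl; ring.
    - change (x * (prod_f_R0 (fun k => x + 1 + INR k) n * (x + 1 + INR (S n))) =
        prod_f_R0 (fun k => x + INR k) n * (x + INR (S n)) * (x + INR (S n) + 1)).
      rewrite <- Rmult_assoc, IH, S_INR. ring. }
  unfold eulerseq. apply lt_0_INR in Hn.
  rewrite Rpower_plus, Rpower_1 by auto.
  replace (prod_f_R0 (fun k => x + INR k) n) with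
    (x * prod_f_R0 (fun k => x + 1 + INR k) n / (x + INR n + 1)) by (rewrite HP; field; auto).
  field. repeat split; auto; try lra.
  - apply Rgt_not_eq, exp_pos.
  - apply INR_fact_neq_0.
Qed.

Lemma is_lim_seq_ratio (x : R) : is_lim_seq (fun n => INR n / (x + INR n + 1)) 1.
Proof.
  destruct (nfloor_ex (Rabs x)) as [m Hm]; [apply Rabs_pos|].
  apply (is_lim_seq_incr_n _ (m + 1)).
  apply is_lim_seq_ext with (fun n => 1 - (x + 1) * / (x + INR (n + (m + 1)) + 1)).
  { intros n. assert (0 < x + INR (n + (m + 1)) + 1).
    { rewrite !plus_INR. pose proof (pos_INR n). simpl (INR 1).
      assert (- x <= Rabs x) by (rewrite <- Rabs_Ropp; apply Rle_abs). lra. }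
    field; lra. }
  replace (Finite 1) with (Finite (1 - (x + 1) * 0)) by (f_equal; ring).
  apply is_lim_seq_minus'; [apply is_lim_seq_const|].
  apply (is_lim_seq_scal_l _ (x + 1) (Finite 0)).
  replace (Finite 0) with (Rbar_inv p_infty) by reflexivity.
  apply is_lim_seq_inv; [|discriminate].
  apply (is_lim_seq_incr_n (fun n => x + INR n + 1) (m + 1)).
  eapply is_lim_seq_plus; [eapply is_lim_seq_plus; [apply is_lim_seq_const | apply is_lim_seq_INR | reflexivity]
    | apply is_lim_seq_const | reflexivity].
Qed.

Lemma is_lim_eulerseq_step (x l : R) :
  is_lim_seq (eulerseq (x + 1)) l -> is_lim_seq (eulerseq x) (x * l).
Proof.
  intros H.
  apply is_lim_seq_ext_loc with (fun n => x * eulerseq (x + 1) n * (INR n / (x + INR n + 1))).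
  { destruct (nfloor_ex (Rabs x)) as [m Hm]; [apply Rabs_pos|].
    exists (S m). intros n Hn. symmetry. apply eulerseq_succ; [lia|].
    apply le_INR in Hn. rewrite S_INR in Hn.
    assert (- x <= Rabs x) by (rewrite <- Rabs_Ropp; apply Rle_abs). lra. }
  replace (x * l) with (x * l * 1) by ring.
  apply is_lim_seq_mult'; [|apply is_lim_seq_ratio].
  apply (is_lim_seq_scal_l _ x (Finite l)); auto.
Qed.

(** [rgamma] is the real part of an extended limit, so its value means something only once a finite
    limit is known. Convergence for [x > 0] is carried to the left one unit at a time by the
    recurrence. *)
Lemma is_lim_eulerseq (x : R) : is_lim_seq (eulerseq x) (rgamma x).
Proof.
  assert (H : forall N x, - INR N < x -> exists l : R, is_lim_seq (eulerseq x) l).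
  { clear x; induction N as [|N IH]; intros x Hx.
    - simpl in Hx. eexists; apply is_lim_eulerseq_pos; lra.
    - rewrite S_INR in Hx. destruct (IH (x + 1)) as [l Hl]; [lra|].
      eexists; apply is_lim_eulerseq_step; eauto. }
  destruct (nfloor_ex (Rabs x)) as [m Hm]; [apply Rabs_pos|].
  destruct (H (S m) x) as [l Hl].
  { rewrite S_INR.
    assert (- x <= Rabs x) by (rewrite <- Rabs_Ropp; apply Rle_abs). lra. }
  unfold rgamma. fold (eulerseq x).
  change (is_lim_seq (eulerseq x) (real (Lim_seq (eulerseq x)))).
  rewrite (is_lim_seq_unique _ _ Hl). exact Hl.
Qed.

Lemma rgamma_lim (x l : R) : is_lim_seq (eulerseq x) l -> rgamma x = l.
Proof.
  intros H. unfold rgamma. change (real (Lim_seq (eulerseq x)) = l).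
  rewrite (is_lim_seq_unique _ _ H). reflexivity.
Qed.

Lemma rgamma_exp (x : R) : 0 < x -> rgamma x = x * exp (lnG x).
Proof. intros Hx; apply rgamma_lim, is_lim_eulerseq_pos, Hx. Qed.

Lemma rgamma_pos (x : R) : 0 < x -> 0 < rgamma x.
Proof. intros Hx; rewrite rgamma_exp by auto. apply Rmult_lt_0_compat; [auto | apply exp_pos]. Qed.

Lemma rgamma_rec (x : R) : rgamma x = x * rgamma (x + 1).
Proof. apply rgamma_lim, is_lim_eulerseq_step, is_lim_eulerseq. Qed.

Lemma is_derive_rgamma_pos (x : R) : 0 < x ->
  is_derive rgamma x (exp (lnG x) + x * (dlnG x * exp (lnG x))).
Proof.
  intros Hx. apply is_derive_ext_loc with (fun y => y * exp (lnG y)).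
  - exists (mkposreal x Hx). intros y Hy. symmetry; apply rgamma_exp.
    apply Rabs_lt_between in Hy. unfold minus, plus, opp in Hy; simpl in Hy. lra.
  - pose proof (is_derive_lnG x Hx) as H.
    auto_derive.
    + exists (dlnG x); exact H.
    + replace (Derive (fun x0 => lnG x0) x) with (dlnG x); [ring|].
      symmetry; apply is_derive_unique, H.
Qed.

Lemma is_derive_rgamma_step (x : R) : ex_derive rgamma (x + 1) ->
  is_derive rgamma x (rgamma (x + 1) + x * Derive rgamma (x + 1)).
Proof.
  intros H. apply is_derive_ext with (fun y => y * rgamma (y + 1)).
  { intros y; symmetry; apply rgamma_rec. }
  auto_derive; [auto|].
  change (Derive (fun x0 => rgamma x0) (x + 1)) with (Derive rgamma (x + 1)). ring.
Qed.

Lemma ex_derive_rgamma (x : R) : ex_derive rgamma x.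
Proof.
  assert (H : forall (N : nat) (y : R), - INR N < y -> ex_derive rgamma y).
  { clear x; induction N as [|N IH]; intros x Hx.
    - simpl in Hx. eexists; apply is_derive_rgamma_pos; lra.
    - rewrite S_INR in Hx. eexists; apply is_derive_rgamma_step, IH; lra. }
  destruct (nfloor_ex (Rabs x)) as [m Hm]; [apply Rabs_pos|].
  apply (H (S m)). rewrite S_INR.
  assert (- x <= Rabs x) by (rewrite <- Rabs_Ropp; apply Rle_abs). lra.
Qed.

Definition drgamma : R -> R := Derive rgamma.

Lemma is_derive_rgamma (x : R) : is_derive rgamma x (drgamma x).
Proof. apply Derive_correct, ex_derive_rgamma. Qed.

Lemma drgamma_rec (x : R) : drgamma x = rgamma (x + 1) + x * drgamma (x + 1).
Proof. apply is_derive_unique, is_derive_rgamma_step, ex_derive_rgamma. Qed.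

Lemma rgamma_bound_init : exists B, 0 <= B /\ forall x, 0 < x <= 3 ->
  Rabs (rgamma x) <= B /\ Rabs (drgamma x) <= B.
Proof.
  pose proof ex_series_inv_sqr as Hz.
  assert (Z0 : 0 <= zeta2).
  { unfold zeta2. rewrite <- (is_series_unique (fun _ : nat => 0) 0) at 1.
    - apply Series_le; [|exact Hz]. intros n; split; [lra|].
      left; apply Rinv_0_lt_compat. pose proof (pos_INR n). nra.
    - apply (is_lim_seq_ext (fun _ => 0) (sum_n (fun _ : nat => 0)) 0); [|apply is_lim_seq_const].
      intros n; rewrite sum_n_const; ring. }
  (* 12 is [(1 + x) * x] at [x = 3] in [gterm_bound]; the 4 below is [1 + X] at [X = 3] in
     [dgterm_bound]. *)
  set (E := exp (12 * zeta2)).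
  assert (HE : 0 < E) by apply exp_pos.
  exists (E * (3 + 12 * zeta2 )). split; [apply Rmult_le_pos; lra|].
  intros x Hx.
  assert (H1 : Rabs (lnG x) <= 12 * zeta2).
  { apply Series_bound; [|exact Hz]. intros k. eapply Rle_trans; [apply gterm_bound; lra|].
    apply Rmult_le_compat_r; [|nra].
    left; apply Rinv_0_lt_compat. pose proof (pos_INR k). nra. }
  assert (H2 : Rabs (dlnG x) <= 4 * zeta2).
  { apply Series_bound; [|exact Hz]. intros k. eapply Rle_trans; [apply (dgterm_bound k x 3); lra|].
    right; ring. }
  assert (H3 : exp (lnG x) <= E).
  { unfold E. apply Rabs_le_between in H1.
    destruct (Req_dec (lnG x) (12 * zeta2)) as [->|]; [lra|].
    left; apply exp_increasing; lra. }
  pose proof (exp_pos (lnG x)) as H4.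
  rewrite rgamma_exp by lra.
  unfold drgamma. rewrite (is_derive_unique _ _ _ (is_derive_rgamma_pos x (proj1 Hx))).
  apply Rabs_le_between in H2.
  split.
  - rewrite Rabs_pos_eq by nra. nra.
  - replace (exp (lnG x) + x * (dlnG x * exp (lnG x))) with (exp (lnG x) * (1 + x * dlnG x)) by ring.
    rewrite Rabs_mult, Rabs_pos_eq by lra.
    apply Rmult_le_compat; [lra | apply Rabs_pos | auto|].
    apply Rabs_le. split; nra.
Qed.

(** The bound on [(0, 3]] propagates without growth. For [x > 3] the recurrence at [x - 1] gives
    [(x-1) |rgamma x| <= B] and [(x-1) |drgamma x| <= 2 B], and [x - 1 >= 2]; this is why the
    initial interval ends at 3. *)
Lemma rgamma_bound_pos : exists B, 0 <= B /\ forall x, 0 < x ->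
  Rabs (rgamma x) <= B /\ Rabs (drgamma x) <= B.
Proof.
  destruct rgamma_bound_init as [B [HB H]].
  exists B; split; auto.
  assert (HN : forall N x, 0 < x <= 3 + INR N -> Rabs (rgamma x) <= B /\ Rabs (drgamma x) <= B).
  { induction N as [|N IH]; intros x Hx.
    - apply H. simpl in Hx; lra.
    - rewrite S_INR in Hx. destruct (Rle_dec x 3) as [h|h]; [apply H; lra|].
      destruct (IH (x - 1)) as [I1 I2]; [lra|].
      pose proof (rgamma_rec (x - 1)) as R1. pose proof (drgamma_rec (x - 1)) as R2.
      replace (x - 1 + 1) with x in R1, R2 by ring.
      rewrite R1 in I1. rewrite R2 in I2.
      rewrite Rabs_mult, (Rabs_pos_eq (x - 1)) in I1 by lra.
      assert (G1 : Rabs (rgamma x) <= B) by (pose proof (Rabs_pos (rgamma x)); nra).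
      split; auto.
      pose proof (Rabs_triang (rgamma x + (x - 1) * drgamma x) (- rgamma x)) as T.
      rewrite Rabs_Ropp in T.
      replace (rgamma x + (x - 1) * drgamma x + - rgamma x) with ((x - 1) * drgamma x) in T by ring.
      rewrite Rabs_mult, (Rabs_pos_eq (x - 1)) in T by lra.
      pose proof (Rabs_pos (drgamma x)). nra. }
  intros x Hx. destruct (nfloor_ex x) as [m Hm]; [lra|].
  apply (HN m). lra.
Qed.

(** Each step to the left costs a bounded factor. The unbounded half-line serves [coefJQ_bound],
    where the argument runs over all [INR k + b + 1]. *)
Lemma rgamma_bound (N : nat) : exists B, 0 <= B /\ forall x, - INR N < x ->
  Rabs (rgamma x) <= B /\ Rabs (drgamma x) <= B.
Proof.
  induction N as [|N [B [HB IH]]].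
  - destruct rgamma_bound_pos as [B [HB H]]. exists B; split; auto.
    intros x Hx; apply H. simpl in Hx; lra.
  - pose proof (pos_INR N) as HN.
    exists (B + (INR N + 1) * B). split; [nra|].
    intros x Hx. rewrite S_INR in Hx.
    destruct (Rlt_dec (- INR N) x) as [h|h].
    + destruct (IH x h). split; nra.
    + destruct (IH (x + 1)) as [I1 I2]; [lra|].
      rewrite rgamma_rec, drgamma_rec.
      assert (Hax : Rabs x <= INR N + 1) by (apply Rabs_le; lra).
      pose proof (Rabs_pos x). pose proof (Rabs_pos (rgamma (x + 1))).
      pose proof (Rabs_pos (drgamma (x + 1))).
      split.
      * rewrite Rabs_mult. nra.
      * eapply Rle_trans; [apply Rabs_triang|]. rewrite Rabs_mult. nra.
Qed.

Lemma rgamma_nonpos_int (n : nat) : rgamma (- INR n) = 0.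
Proof.
  induction n as [|n IH].
  - rewrite rgamma_rec. simpl; ring.
  - rewrite rgamma_rec. replace (- INR (S n) + 1) with (- INR n) by (rewrite S_INR; ring).
    rewrite IH; ring.
Qed.

Lemma rgamma_neq_0 (x : R) : (forall n : nat, x <> - INR n) -> rgamma x <> 0.
Proof.
  assert (H : forall N x, - INR N < x -> (forall n : nat, x <> - INR n) -> rgamma x <> 0).
  { clear x; induction N as [|N IH]; intros x Hx Hn.
    - apply Rgt_not_eq, rgamma_pos. simpl in Hx; lra.
    - rewrite S_INR in Hx. rewrite rgamma_rec. apply Rmult_integral_contrapositive; split.
      + intros h; apply (Hn 0%nat); simpl; lra.
      + apply IH; [lra|]. intros n h; apply (Hn (S n)); rewrite S_INR; lra. }
  intros Hn.
  destruct (nfloor_ex (Rabs x)) as [m Hm]; [apply Rabs_pos|].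
  apply (H (S m)); auto. rewrite S_INR.
  assert (- x <= Rabs x) by (rewrite <- Rabs_Ropp; apply Rle_abs). lra.
Qed.

(** The zeros of 1/Gamma are simple. At such a zero the differentiated recurrence loses its first
    term and only multiplies the derivative by a nonzero integer. This makes the Wronskian nonzero
    at positive integer order. *)
Lemma drgamma_nonpos_int (n : nat) : drgamma (- INR n) <> 0.
Proof.
  induction n as [|n IH].
  - rewrite drgamma_rec. simpl. replace (-0 + 1) with 1 by ring.
    replace (rgamma 1 + -0 * drgamma 1) with (rgamma 1) by ring.
    apply Rgt_not_eq, rgamma_pos; lra.
  - rewrite drgamma_rec. replace (- INR (S n) + 1) with (- INR n) by (rewrite S_INR; ring).
    rewrite rgamma_nonpos_int, Rplus_0_l.
    apply Rmult_integral_contrapositive; split; auto.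
    rewrite S_INR; pose proof (pos_INR n); lra.
Qed.

(** * Bessel functions as Frobenius series *)

Lemma is_derive_eq (f : R -> R) (x l l' : R) : is_derive f x l -> l = l' -> is_derive f x l'.
Proof. intros H <-; exact H. Qed.

Lemma is_derive_mult_R (f g : R -> R) (x df dg : R) :
  is_derive f x df -> is_derive g x dg ->
  is_derive (fun y => f y * g y) x (df * g x + f x * dg).
Proof. intros Hf Hg. apply (is_derive_mult f g x df dg Hf Hg Rmult_comm). Qed.

Lemma is_derive_plus_R (f g : R -> R) (x df dg : R) :
  is_derive f x df -> is_derive g x dg -> is_derive (fun y => f y + g y) x (df + dg).
Proof. intros Hf Hg. apply (is_derive_plus f g x df dg Hf Hg). Qed.

Lemma is_derive_minus_R (f g : R -> R) (x df dg : R) :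
  is_derive f x df -> is_derive g x dg -> is_derive (fun y => f y - g y) x (df - dg).
Proof. intros Hf Hg. apply (is_derive_minus f g x df dg Hf Hg). Qed.

Lemma is_derive_comp_R (f g : R -> R) (x df dg : R) :
  is_derive f (g x) df -> is_derive g x dg -> is_derive (fun y => f (g y)) x (dg * df).
Proof. intros Hf Hg. apply (is_derive_comp f g x df dg Hf Hg). Qed.

Lemma is_derive_ext_pos (f g : R -> R) (x l : R) : 0 < x ->
  (forall y, 0 < y -> f y = g y) -> is_derive f x l -> is_derive g x l.
Proof.
  intros Hx H. apply is_derive_ext_loc.
  exists (mkposreal x Hx). intros y Hy. apply H.
  apply Rabs_lt_between in Hy. unfold minus, plus, opp in Hy; simpl in Hy. lra.
Qed.

(** Domination by an exponential series. Unlike an infinite radius of convergence, it is an explicit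
    bound, which survives multiplication by polynomials in [k] after enlarging [rho]. *)
Definition entire_coef (c : nat -> R) : Prop :=
  exists B rho, 0 <= B /\ 0 <= rho /\ forall k, Rabs (c k) <= B * (rho ^ k / INR (fact k)).

Lemma ex_series_exp (x : R) : ex_series (fun k => x ^ k / INR (fact k)).
Proof.
  exists (exp x). generalize (is_exp_Reals x). unfold is_pseries.
  apply is_series_ext. intros n. unfold scal; simpl; unfold mult; simpl.
  rewrite pow_n_pow. reflexivity.
Qed.

Lemma pow_div_fact_pos (x : R) (k : nat) : 0 <= x -> 0 <= x ^ k / INR (fact k).
Proof.
  intros Hx. apply Rmult_le_pos; [apply pow_le; auto|].
  left; apply Rinv_0_lt_compat, INR_fact_lt_0.
Qed.

Lemma entire_ex_series_Rabs (c : nat -> R) (x : R) :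
  entire_coef c -> ex_series (fun k => Rabs (c k) * Rabs x ^ k).
Proof.
  intros [B [rho [HB [Hr H]]]].
  apply ex_series_le_R with (fun k => B * ((rho * Rabs x) ^ k / INR (fact k))).
  - intros k. rewrite Rabs_mult, Rabs_Rabsolu, (Rabs_pos_eq (_ ^ _)) by (apply pow_le, Rabs_pos).
    rewrite Rpow_mult_distr.
    replace (B * (rho ^ k * Rabs x ^ k / INR (fact k))) with
      (B * (rho ^ k / INR (fact k)) * Rabs x ^ k) by (unfold Rdiv; ring).
    apply Rmult_le_compat_r; [apply pow_le, Rabs_pos | auto].
  - apply ex_series_scal_R, ex_series_exp.
Qed.

Lemma entire_CV_radius (c : nat -> R) (x : R) :
  entire_coef c -> Rbar_lt (Rabs x) (CV_radius c).
Proof.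
  (* Bounded terms at a point only give a weak inequality for the radius, hence the point
     [|x| + 1]. *)
  intros H. apply Rbar_lt_le_trans with (Finite (Rabs x + 1)); [simpl; lra|].
  destruct (CV_radius_bounded c) as [HU _]. apply HU.
  pose proof (entire_ex_series_Rabs c (Rabs x + 1) H) as Hs.
  apply ex_series_lim_0 in Hs.
  destruct (filterlim_bounded (K := R_AbsRing) (V := R_NormedModule)
    (fun k => Rabs (c k) * Rabs (Rabs x + 1) ^ k)) as [M HM].
  { exists 0; exact Hs. }
  exists M. intros n. specialize (HM n).
  unfold norm in HM; simpl in HM. unfold abs in HM; simpl in HM.
  rewrite Rabs_mult, <- RPow_abs. rewrite Rabs_mult, Rabs_Rabsolu, <- RPow_abs, !Rabs_Rabsolu in HM.
  exact HM.
Qed.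

Lemma entire_ex_pseries (c : nat -> R) (x : R) : entire_coef c -> ex_pseries c x.
Proof. intros H; apply CV_radius_inside, entire_CV_radius, H. Qed.

Ltac ex_pseries_tac :=
  lazymatch goal with
  | |- ex_pseries (PS_plus _ _) _ =>
      apply (ex_pseries_plus (K := R_AbsRing) (V := R_NormedModule)); ex_pseries_tac
  | |- ex_pseries (PS_scal _ _) _ => apply ex_pseries_scal; [apply Rmult_comm | ex_pseries_tac]
  | |- ex_pseries (PS_incr_1 _) _ => apply ex_pseries_incr_1; ex_pseries_tac
  | _ => apply entire_ex_pseries; assumption
  end.

(** The action of [x d/dx] on [frob a c]: each power [(x/2)^(2k+a)] is an eigenfunction with
    eigenvalue [a + 2 k]. *)
Definition theta_coef (a : R) (c : nat -> R) (k : nat) : R := (a + 2 * INR k) * c k.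

Lemma INR_le_pow2 (k : nat) : 1 + INR k <= 2 ^ k.
Proof.
  induction k as [|k IH]; [simpl; lra|].
  rewrite S_INR. simpl. pose proof (pos_INR k). lra.
Qed.

Lemma entire_theta (a : R) (c : nat -> R) : entire_coef c -> entire_coef (theta_coef a c).
Proof.
  intros [B [rho [HB [Hr H]]]].
  exists ((Rabs a + 2) * B), (2 * rho).
  pose proof (Rabs_pos a) as Ha.
  repeat split; [nra | lra |].
  intros k. unfold theta_coef. rewrite Rabs_mult.
  rewrite Rpow_mult_distr.
  replace ((Rabs a + 2) * B * (2 ^ k * rho ^ k / INR (fact k))) with
    (((Rabs a + 2) * 2 ^ k) * (B * (rho ^ k / INR (fact k)))) by (unfold Rdiv; ring).
  apply Rmult_le_compat; try apply Rabs_pos; auto.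
  eapply Rle_trans; [apply Rabs_triang|].
  pose proof (INR_le_pow2 k). pose proof (pos_INR k).
  rewrite (Rabs_pos_eq (2 * INR k)) by lra. nra.
Qed.

(* [frob a c x = sum_k c_k (x/2)^(2k+a)] *)
Definition frob (a : R) (c : nat -> R) (x : R) : R :=
  Rpower (x / 2) a * PSeries c ((x / 2) ^ 2).

Lemma is_derive_Rpower_half (a x : R) : 0 < x ->
  is_derive (fun x => Rpower (x / 2) a) x (a / x * Rpower (x / 2) a).
Proof.
  intros Hx. unfold Rpower, Rdiv. auto_derive; [lra|]. field. lra.
Qed.

Lemma PSeries_theta (a : R) (c : nat -> R) (s : R) : entire_coef c ->
  PSeries (theta_coef a c) s = a * PSeries c s + 2 * (s * PSeries (PS_derive c) s).
Proof.
  intros H. rewrite <- PSeries_incr_1, <- !PSeries_scal, <- PSeries_plus.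
  - apply PSeries_ext. intros k. unfold theta_coef, PS_plus, PS_scal, PS_incr_1, PS_derive.
    unfold plus, scal; simpl; unfold mult; simpl.
    destruct k as [|k]; unfold zero; simpl; [ring|].
    destruct k; simpl; ring.
  - apply ex_pseries_scal; [apply Rmult_comm | apply entire_ex_pseries, H].
  - apply ex_pseries_scal; [apply Rmult_comm |].
    apply ex_pseries_incr_1. apply CV_radius_inside. rewrite CV_radius_derive.
    apply entire_CV_radius, H.
Qed.

Lemma is_derive_frob (a : R) (c : nat -> R) (x : R) : entire_coef c -> 0 < x ->
  is_derive (frob a c) x (frob a (theta_coef a c) x / x).
Proof.
  intros Hc Hx. unfold frob.
  eapply is_derive_eq.
  - apply is_derive_mult_R; [apply is_derive_Rpower_half, Hx|].
    apply (is_derive_comp_R (PSeries c) (fun x => (x / 2) ^ 2)).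
    + apply is_derive_PSeries, entire_CV_radius, Hc.
    + auto_derive; [auto | reflexivity].
  - rewrite PSeries_theta by auto. simpl. field. lra.
Qed.

Definition coefJ (a : R) (k : nat) : R := (-1) ^ k / INR (fact k) * rgamma (INR k + a + 1).
(** The derivative of [coefJ a k] in the order [a]. *)
Definition coefQ (a : R) (k : nat) : R := (-1) ^ k / INR (fact k) * drgamma (INR k + a + 1).

Lemma Rabs_pow_m1 (k : nat) : Rabs ((-1) ^ k) = 1.
Proof. apply pow_1_abs. Qed.

(* The bound is uniform in the order, which is what differentiation in the order needs. *)
Lemma coefJQ_bound (a : R) : exists B, 0 <= B /\ forall b k, Rabs (b - a) < 1 ->
  Rabs (coefJ b k) <= B * (1 ^ k / INR (fact k)) /\
  Rabs (coefQ b k) <= B * (1 ^ k / INR (fact k)).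
Proof.
  destruct (nfloor_ex (Rabs a)) as [m Hm]; [apply Rabs_pos|].
  destruct (rgamma_bound (S m)) as [B [HB H]].
  exists B; split; auto. intros b k Hb.
  destruct (H (INR k + b + 1)) as [H1 H2].
  { rewrite S_INR. pose proof (pos_INR k). apply Rabs_lt_between in Hb.
    assert (- a <= Rabs a) by (rewrite <- Rabs_Ropp; apply Rle_abs). lra. }
  unfold coefJ, coefQ, Rdiv. pose proof (INR_fact_lt_0 k) as Hf.
  assert (Hf' : 0 < / INR (fact k)) by (apply Rinv_0_lt_compat; auto).
  rewrite !Rabs_mult, Rabs_pow_m1, pow1, (Rabs_pos_eq (/ _)) by lra.
  split; rewrite !Rmult_1_l, Rmult_comm; apply Rmult_le_compat_r; lra.
Qed.

Lemma entire_coefJ (a : R) : entire_coef (coefJ a).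
Proof.
  destruct (coefJQ_bound a) as [B [HB H]]. exists B, 1. repeat split; try lra.
  intros k; apply (H a k). replace (a - a) with 0 by ring; rewrite Rabs_R0; lra.
Qed.

Lemma entire_coefQ (a : R) : entire_coef (coefQ a).
Proof.
  destruct (coefJQ_bound a) as [B [HB H]]. exists B, 1. repeat split; try lra.
  intros k; apply (H a k). replace (a - a) with 0 by ring; rewrite Rabs_R0; lra.
Qed.

Lemma BesselJ_frob (a x : R) : 0 < x -> BesselJ a x = frob a (coefJ a) x.
Proof.
  intros Hx. unfold BesselJ, frob, PSeries. rewrite <- Series_scal_l.
  apply Series_ext. intros k. fold (coefJ a k).
  rewrite Rpower_plus.
  replace (2 * INR k) with (INR (2 * k)) by (rewrite mult_INR; simpl; ring).
  rewrite Rpower_pow, pow_mult by lra. ring.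
Qed.

(* With [f1 = x f'], Bessel's equation is [x f1' = (nu^2 - x^2) f]. *)
Definition bessel_sol (nu : R) (f f1 : R -> R) : Prop :=
  forall x, 0 < x ->
    is_derive f x (f1 x / x) /\ is_derive f1 x ((nu ^ 2 - x ^ 2) * f x / x).

(** The factor [INR (S k) + a] stays on the left because it vanishes at some [k] when [a] is a
    negative integer; in this form the recurrence holds for every order. *)
Lemma coefJ_rec (a : R) (k : nat) :
  INR (S k) * (INR (S k) + a) * coefJ a (S k) = - coefJ a k.
Proof.
  unfold coefJ. rewrite (rgamma_rec (INR k + a + 1)), fact_simpl, mult_INR.
  replace (INR (S k) + a + 1) with (INR k + a + 1 + 1) by (rewrite S_INR; ring).
  rewrite S_INR. pose proof (pos_INR k). simpl. field.
  split; [apply INR_fact_neq_0 | lra].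
Qed.

(** This is [coefJ_rec] differentiated in [a]; the last term comes from the factor
    [INR (S k) + a]. *)
Lemma coefQ_rec (a : R) (k : nat) :
  INR (S k) * (INR (S k) + a) * coefQ a (S k) = - coefQ a k - INR (S k) * coefJ a (S k).
Proof.
  unfold coefQ, coefJ. rewrite (drgamma_rec (INR k + a + 1)), fact_simpl, mult_INR.
  replace (INR (S k) + a + 1) with (INR k + a + 1 + 1) by (rewrite S_INR; ring).
  rewrite S_INR. pose proof (pos_INR k). simpl. field.
  split; [apply INR_fact_neq_0 | lra].
Qed.

(** Since [(a + 2k)^2 = a^2 + 4 k (k + a)], the recurrence turns the second part into
    [-4 (x/2)^2 = -x^2] times the series and a source [d]. The source is 0 for [coefJ] and
    [INR k * coefJ a k] for [coefQ]. *)
Lemma frob_theta2 (a : R) (c d : nat -> R) (x : R) : 0 < x ->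
  entire_coef c -> entire_coef d -> d 0%nat = 0 ->
  (forall k, INR (S k) * (INR (S k) + a) * c (S k) = - c k - d (S k)) ->
  frob a (theta_coef a (theta_coef a c)) x =
  (a ^ 2 - x ^ 2) * frob a c x - 4 * frob a d x.
Proof.
  intros Hx Hc Hd H0 H. unfold frob.
  assert (E : PSeries (theta_coef a (theta_coef a c)) ((x / 2) ^ 2) =
    a ^ 2 * PSeries c ((x / 2) ^ 2) +
    ((-4) * ((x / 2) ^ 2 * PSeries c ((x / 2) ^ 2)) + (-4) * PSeries d ((x / 2) ^ 2))).
  { rewrite <- PSeries_incr_1, <- !PSeries_scal, <- !PSeries_plus.
    - apply PSeries_ext. intros k. unfold theta_coef, PS_plus, PS_scal, PS_incr_1.
      unfold plus, scal; simpl; unfold mult; simpl.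
      destruct k as [|k].
      + rewrite H0. unfold zero; simpl. ring.
      + specialize (H k).
        transitivity (a ^ 2 * c (S k) + 4 * (INR (S k) * (INR (S k) + a) * c (S k)));
          [change (match k with O => 1 | S _ => INR k + 1 end) with (INR (S k)); ring|].
        rewrite H. ring.
    - ex_pseries_tac.
    - ex_pseries_tac.
    - ex_pseries_tac.
    - ex_pseries_tac. }
  rewrite E. field.
Qed.

Lemma entire_zero : entire_coef (fun _ => 0).
Proof.
  exists 0, 0. repeat split; try lra. intros k. rewrite Rabs_R0; lra.
Qed.

Lemma frob_zero (a x : R) : frob a (fun _ => 0) x = 0.
Proof.
  unfold frob. rewrite PSeries_const_0. ring.
Qed.

Lemma frob_coefJ_sol (a : R) :
  bessel_sol a (frob a (coefJ a)) (frob a (theta_coef a (coefJ a))).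
Proof.
  intros x Hx. pose proof (entire_coefJ a) as HJ. split.
  - apply is_derive_frob; auto.
  - eapply is_derive_eq; [apply is_derive_frob; auto using entire_theta|].
    rewrite (frob_theta2 a (coefJ a) (fun _ => 0)); auto using entire_zero.
    + rewrite frob_zero. f_equal. ring.
    + intros k. rewrite coefJ_rec. ring.
Qed.

(** Bessel's equation with a source, as expected from differentiating the equation of [coefJ] in the
    order. The source [4 k c_k] is rewritten through [x d/dx], as [2 (a + 2k) - 2 a]. *)
Lemma is_derive_frob_coefQ (a : R) (x : R) : 0 < x ->
  is_derive (frob a (theta_coef a (coefQ a))) x
    (((a ^ 2 - x ^ 2) * frob a (coefQ a) x
      - 2 * frob a (theta_coef a (coefJ a)) x + 2 * a * frob a (coefJ a) x) / x).
Proof.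
  intros Hx. pose proof (entire_coefJ a) as HJ. pose proof (entire_coefQ a) as HQ.
  eapply is_derive_eq; [apply is_derive_frob; auto using entire_theta|].
  set (d := fun k => INR k * coefJ a k).
  assert (Hd : entire_coef d).
  { destruct (entire_theta 0 _ HJ) as [B [rho [HB [Hr H]]]].
    exists B, rho. repeat split; auto. intros k.
    eapply Rle_trans; [|apply H]. unfold d, theta_coef.
    rewrite !Rabs_mult. apply Rmult_le_compat_r; [apply Rabs_pos|].
    pose proof (pos_INR k). rewrite !Rabs_pos_eq by lra. lra. }
  rewrite (frob_theta2 a (coefQ a) d); auto.
  - assert (E : 4 * frob a d x = 2 * frob a (theta_coef a (coefJ a)) x - 2 * a * frob a (coefJ a) x).
    { unfold frob.
      assert (E : PSeries (theta_coef a (coefJ a)) ((x / 2) ^ 2) =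
        a * PSeries (coefJ a) ((x / 2) ^ 2) + 2 * PSeries d ((x / 2) ^ 2)).
      { rewrite <- !PSeries_scal, <- PSeries_plus.
        - apply PSeries_ext. intros k. unfold theta_coef, PS_plus, PS_scal, d.
          unfold plus, scal; simpl; unfold mult; simpl. ring.
        - apply ex_pseries_scal; [apply Rmult_comm | apply entire_ex_pseries, HJ].
        - apply ex_pseries_scal; [apply Rmult_comm | apply entire_ex_pseries, Hd]. }
      rewrite E. ring. }
    rewrite E. unfold Rdiv. ring.
  - unfold d; simpl; ring.
  - intros k. rewrite coefQ_rec. reflexivity.
Qed.

Lemma bessel_sol_comb (nu : R) (f f1 g g1 : R -> R) (l m : R) :
  bessel_sol nu f f1 -> bessel_sol nu g g1 ->
  bessel_sol nu (fun x => l * f x + m * g x) (fun x => l * f1 x + m * g1 x).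
Proof.
  intros Hf Hg x Hx. destruct (Hf x Hx) as [F F1]. destruct (Hg x Hx) as [G G1]. split.
  - eapply is_derive_eq; [apply is_derive_plus_R; apply is_derive_scal; eassumption|].
    unfold Rdiv; ring.
  - eapply is_derive_eq; [apply is_derive_plus_R; apply is_derive_scal; eassumption|].
    unfold Rdiv; ring.
Qed.

Lemma bessel_sol_ext (nu : R) (f f1 g g1 : R -> R) :
  (forall x, 0 < x -> f x = g x) -> (forall x, 0 < x -> f1 x = g1 x) ->
  bessel_sol nu f f1 -> bessel_sol nu g g1.
Proof.
  intros E E1 H x Hx. destruct (H x Hx) as [F F1].
  rewrite <- E, <- E1 by auto. split.
  - apply is_derive_ext_pos with f; auto.
  - apply is_derive_ext_pos with f1; auto.
Qed.

Lemma bessel_sol_order_opp (nu : R) (f f1 : R -> R) :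
  bessel_sol (- nu) f f1 -> bessel_sol nu f f1.
Proof.
  intros H x Hx. destruct (H x Hx) as [F F1]. split; auto.
  eapply is_derive_eq; [exact F1|]. f_equal. ring.
Qed.

Lemma is_derive_zero_const (f : R -> R) :
  (forall x, 0 < x -> is_derive f x 0) -> forall x y, 0 < x -> 0 < y -> f x = f y.
Proof.
  intros H.
  assert (L : forall x y, 0 < x -> x < y -> f x = f y).
  { intros x y Hx Hxy. apply (eq_is_derive (V := R_NormedModule) f x y); auto.
    intros t Ht. apply H; lra. }
  intros x y Hx Hy. destruct (Rtotal_order x y) as [h|[->|h]]; auto.
  symmetry; auto.
Qed.

Lemma bessel_wronskian_const (nu : R) (f f1 g g1 : R -> R) :
  bessel_sol nu f f1 -> bessel_sol nu g g1 ->
  forall x y, 0 < x -> 0 < y -> f x * g1 x - g x * f1 x = f y * g1 y - g y * f1 y.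
Proof.
  intros Hf Hg. apply (is_derive_zero_const (fun x => f x * g1 x - g x * f1 x)).
  intros x Hx. destruct (Hf x Hx) as [F F1]. destruct (Hg x Hx) as [G G1].
  eapply is_derive_eq; [apply is_derive_minus_R; apply is_derive_mult_R; eassumption|].
  field. lra.
Qed.

(** Evaluates a constant Wronskian at the singular point 0, where the Bessel functions have no value
    but the power series in [(x/2)^2] do. *)
Lemma const_continuous_0 (Phi : R -> R) (K : R) : continuity_pt Phi 0 ->
  (forall x, 0 < x -> Phi ((x / 2) ^ 2) = K) -> Phi 0 = K.
Proof.
  intros HC H.
  assert (HP : forall s, 0 < s -> Phi s = K).
  { intros s Hs. rewrite <- (H (2 * sqrt s)).
    - f_equal. replace (2 * sqrt s / 2) with (sqrt s) by field.
      rewrite pow2_sqrt; lra.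
    - pose proof (sqrt_lt_R0 s Hs). lra. }
  destruct (Req_dec (Phi 0) K) as [|Hne]; auto. exfalso.
  destruct (HC (Rabs (Phi 0 - K))) as [d [Hd Hc]].
  { apply Rabs_pos_lt. lra. }
  specialize (Hc (d / 2)). simpl in Hc. unfold Rdist in Hc.
  rewrite HP in Hc by lra.
  rewrite (Rabs_minus_sym K) in Hc.
  assert (Rabs (Phi 0 - K) < Rabs (Phi 0 - K)); [|lra].
  apply Hc. split.
  - split; [exact I | lra].
  - rewrite Rminus_0_r, Rabs_pos_eq; lra.
Qed.

Lemma continuity_PSeries (c : nat -> R) (x : R) : entire_coef c -> continuity_pt (PSeries c) x.
Proof. intros H; apply PSeries_continuity, entire_CV_radius, H. Qed.

Lemma Rpower_opp_mult (p a : R) : Rpower p a * Rpower p (- a) = 1.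
Proof. rewrite <- Rpower_plus, Rplus_opp_r. unfold Rpower. rewrite Rmult_0_l. apply exp_0. Qed.

(** The powers [(x/2)^nu] and [(x/2)^(-nu)] cancel, leaving a power series whose value at 0 is
    [-2 nu rgamma (nu + 1) rgamma (1 - nu)]. Non-integrality keeps the last factor away from the
    zeros of [rgamma]. *)
Lemma wronskian_coefJ_neq_0 (nu x : R) : 0 < nu -> (forall n : Z, nu <> IZR n) -> 0 < x ->
  frob nu (coefJ nu) x * frob (- nu) (theta_coef (- nu) (coefJ (- nu))) x
  - frob (- nu) (coefJ (- nu)) x * frob nu (theta_coef nu (coefJ nu)) x <> 0.
Proof.
  intros Hnu Hint Hx.
  pose proof (entire_coefJ nu) as H1. pose proof (entire_coefJ (- nu)) as H2.
  set (Phi := fun s => PSeries (coefJ nu) s * PSeries (theta_coef (- nu) (coefJ (- nu))) s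
    - PSeries (coefJ (- nu)) s * PSeries (theta_coef nu (coefJ nu)) s).
  set (W := fun x => frob nu (coefJ nu) x * frob (- nu) (theta_coef (- nu) (coefJ (- nu))) x
    - frob (- nu) (coefJ (- nu)) x * frob nu (theta_coef nu (coefJ nu)) x).
  change (W x <> 0).
  assert (HW : forall y, 0 < y -> W y = W x).
  { intros y Hy. unfold W. apply (bessel_wronskian_const nu); auto.
    - apply frob_coefJ_sol.
    - apply bessel_sol_order_opp, frob_coefJ_sol. }
  assert (HP : Phi 0 = W x).
  { apply (const_continuous_0 Phi (W x)).
    - unfold Phi. apply continuity_pt_minus; apply continuity_pt_mult;
        apply continuity_PSeries; auto using entire_theta.
    - intros y Hy. rewrite <- (HW y Hy). unfold W, Phi, frob.
      pose proof (Rpower_opp_mult (y / 2) nu) as E.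
      match goal with |- ?a * ?b - ?c * ?d = _ =>
        transitivity ((a * b - c * d) * (Rpower (y / 2) nu * Rpower (y / 2) (- nu))); [rewrite E|]; ring end. }
  rewrite <- HP. unfold Phi. rewrite !PSeries_0. unfold theta_coef.
  assert (N1 : coefJ nu 0 <> 0).
  { unfold coefJ. simpl. rewrite Rdiv_1_r, Rmult_1_l. apply Rgt_not_eq, rgamma_pos. lra. }
  assert (N2 : coefJ (- nu) 0 <> 0).
  { unfold coefJ. simpl. rewrite Rdiv_1_r, Rmult_1_l. apply rgamma_neq_0.
    intros n Hn. apply (Hint (Z.of_nat n + 1)%Z). rewrite plus_IZR, <- INR_IZR_INZ. lra. }
  simpl INR.
  replace (coefJ nu 0 * ((- nu + 2 * 0) * coefJ (- nu) 0) - coefJ (- nu) 0 * ((nu + 2 * 0) * coefJ nu 0))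
    with ((-2 * nu) * (coefJ nu 0 * coefJ (- nu) 0)) by ring.
  apply Rmult_integral_contrapositive; split; [lra|].
  apply Rmult_integral_contrapositive; auto.
Qed.

(** * Integer order *)

Lemma rgamma_succ_fact (k : nat) : rgamma (INR k + 1) * INR (fact k) = rgamma 1.
Proof.
  induction k as [|k IH].
  - simpl. replace (0 + 1) with 1 by ring. ring.
  - rewrite <- IH, (rgamma_rec (INR k + 1)), fact_simpl, mult_INR, S_INR. ring.
Qed.

Lemma coefJ_opp_small (n k : nat) : (k < n)%nat -> coefJ (- INR n) k = 0.
Proof.
  intros H. unfold coefJ.
  replace (INR k + - INR n + 1) with (- INR (n - k - 1)).
  - rewrite rgamma_nonpos_int; ring.
  - rewrite !minus_INR by lia. simpl; ring.
Qed.

Lemma coefJ_opp_shift (n k : nat) : coefJ (- INR n) (n + k) = (-1) ^ n * coefJ (INR n) k.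
Proof.
  unfold coefJ.
  pose proof (rgamma_succ_fact k) as H1. pose proof (rgamma_succ_fact (n + k)) as H2.
  replace (INR (n + k) + - INR n + 1) with (INR k + 1) by (rewrite plus_INR; ring).
  replace (INR k + INR n + 1) with (INR (n + k) + 1) by (rewrite plus_INR; ring).
  rewrite <- H1 in H2.
  rewrite pow_add.
  pose proof (INR_fact_neq_0 k). pose proof (INR_fact_neq_0 (n + k)).
  apply (Rmult_eq_reg_r (INR (fact k) * INR (fact (n + k)))).
  2: { apply Rmult_integral_contrapositive; auto. }
  transitivity ((-1) ^ n * (-1) ^ k * (rgamma (INR k + 1) * INR (fact k))); [field; auto|].
  rewrite <- H2. field; auto.
Qed.

Lemma PS_incr_n_shift (a : nat -> R) (n k : nat) :
  PS_incr_n (V := R_NormedModule) a n (n + k) = a k.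
Proof. induction n as [|n IH]; simpl; auto. Qed.

Lemma PS_incr_n_small (a : nat -> R) (n k : nat) : (k < n)%nat ->
  PS_incr_n (V := R_NormedModule) a n k = 0.
Proof.
  revert k; induction n as [|n IH]; intros k H; [lia|].
  destruct k as [|k]; simpl; [reflexivity|]. apply IH; lia.
Qed.

(** The first [n] coefficients at order [-n] vanish with 1/Gamma. The others are those at order [n],
    shifted by [n], and the shift contributes the [(x/2)^(2n)] that turns [(x/2)^(-n)] into
    [(x/2)^n]. *)
Lemma frob_coefJ_opp (n : nat) (x : R) : 0 < x ->
  frob (- INR n) (coefJ (- INR n)) x = (-1) ^ n * frob (INR n) (coefJ (INR n)) x.
Proof.
  intros Hx. unfold frob.
  assert (E : PSeries (coefJ (- INR n)) ((x / 2) ^ 2) =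
    ((x / 2) ^ 2) ^ n * ((-1) ^ n * PSeries (coefJ (INR n)) ((x / 2) ^ 2))).
  { rewrite <- PSeries_scal, <- PSeries_incr_n. apply PSeries_ext. intros k.
    destruct (le_lt_dec n k) as [h|h].
    - replace k with (n + (k - n))%nat by lia.
      rewrite PS_incr_n_shift, coefJ_opp_shift. reflexivity.
    - rewrite PS_incr_n_small, coefJ_opp_small by auto. reflexivity. }
  rewrite E. pose proof (Rpower_opp_mult (x / 2) (INR n)) as E2.
  rewrite <- pow_mult, Nat.mul_comm, pow_mult, <- (Rpower_pow n (x / 2)) by lra.
  replace (Rpower (x / 2) (INR n) ^ 2) with (Rpower (x / 2) (INR n) * Rpower (x / 2) (INR n)) by ring.
  match goal with |- Rpower (x/2) (- INR n) * (_ * _ * (?e * ?P)) = _ =>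
    transitivity ((Rpower (x / 2) (INR n) * Rpower (x / 2) (- INR n)) * (e * (Rpower (x / 2) (INR n) * P)));
    [ring | rewrite E2; ring] end.
Qed.

Lemma cos_INR_PI (n : nat) : cos (INR n * PI) = (-1) ^ n.
Proof.
  induction n as [|n IH].
  - simpl. rewrite Rmult_0_l. apply cos_0.
  - rewrite S_INR. replace ((INR n + 1) * PI) with (INR n * PI + PI) by ring.
    rewrite neg_cos, IH. simpl. ring.
Qed.

Lemma sin_INR_PI (n : nat) : sin (INR n * PI) = 0.
Proof. apply sin_eq_0_1. exists (Z.of_nat n). rewrite <- INR_IZR_INZ. reflexivity. Qed.

Lemma pow_m1_sqr (n : nat) : (-1) ^ n * (-1) ^ n = 1.
Proof. rewrite <- Rpow_mult_distr. replace (-1 * -1) with 1 by ring. apply pow1. Qed.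

Definition dJorder (a x : R) : R := ln (x / 2) * frob a (coefJ a) x + frob a (coefQ a) x.

Lemma is_derive_frob_order (a x : R) : 0 < x ->
  is_derive (fun a => frob a (coefJ a) x) a (dJorder a x).
Proof.
  intros Hx. unfold dJorder, frob. set (s := (x / 2) ^ 2).
  eapply is_derive_eq.
  - apply is_derive_mult_R.
    + unfold Rpower. auto_derive; [auto | reflexivity].
    + destruct (coefJQ_bound a) as [B [HB H]].
      apply (is_derive_Series (fun k a => coefJ a k * s ^ k) (fun k a => coefQ a k * s ^ k)
        (fun k => B * (s ^ k / INR (fact k))) a 1); [lra | | | |].
      * intros k b _. unfold coefJ, coefQ.
        eapply is_derive_eq.
        -- apply is_derive_mult_R; [|apply is_derive_const].
           apply is_derive_scal.
           apply (is_derive_comp_R rgamma (fun b => INR k + b + 1)); [apply is_derive_rgamma|].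
           auto_derive; auto.
        -- unfold zero; simpl. ring.
      * intros k b Hb. rewrite Rabs_mult.
        assert (Hs : 0 <= s ^ k) by (apply pow_le; unfold s; apply pow2_ge_0).
        rewrite (Rabs_pos_eq (s ^ k)) by auto.
        destruct (H b k Hb) as [_ H2]. rewrite pow1 in H2.
        replace (B * (s ^ k / INR (fact k))) with (B * (1 / INR (fact k)) * s ^ k) by (unfold Rdiv; ring).
        apply Rmult_le_compat_r; auto.
      * apply ex_series_scal_R, ex_series_exp.
      * apply ex_series_ext with (fun k => scal (pow_n s k) (coefJ a k)).
        { intros k. rewrite pow_n_pow. unfold scal; simpl; unfold mult; simpl. ring. }
        apply (entire_ex_pseries (coefJ a) s), entire_coefJ.
  - unfold PSeries, Rpower. ring.
Qed.

Lemma is_lim_diff_quot (f : R -> R) (x l : R) :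
  is_derive f x l -> is_lim (fun y => (f y - f x) / (y - x)) x l.
Proof.
  intros H. apply is_derive_Reals in H.
  intros P [eps HP]. destruct (H eps (cond_pos eps)) as [d Hd].
  exists d. intros y Hy Hne. apply HP.
  specialize (Hd (y - x)). rewrite Rplus_minus in Hd.
  apply Hd; [apply Rminus_eq_contra; exact Hne | exact Hy].
Qed.

(** L'Hopital's rule at a common zero from the derivatives at that point alone, as a quotient of
    difference quotients. *)
Lemma is_lim_quot_zero (f g : R -> R) (x l m : R) :
  is_derive f x l -> is_derive g x m -> f x = 0 -> g x = 0 -> m <> 0 ->
  is_lim (fun y => f y / g y) x (l / m).
Proof.
  intros Hf Hg f0 g0 Hm.
  apply is_lim_ext_loc with (fun y => ((f y - f x) / (y - x)) / ((g y - g x) / (y - x))).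
  - exists (mkposreal 1 Rlt_0_1). intros y _ Hne. rewrite f0, g0, !Rminus_0_r.
    (* Inversion is total, so the cancellation also covers points where [g y = 0]. *)
    unfold Rdiv. rewrite Rinv_mult, Rinv_inv.
    replace (f y * / (y - x) * (/ g y * (y - x))) with (f y * / g y * (/ (y - x) * (y - x))) by ring.
    rewrite Rinv_l by lra. ring.
  - apply (is_lim_div _ _ x l m).
    + apply is_lim_diff_quot; auto.
    + apply is_lim_diff_quot; auto.
    + intros E; inversion E; auto.
    + simpl. auto.
Qed.

(** The part of [BesselY] at integer order that carries no logarithm; [frobZ1] is [x] times its
    derivative. *)
Definition frobZ (n : nat) (x : R) : R :=
  / PI * (frob (INR n) (coefQ (INR n)) x + (-1) ^ n * frob (- INR n) (coefQ (- INR n)) x).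

Definition frobZ1 (n : nat) (x : R) : R :=
  / PI * (frob (INR n) (theta_coef (INR n) (coefQ (INR n))) x
    + (-1) ^ n * frob (- INR n) (theta_coef (- INR n) (coefQ (- INR n))) x).

(** L'Hopital in the order, where the sine has a simple zero. The derivatives of [BesselJ] at the
    orders [n] and [-n] both enter, and their logarithmic parts add up because the two functions
    agree up to [(-1)^n]; hence the factor 2. *)
Lemma BesselY_INR (n : nat) (x : R) : 0 < x ->
  BesselY (INR n) x = 2 / PI * ln (x / 2) * frob (INR n) (coefJ (INR n)) x + frobZ n x.
Proof.
  intros Hx. unfold BesselY.
  destruct (excluded_middle_informative (exists m : Z, INR n = IZR m)) as [_|h].
  2: { exfalso; apply h. exists (Z.of_nat n). apply INR_IZR_INZ. }
  pose proof PI_RGT_0 as HPI.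
  assert (Hm1 : (-1) ^ n <> 0) by (apply pow_nonzero; lra).
  assert (D1 : forall a, is_derive (fun a => BesselJ a x) a (dJorder a x)).
  { intros a. eapply is_derive_ext; [|apply is_derive_frob_order, Hx].
    intros b; symmetry; apply BesselJ_frob, Hx. }
  assert (L : is_lim (fun mu => BesselY_quot mu x) (INR n)
    (((dJorder (INR n) x * (-1) ^ n) + dJorder (- INR n) x) / (PI * (-1) ^ n))).
  { unfold BesselY_quot.
    apply (is_lim_quot_zero (fun mu => BesselJ mu x * cos (mu * PI) - BesselJ (- mu) x)
      (fun mu => sin (mu * PI))).
    - eapply is_derive_eq.
      + apply is_derive_minus_R.
        * apply is_derive_mult_R; [apply D1|]. auto_derive; [auto|reflexivity].
        * apply (is_derive_comp_R (fun a => BesselJ a x) Ropp); [apply D1|].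
          auto_derive; [auto|reflexivity].
      + cbv beta. rewrite cos_INR_PI, sin_INR_PI. ring.
    - auto_derive; [auto|]. rewrite cos_INR_PI. ring.
    - rewrite cos_INR_PI, !BesselJ_frob, frob_coefJ_opp by auto. ring.
    - apply sin_INR_PI.
    - apply Rmult_integral_contrapositive; split; auto. lra. }
  rewrite (is_lim_unique _ _ _ L). simpl.
  unfold dJorder, frobZ. rewrite frob_coefJ_opp by auto.
  pose proof (pow_m1_sqr n) as E.
  apply (Rmult_eq_reg_r (PI * (-1) ^ n)).
  2: { apply Rmult_integral_contrapositive; split; auto. lra. }
  set (A := frob (INR n) (coefJ (INR n)) x). set (B := frob _ (coefQ (INR n)) x).
  set (D := frob _ (coefQ (- INR n)) x). set (l := ln (x / 2)).
  transitivity ((l * A + B) * (-1) ^ n + (l * ((-1) ^ n * A) + D)); [field; split; auto; lra|].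
  transitivity (2 * l * A * (-1) ^ n + B * (-1) ^ n + D * ((-1) ^ n * (-1) ^ n)); [rewrite E; ring|].
  field. lra.
Qed.

(** In [frobZ] the sources of the orders [n] and [-n] combine: the terms in [n] cancel and the terms
    in [x J'] double. What is left is cancelled by the cross terms from differentiating the
    logarithm. *)
Lemma BesselY_INR_sol (n : nat) :
  bessel_sol (INR n)
    (fun x => 2 / PI * ln (x / 2) * frob (INR n) (coefJ (INR n)) x + frobZ n x)
    (fun x => 2 / PI * (frob (INR n) (coefJ (INR n)) x
       + ln (x / 2) * frob (INR n) (theta_coef (INR n) (coefJ (INR n))) x) + frobZ1 n x).
Proof.
  pose proof PI_RGT_0 as HPI.
  intros x Hx.
  destruct (frob_coefJ_sol (INR n) x Hx) as [J0 J1].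
  destruct (frob_coefJ_sol (- INR n) x Hx) as [K0 _].
  assert (Hln : is_derive (fun x => ln (x / 2)) x (/ x)).
  { auto_derive; [lra|]. field; lra. }
  (* Obtained by differentiating [frob_coefJ_opp], by uniqueness of the derivative. *)
  assert (E : frob (- INR n) (theta_coef (- INR n) (coefJ (- INR n))) x =
    (-1) ^ n * frob (INR n) (theta_coef (INR n) (coefJ (INR n))) x).
  { assert (K : is_derive (frob (- INR n) (coefJ (- INR n))) x
      ((-1) ^ n * (frob (INR n) (theta_coef (INR n) (coefJ (INR n))) x / x))).
    { apply is_derive_ext_pos with (fun y => (-1) ^ n * frob (INR n) (coefJ (INR n)) y); auto.
      - intros y Hy; symmetry; apply frob_coefJ_opp, Hy.
      - apply is_derive_scal, J0. }
    apply is_derive_unique in K. apply is_derive_unique in K0. rewrite K0 in K.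
    apply (Rmult_eq_reg_r (/ x)); [|apply Rinv_neq_0_compat; lra].
    unfold Rdiv in K. rewrite K. ring. }
  assert (Z0 : is_derive (frobZ n) x (frobZ1 n x / x)).
  { unfold frobZ, frobZ1. eapply is_derive_eq.
    - apply is_derive_scal, is_derive_plus_R.
      + apply is_derive_frob; [apply entire_coefQ | auto].
      + apply is_derive_scal, is_derive_frob; [apply entire_coefQ | auto].
    - unfold Rdiv; ring. }
  assert (Z1 : is_derive (frobZ1 n) x
    (((INR n ^ 2 - x ^ 2) * frobZ n x
      - 4 / PI * frob (INR n) (theta_coef (INR n) (coefJ (INR n))) x) / x)).
  { unfold frobZ, frobZ1. eapply is_derive_eq.
    - apply is_derive_scal, is_derive_plus_R.
      + apply is_derive_frob_coefQ, Hx.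
      + apply is_derive_scal, is_derive_frob_coefQ, Hx.
    - rewrite E, frob_coefJ_opp by auto.
      pose proof (pow_m1_sqr n) as E2.
      set (A := frob (INR n) (coefJ (INR n)) x).
      set (A1 := frob (INR n) (theta_coef (INR n) (coefJ (INR n))) x).
      set (B := frob (INR n) (coefQ (INR n)) x). set (D := frob (- INR n) (coefQ (- INR n)) x).
      transitivity (/ PI * ((INR n ^ 2 - x ^ 2) * (B + (-1) ^ n * D) - 2 * A1 + 2 * INR n * A
        - 2 * ((-1) ^ n * (-1) ^ n) * A1 - 2 * INR n * ((-1) ^ n * (-1) ^ n) * A) / x);
        [field; split; lra|].
      rewrite E2. field; split; lra. }
  split.
  - eapply is_derive_eq.
    + apply is_derive_plus_R; [|exact Z0].
      apply is_derive_mult_R; [|exact J0]. apply is_derive_scal, Hln.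
    + cbv beta. field; split; lra.
  - eapply is_derive_eq.
    + apply is_derive_plus_R; [|exact Z1].
      apply is_derive_scal, is_derive_plus_R; [exact J0|].
      apply is_derive_mult_R; [exact Hln | exact J1].
    + cbv beta. field; split; lra.
Qed.

(* The Wronskian times [x] is a continuous function of [(x/2)^2]: the logarithms cancel, and
   its value at 0 is read off the leading coefficients. *)
Lemma wronskian_INR_neq_0 (n : nat) (x : R) : 0 < x ->
  let J := frob (INR n) (coefJ (INR n)) in
  let J1 := frob (INR n) (theta_coef (INR n) (coefJ (INR n))) in
  J x * (2 / PI * (J x + ln (x / 2) * J1 x) + frobZ1 n x)
  - (2 / PI * ln (x / 2) * J x + frobZ n x) * J1 x <> 0.
Proof.
  intros Hx J J1.
  pose proof PI_RGT_0 as HPI.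
  set (P := PSeries (coefJ (INR n))). set (P1 := PSeries (theta_coef (INR n) (coefJ (INR n)))).
  set (Q := PSeries (coefQ (INR n))). set (Q1 := PSeries (theta_coef (INR n) (coefQ (INR n)))).
  set (S := PSeries (coefQ (- INR n))). set (S1 := PSeries (theta_coef (- INR n) (coefQ (- INR n)))).
  set (Phi := fun s => 2 / PI * (s ^ n * (P s * P s)) + / PI * (s ^ n * (P s * Q1 s - Q s * P1 s))
    + / PI * (-1) ^ n * (P s * S1 s - S s * P1 s)).
  set (W := fun x => J x * (2 / PI * (J x + ln (x / 2) * J1 x) + frobZ1 n x)
    - (2 / PI * ln (x / 2) * J x + frobZ n x) * J1 x).
  change (W x <> 0).
  assert (HW : forall y, 0 < y -> W y = W x).
  { intros y Hy. unfold W.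
    apply (bessel_wronskian_const (INR n) J J1 _ _ (frob_coefJ_sol (INR n)) (BesselY_INR_sol n)); auto. }
  assert (HP : Phi 0 = W x).
  { apply (const_continuous_0 Phi (W x)).
    - assert (CP : continuity_pt P 0) by (apply continuity_PSeries, entire_coefJ).
      assert (CP1 : continuity_pt P1 0) by (apply continuity_PSeries, entire_theta, entire_coefJ).
      assert (CQ : continuity_pt Q 0) by (apply continuity_PSeries, entire_coefQ).
      assert (CQ1 : continuity_pt Q1 0) by (apply continuity_PSeries, entire_theta, entire_coefQ).
      assert (CS : continuity_pt S 0) by (apply continuity_PSeries, entire_coefQ).
      assert (CS1 : continuity_pt S1 0) by (apply continuity_PSeries, entire_theta, entire_coefQ).
      assert (Cn : continuity_pt (fun s => s ^ n) 0) by (apply derivable_continuous_pt, derivable_pt_pow).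
      unfold Phi.
      repeat first [ assumption
        | apply continuity_pt_plus | apply continuity_pt_opp | apply continuity_pt_mult
        | apply continuity_pt_const; intros ? ?; reflexivity ].
    - intros y Hy. rewrite <- (HW y Hy). unfold W, Phi, frobZ, frobZ1, J, J1, frob.
      fold P P1 Q Q1 S S1.
      pose proof (Rpower_opp_mult (y / 2) (INR n)) as E.
      rewrite <- pow_mult, Nat.mul_comm, pow_mult, <- (Rpower_pow n (y / 2)) by lra.
      set (a := Rpower (y / 2) (INR n)) in *. set (b := Rpower (y / 2) (- INR n)) in *.
      set (s := (y / 2) ^ 2).
      transitivity (2 / PI * (a ^ 2 * (P s * P s)) + / PI * (a ^ 2 * (P s * Q1 s - Q s * P1 s)) +
        / PI * (-1) ^ n * (a * b) * (P s * S1 s - S s * P1 s)); [rewrite E|]; field; lra. }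
  rewrite <- HP. unfold Phi, P, P1, Q, Q1, S, S1. rewrite !PSeries_0. unfold theta_coef.
  assert (N1 : 0 < coefJ (INR n) 0).
  { unfold coefJ. simpl. rewrite Rdiv_1_r, Rmult_1_l. apply rgamma_pos. pose proof (pos_INR n); lra. }
  assert (PI' : 0 < / PI) by (apply Rinv_0_lt_compat; auto).
  (* For [n = 0] the factor [s ^ n] is 1 and the square of [coefJ 0 0], produced by the logarithm,
     survives at 0. For [n > 0] that factor vanishes at 0 and only the product with the series of
     order [-n] remains; its leading coefficient is the derivative of 1/Gamma at one of its
     zeros. *)
  destruct n as [|n].
  - simpl. apply Rgt_not_eq.
    match goal with |- ?a > 0 => replace a with (2 / PI * (coefJ 0 0 * coefJ 0 0)) end.
    + simpl in N1. unfold Rdiv. apply Rmult_lt_0_compat; nra.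
    + rewrite Ropp_0. field. lra.
  - rewrite pow_i by lia.
    match goal with |- ?a <> 0 => replace a with
      (-2 * INR (Datatypes.S n) * / PI * ((-1) ^ (Datatypes.S n)) * coefJ (INR (Datatypes.S n)) 0 * coefQ (- INR (Datatypes.S n)) 0) end.
    + repeat match goal with |- _ * _ <> 0 => apply Rmult_integral_contrapositive_currified end.
      * lra.
      * apply not_0_INR; lia.
      * lra.
      * apply pow_nonzero; lra.
      * lra.
      * unfold coefQ. simpl (INR 0). simpl (_ ^ 0). simpl (fact 0).
        simpl (INR 1). rewrite Rdiv_1_r, Rmult_1_l.
        replace (0 + - INR (Datatypes.S n) + 1) with (- INR n) by (rewrite S_INR; ring).
        apply drgamma_nonpos_int.
    + change (INR 0) with 0. field. lra.
Qed.

Lemma Derive_bessel_sol (nu : R) (f f1 : R -> R) (x : R) :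
  bessel_sol nu f f1 -> 0 < x -> Derive f x = f1 x / x.
Proof. intros H Hx. apply is_derive_unique, H, Hx. Qed.

(** Merges the two cases in the definition of [BesselY]. As [f1 = x f'], the last clause is the
    Wronskian times [x]; being constant, it is tested at [x = 1]. *)
Lemma bessel_fundamental (nu : R) : 0 <= nu ->
  exists J1 Y1 : R -> R, exists c : R, c <> 0 /\
    bessel_sol nu (BesselJ nu) J1 /\ bessel_sol nu (BesselY nu) Y1 /\
    forall x, 0 < x -> BesselJ nu x * Y1 x - BesselY nu x * J1 x = c.
Proof.
  intros Hnu.
  assert (HJ : bessel_sol nu (BesselJ nu) (frob nu (theta_coef nu (coefJ nu)))).
  { eapply bessel_sol_ext; [| |apply frob_coefJ_sol]; auto.
    intros x Hx; symmetry; apply BesselJ_frob, Hx. }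
  assert (Fin : forall Y1, bessel_sol nu (BesselY nu) Y1 ->
    BesselJ nu 1 * Y1 1 - BesselY nu 1 * frob nu (theta_coef nu (coefJ nu)) 1 <> 0 ->
    exists J1 Y1 : R -> R, exists c : R, c <> 0 /\
    bessel_sol nu (BesselJ nu) J1 /\ bessel_sol nu (BesselY nu) Y1 /\
    forall x, 0 < x -> BesselJ nu x * Y1 x - BesselY nu x * J1 x = c).
  { intros Y1 HY Hc. eexists _, Y1, _. split; [exact Hc|]. split; [exact HJ|]. split; [exact HY|].
    intros x Hx. apply (bessel_wronskian_const nu); auto. lra. }
  destruct (excluded_middle_informative (exists n : Z, nu = IZR n)) as [[m Hm]|Hn].
  - assert (exists n, nu = INR n) as [n ->].
    { exists (Z.to_nat m). rewrite INR_IZR_INZ, Z2Nat.id; auto. apply le_IZR. lra. }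
    assert (HY : bessel_sol (INR n) (BesselY (INR n)) (fun x => 2 / PI * (frob (INR n) (coefJ (INR n)) x
       + ln (x / 2) * frob (INR n) (theta_coef (INR n) (coefJ (INR n))) x) + frobZ1 n x)).
    { eapply bessel_sol_ext; [| |apply BesselY_INR_sol]; auto.
      intros x Hx; symmetry; apply BesselY_INR, Hx. }
    apply (Fin _ HY). rewrite BesselJ_frob, BesselY_INR by lra.
    apply wronskian_INR_neq_0. lra.
  - assert (Hpos : 0 < nu).
    { destruct Hnu as [|<-]; auto. exfalso; apply Hn; exists 0%Z; reflexivity. }
    assert (Hsin : sin (nu * PI) <> 0).
    { intros h. apply sin_eq_0_0 in h. destruct h as [k Hk]. apply Hn. exists k.
      apply (Rmult_eq_reg_r PI); auto. apply PI_neq0. }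
    assert (HY : bessel_sol nu (BesselY nu) (fun x =>
      cos (nu * PI) / sin (nu * PI) * frob nu (theta_coef nu (coefJ nu)) x
      + - / sin (nu * PI) * frob (- nu) (theta_coef (- nu) (coefJ (- nu))) x)).
    { eapply bessel_sol_ext; [| |apply bessel_sol_comb;
        [apply frob_coefJ_sol | apply bessel_sol_order_opp, frob_coefJ_sol]]; [|reflexivity].
      intros x Hx. unfold BesselY.
      destruct (excluded_middle_informative (exists n : Z, nu = IZR n)) as [h|_]; [tauto|].
      unfold BesselY_quot. rewrite !BesselJ_frob by auto. field; auto. }
    apply (Fin _ HY). unfold BesselY.
    destruct (excluded_middle_informative (exists n : Z, nu = IZR n)) as [h|_]; [tauto|].
    unfold BesselY_quot. rewrite !BesselJ_frob by lra.
    assert (Hi : forall n : Z, nu <> IZR n) by (intros n h; apply Hn; exists n; auto).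
    pose proof (wronskian_coefJ_neq_0 nu 1 Hpos Hi Rlt_0_1) as Hw.
    match type of Hw with ?a <> 0 => match goal with |- ?b <> 0 =>
      (* The [BesselJ nu] component of [BesselY_quot] drops out of the Wronskian with
         [BesselJ nu]. *)
      replace b with (- / sin (nu * PI) * a) by (field; auto) end end.
    apply Rmult_integral_contrapositive_currified; auto.
    apply Ropp_neq_0_compat, Rinv_neq_0_compat; auto.
Qed.

(** * The coefficients of the solution in the spectral parameter *)

(** With [hypC], a fundamental system of [u'' = nu^2 u] with standard initial values. At [nu = 0]
    the quotient is replaced by its limit, which makes the variation of parameters uniform in
    [nu]. *)
Definition hypS (nu t : R) : R := if Req_EM_T nu 0 then t else sinh (nu * t) / nu.
Definition hypC (nu t : R) : R := cosh (nu * t).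

Lemma is_derive_hypS (nu t : R) : is_derive (hypS nu) t (hypC nu t).
Proof.
  unfold hypS, hypC. destruct (Req_EM_T nu 0) as [->|h].
  - rewrite Rmult_0_l, cosh_0. apply (is_derive_id (K := R_AbsRing)).
  - unfold sinh, cosh. auto_derive; [auto|]. field; auto.
Qed.

Lemma is_derive_hypC (nu t : R) : is_derive (hypC nu) t (nu ^ 2 * hypS nu t).
Proof.
  unfold hypS, hypC. destruct (Req_EM_T nu 0) as [->|h].
  - apply is_derive_ext with (fun _ => 1).
    { intros s. rewrite Rmult_0_l, cosh_0. reflexivity. }
    eapply is_derive_eq; [apply is_derive_const|]. unfold zero; simpl; ring.
  - unfold sinh, cosh. auto_derive; [auto|]. field; auto.
Qed.

(** The Wronskian of the fundamental system; since it is 1, [picU] has no denominator. *)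
Lemma hypCS (nu t : R) : hypC nu t ^ 2 - nu ^ 2 * hypS nu t ^ 2 = 1.
Proof.
  unfold hypS, hypC. destruct (Req_EM_T nu 0) as [->|h].
  - rewrite Rmult_0_l, cosh_0. ring.
  - unfold sinh, cosh. rewrite exp_Ropp. pose proof (exp_pos (nu * t)). field. split; lra.
Qed.

Lemma hypS_0 (nu : R) : hypS nu 0 = 0.
Proof.
  unfold hypS. destruct (Req_EM_T nu 0) as [->|h]; auto.
  rewrite Rmult_0_r, sinh_0. unfold Rdiv; ring.
Qed.

Lemma hypC_0 (nu : R) : hypC nu 0 = 1.
Proof. unfold hypC. rewrite Rmult_0_r. apply cosh_0. Qed.

Definition wgt (r t : R) : R := r ^ 2 * exp (2 * t).

Lemma is_derive_wgt (r t : R) : is_derive (wgt r) t (2 * wgt r t).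
Proof. unfold wgt. auto_derive; [auto|]. ring. Qed.

Lemma wgt_pos (r t : R) : 0 < r -> 0 < wgt r t.
Proof. intros Hr. unfold wgt. apply Rmult_lt_0_compat; [nra | apply exp_pos]. Qed.

(* The coefficients of the powers of [l] in the solution of
   [u'' = (nu^2 - l wgt) u], [u 0 = 1], [u' 0 = delta], by variation of parameters. *)
Fixpoint picU (nu delta r : R) (k : nat) (t : R) : R :=
  match k with
  | O => hypC nu t + delta * hypS nu t
  | S k => hypC nu t * RInt (fun s => hypS nu s * wgt r s * picU nu delta r k s) 0 t
           - hypS nu t * RInt (fun s => hypC nu s * wgt r s * picU nu delta r k s) 0 t
  end.

(** The [t]-derivative of [picU], in closed form: the contributions of the moving endpoints of the
    two integrals cancel. *)
Definition picV (nu delta r : R) (k : nat) (t : R) : R :=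
  match k with
  | O => nu ^ 2 * hypS nu t + delta * hypC nu t
  | S k => nu ^ 2 * hypS nu t * RInt (fun s => hypS nu s * wgt r s * picU nu delta r k s) 0 t
           - hypC nu t * RInt (fun s => hypC nu s * wgt r s * picU nu delta r k s) 0 t
  end.

(** The coefficient of index [k - 1], extended by 0, so that one differential equation serves every
    [k]. *)
Definition picU_pred (nu delta r : R) (k : nat) (t : R) : R :=
  match k with O => 0 | S k => picU nu delta r k t end.

Lemma is_derive_continuous (f : R -> R) (x l : R) : is_derive f x l -> continuous f x.
Proof. intros H. apply (ex_derive_continuous f). exists l; exact H. Qed.

Lemma is_derive_RInt_0 (f : R -> R) (t : R) :
  (forall x, continuous f x) -> is_derive (fun t => RInt f 0 t) t (f t).
Proof.
  intros H. apply (is_derive_RInt f _ 0 t); [|apply H].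
  apply filter_forall. intros y.
  apply (RInt_correct (V := R_CompleteNormedModule) f 0 y).
  apply (ex_RInt_continuous (V := R_CompleteNormedModule)). intros z _. apply H.
Qed.

Lemma continuous_mult_R (f g : R -> R) (x : R) :
  continuous f x -> continuous g x -> continuous (fun x => f x * g x) x.
Proof. apply (continuous_mult f g). Qed.

Lemma pic_derive (nu delta r : R) (k : nat) :
  (forall t, is_derive (picU nu delta r k) t (picV nu delta r k t)) /\
  (forall t, is_derive (picV nu delta r k) t
     (nu ^ 2 * picU nu delta r k t - wgt r t * picU_pred nu delta r k t)).
Proof.
  induction k as [|k [IH _]].
  - split; intros t; simpl.
    + eapply is_derive_eq.
      * apply is_derive_plus_R; [apply is_derive_hypC | apply is_derive_scal, is_derive_hypS].
      * reflexivity.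
    + eapply is_derive_eq.
      * apply is_derive_plus_R; apply is_derive_scal; [apply is_derive_hypS | apply is_derive_hypC].
      * ring.
  - assert (Hc : forall t, continuous (picU nu delta r k) t)
      by (intros t; eapply is_derive_continuous, IH).
    assert (HI : forall t, is_derive
      (fun t => RInt (fun s => hypS nu s * wgt r s * picU nu delta r k s) 0 t) t
      (hypS nu t * wgt r t * picU nu delta r k t)).
    { intros t. apply (is_derive_RInt_0 (fun s => hypS nu s * wgt r s * picU nu delta r k s)).
      intros x. apply continuous_mult_R; [|apply Hc].
      apply continuous_mult_R; eapply is_derive_continuous; [apply is_derive_hypS | apply is_derive_wgt]. }
    assert (HI' : forall t, is_derive
      (fun t => RInt (fun s => hypC nu s * wgt r s * picU nu delta r k s) 0 t) t
      (hypC nu t * wgt r t * picU nu delta r k t)).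
    { intros t. apply (is_derive_RInt_0 (fun s => hypC nu s * wgt r s * picU nu delta r k s)).
      intros x. apply continuous_mult_R; [|apply Hc].
      apply continuous_mult_R; eapply is_derive_continuous; [apply is_derive_hypC | apply is_derive_wgt]. }
    split; intros t; simpl.
    + eapply is_derive_eq.
      * apply is_derive_minus_R; apply is_derive_mult_R;
          [apply is_derive_hypC | apply HI | apply is_derive_hypS | apply HI'].
      * ring.
    + eapply is_derive_eq.
      * apply is_derive_minus_R; apply is_derive_mult_R;
          [apply is_derive_scal, is_derive_hypS | apply HI | apply is_derive_hypC | apply HI'].
      * cbv beta. set (I1 := RInt _ 0 t). set (I2 := RInt _ 0 t).
        set (u := picU nu delta r k t).
        transitivity (nu ^ 2 * (hypC nu t * I1 - hypS nu t * I2)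
          - (hypC nu t ^ 2 - nu ^ 2 * hypS nu t ^ 2) * (wgt r t * u)); [ring|].
        rewrite hypCS. ring.
Qed.

Lemma is_derive_picU (nu delta r : R) (k : nat) (t : R) :
  is_derive (picU nu delta r k) t (picV nu delta r k t).
Proof. apply (proj1 (pic_derive nu delta r k)). Qed.

Lemma is_derive_picV (nu delta r : R) (k : nat) (t : R) :
  is_derive (picV nu delta r k) t
    (nu ^ 2 * picU nu delta r k t - wgt r t * picU_pred nu delta r k t).
Proof. apply (proj2 (pic_derive nu delta r k)). Qed.

Lemma continuous_picU (nu delta r : R) (k : nat) (t : R) : continuous (picU nu delta r k) t.
Proof. exact (is_derive_continuous _ _ _ (is_derive_picU nu delta r k t)). Qed.

Lemma continuous_picV (nu delta r : R) (k : nat) (t : R) : continuous (picV nu delta r k) t.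
Proof. exact (is_derive_continuous _ _ _ (is_derive_picV nu delta r k t)). Qed.

Lemma pic_init (nu delta r : R) (k : nat) :
  picU nu delta r k 0 = match k with O => 1 | S _ => 0 end /\
  picV nu delta r k 0 = match k with O => delta | S _ => 0 end.
Proof.
  destruct k as [|k]; simpl; rewrite ?RInt_point, hypS_0, hypC_0; split;
    unfold zero; simpl; ring.
Qed.

Lemma bounded_on_compact (f : R -> R) (M : R) : 0 <= M -> (forall x, continuous f x) ->
  exists G, 0 <= G /\ forall t, Rabs t <= M -> Rabs (f t) <= G.
Proof.
  intros HM Hf.
  destruct (continuity_ab_maj (fun t => Rabs (f t)) (- M) M) as [x [Hx _]]; [lra| |].
  - intros c _. apply (continuity_pt_comp f Rabs); [|apply Rcontinuity_abs].
    apply continuity_pt_filterlim, Hf.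
  - exists (Rabs (f x)). split; [apply Rabs_pos|].
    intros t Ht. apply Hx. apply Rabs_le_between in Ht. lra.
Qed.

(** Each integration gains [|t| / (k + 1)]; this builds the factorial of [pic_bound]. The one-sided
    estimate for [t >= 0] gives the rest by replacing [F] with [- F] and [t] with [- t]. *)
Lemma is_derive_pow_bound (F f : R -> R) (A M : R) (k : nat) :
  F 0 = 0 -> (forall t, is_derive F t (f t)) ->
  (forall t, Rabs t <= M -> Rabs (f t) <= A * Rabs t ^ k) ->
  forall t, Rabs t <= M -> Rabs (F t) <= A * Rabs t ^ S k / INR (S k).
Proof.
  intros F0 HF Hb.
  assert (Hk : 0 < INR (S k)) by (apply lt_0_INR; lia).
  assert (Pos : forall (F f : R -> R), F 0 = 0 -> (forall t, is_derive F t (f t)) ->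
    (forall t, 0 <= t <= M -> Rabs (f t) <= A * t ^ k) ->
    forall t, 0 <= t <= M -> F t <= A * t ^ S k / INR (S k)).
  { clear F f F0 HF Hb. intros F f F0 HF Hb t Ht.
    set (D := fun t => A / INR (S k) * t ^ S k - F t).
    assert (HD : forall t, is_derive D t (A * t ^ k - f t)).
    { intros s. unfold D. eapply is_derive_eq.
      - apply is_derive_minus_R; [|apply HF].
        apply is_derive_scal. auto_derive; [auto|reflexivity].
      - cbv beta. change (match k with O => 1 | S _ => INR k + 1 end) with (INR (S k)).
        field. lra. }
    destruct (MVT_gen D 0 t (fun t => A * t ^ k - f t)) as [c [Hc E]].
    - intros s _; apply HD.
    - intros s _; apply continuity_pt_filterlim. eapply is_derive_continuous, HD.
    - rewrite Rmin_left, Rmax_right in Hc by lra.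
      assert (HD0 : D 0 = 0).
      { unfold D. rewrite F0, pow_i by lia. unfold Rdiv; ring. }
      rewrite HD0 in E.
      specialize (Hb c ltac:(lra)). pose proof (Rle_abs (f c)).
      assert (H1 : 0 <= D t) by nra. unfold D in H1.
      replace (A * t ^ S k / INR (S k)) with (A / INR (S k) * t ^ S k) by (unfold Rdiv; ring). lra. }
  assert (Pos2 : forall (F f : R -> R), F 0 = 0 -> (forall t, is_derive F t (f t)) ->
    (forall t, 0 <= t <= M -> Rabs (f t) <= A * t ^ k) ->
    forall t, 0 <= t <= M -> Rabs (F t) <= A * t ^ S k / INR (S k)).
  { intros G g G0 HG Hg t Ht. apply Rabs_le. split; [|apply (Pos G g); auto].
    assert (- G t <= A * t ^ S k / INR (S k)); [|lra].
    apply (Pos (fun t => - G t) (fun t => - g t)); auto.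
    - rewrite G0; ring.
    - intros s. apply (is_derive_opp G s (g s)), HG.
    - intros s Hs. rewrite Rabs_Ropp. auto. }
  intros t Ht. destruct (Rle_dec 0 t) as [h|h].
  - rewrite (Rabs_pos_eq t) in Ht |- * by auto.
    apply (Pos2 F f); auto. intros s Hs. specialize (Hb s).
    rewrite (Rabs_pos_eq s) in Hb by lra. apply Hb; lra.
  - rewrite (Rabs_left t) in Ht |- * by lra.
    replace (F t) with (F (- (- t))) by (f_equal; ring).
    apply (Pos2 (fun t => F (- t)) (fun t => - f (- t))); auto; [| | |lra].
    + rewrite Ropp_0; auto.
    + intros s. eapply is_derive_eq.
      * apply (is_derive_comp_R F Ropp); [apply HF|]. auto_derive; [auto|reflexivity].
      * ring.
    + intros s Hs. specialize (Hb (- s)). rewrite Rabs_Ropp, (Rabs_pos_eq s) in Hb by lra.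
      rewrite Rabs_Ropp. apply Hb; lra.
Qed.

Lemma pic_bound (nu delta r M : R) : 0 <= M -> exists B rho, 0 <= B /\ 0 <= rho /\
  forall k t, Rabs t <= M ->
    Rabs (picU nu delta r k t) <= B * (rho ^ k / INR (fact k)) /\
    Rabs (picV nu delta r k t) <= B * (rho ^ k / INR (fact k)).
Proof.
  intros HM.
  destruct (bounded_on_compact (hypS nu) M HM) as [GS [GS0 HGS]].
  { intros x; eapply is_derive_continuous, is_derive_hypS. }
  destruct (bounded_on_compact (hypC nu) M HM) as [GC [GC0 HGC]].
  { intros x; eapply is_derive_continuous, is_derive_hypC. }
  destruct (bounded_on_compact (wgt r) M HM) as [GW [GW0 HGW]].
  { intros x; eapply is_derive_continuous, is_derive_wgt. }
  destruct (bounded_on_compact (picU nu delta r 0) M HM) as [K [K0 HK]].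
  { intros x; apply continuous_picU. }
  destruct (bounded_on_compact (picV nu delta r 0) M HM) as [KV [KV0 HKV]].
  { intros x; apply continuous_picV. }
  (* The 2 counts the two integrals in [picU], each bounded through one [hypS], one [hypC] and one
     weight. *)
  set (L := 2 * GS * GC * GW).
  assert (L0 : 0 <= L) by (unfold L; repeat apply Rmult_le_pos; lra).
  assert (HI : forall k, (forall t, Rabs t <= M ->
     Rabs (picU nu delta r k t) <= K * L ^ k / INR (fact k) * Rabs t ^ k) ->
     forall g G, (forall t, Rabs t <= M -> Rabs (g t) <= G) -> 0 <= G ->
       (forall x, continuous g x) -> forall t, Rabs t <= M ->
     Rabs (RInt (fun s => g s * wgt r s * picU nu delta r k s) 0 t) <=
       G * GW * (K * L ^ k / INR (fact k)) * Rabs t ^ S k / INR (S k)).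
  { intros k IH g G Hg HG0 Hc.
    apply (is_derive_pow_bound (fun t => RInt (fun s => g s * wgt r s * picU nu delta r k s) 0 t)
      (fun s => g s * wgt r s * picU nu delta r k s)).
    - rewrite RInt_point; reflexivity.
    - intros t. apply (is_derive_RInt_0 (fun s => g s * wgt r s * picU nu delta r k s)). intros x.
      apply continuous_mult_R; [apply continuous_mult_R|]; auto.
      + eapply is_derive_continuous, is_derive_wgt.
      + apply continuous_picU.
    - intros t Ht. rewrite !Rabs_mult, (Rmult_assoc (G * GW)).
      apply Rmult_le_compat; auto; try apply Rmult_le_pos; try apply Rabs_pos.
      apply Rmult_le_compat; auto; apply Rabs_pos. }
  assert (HC : forall x, continuous (hypC nu) x)
    by (intros x; eapply is_derive_continuous, is_derive_hypC).
  assert (HS : forall x, continuous (hypS nu) x)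
    by (intros x; eapply is_derive_continuous, is_derive_hypS).
  assert (HU : forall k t, Rabs t <= M ->
     Rabs (picU nu delta r k t) <= K * L ^ k / INR (fact k) * Rabs t ^ k).
  { induction k as [|k IH]; intros t Ht.
    - change (fact 0) with 1%nat. simpl pow. simpl (INR 1).
      rewrite Rdiv_1_r, !Rmult_1_r. auto.
    - pose proof (HI k IH (hypS nu) GS HGS GS0 HS t Ht) as I1.
      pose proof (HI k IH (hypC nu) GC HGC GC0 HC t Ht) as I2.
      simpl picU. unfold Rminus. eapply Rle_trans; [apply Rabs_triang|].
      rewrite Rabs_Ropp, !Rabs_mult.
      eapply Rle_trans.
      + apply Rplus_le_compat; (apply Rmult_le_compat; [apply Rabs_pos | apply Rabs_pos | |]).
        * apply HGC, Ht.
        * apply I1.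
        * apply HGS, Ht.
        * apply I2.
      + right. rewrite fact_simpl, mult_INR. unfold L. simpl pow.
        field. split; [apply INR_fact_neq_0 | apply not_0_INR; lia]. }
  set (B := K * (1 + nu ^ 2 * GS ^ 2 * GW + GC ^ 2 * GW) + KV).
  assert (Hn2 : 0 <= nu ^ 2) by apply pow2_ge_0.
  assert (HS2 : 0 <= GS ^ 2) by apply pow2_ge_0.
  assert (HC2 : 0 <= GC ^ 2) by apply pow2_ge_0.
  assert (HX : 0 <= nu ^ 2 * GS ^ 2 * GW) by (apply Rmult_le_pos; [apply Rmult_le_pos|]; auto).
  assert (HY : 0 <= GC ^ 2 * GW) by (apply Rmult_le_pos; auto).
  assert (HB : 0 <= B) by (unfold B; nra).
  assert (HKVB : KV <= B) by (unfold B; nra).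
  assert (HKB : K <= B) by (unfold B; nra).
  (* Adding 1 makes both bases at least 1: for [picV] the estimate carries [L ^ k] next to the
     factorial of [S k], and [(L + 1) ^ S k] absorbs it. *)
  exists ((M + 1) * B), ((L + 1) * (M + 1) ).
  assert (Hrho : 0 <= (L + 1) * (M + 1)) by nra.
  repeat split; [nra | auto | |].
  - eapply Rle_trans; [apply HU; auto|].
    rewrite Rpow_mult_distr.
    replace (K * L ^ k / INR (fact k) * Rabs t ^ k) with
      ((K * / INR (fact k)) * (L ^ k * Rabs t ^ k)) by (unfold Rdiv; ring).
    replace ((M + 1) * B * ((L + 1) ^ k * (M + 1) ^ k / INR (fact k))) with
      (((M + 1) * B * / INR (fact k)) * ((L + 1) ^ k * (M + 1) ^ k)) by (unfold Rdiv; ring).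
    assert (Hf : 0 < / INR (fact k)) by (apply Rinv_0_lt_compat, INR_fact_lt_0).
    apply Rmult_le_compat.
    + apply Rmult_le_pos; lra.
    + apply Rmult_le_pos; apply pow_le; [auto | apply Rabs_pos].
    + apply Rmult_le_compat_r; [lra | nra].
    + apply Rmult_le_compat; try (apply pow_le; auto; apply Rabs_pos); apply pow_incr; split;
        auto; try lra; apply Rabs_pos.
  - destruct k as [|k].
    + change (fact 0) with 1%nat. simpl (_ ^ 0). simpl (INR 1).
      eapply Rle_trans; [apply HKV; auto|]. rewrite Rdiv_1_r, Rmult_1_r. nra.
    + pose proof (HI k (HU k) (hypS nu) GS HGS GS0 HS t H) as I1.
      pose proof (HI k (HU k) (hypC nu) GC HGC GC0 HC t H) as I2.
      cbn [picV]. unfold Rminus. eapply Rle_trans; [apply Rabs_triang|].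
      rewrite Rabs_Ropp, !Rabs_mult, (Rabs_pos_eq (nu ^ 2)) by auto.
      eapply Rle_trans.
      * apply Rplus_le_compat; (apply Rmult_le_compat;
          [try apply Rmult_le_pos; auto; apply Rabs_pos | apply Rabs_pos | |]).
        -- apply Rmult_le_compat_l; [auto|]. apply HGS, H.
        -- apply I1.
        -- apply HGC, H.
        -- apply I2.
      * assert (Hf : 0 < / INR (fact (S k))) by (apply Rinv_0_lt_compat, INR_fact_lt_0).
        transitivity ((K * (nu ^ 2 * GS ^ 2 * GW + GC ^ 2 * GW) * / INR (fact (S k)))
          * (L ^ k * Rabs t ^ S k)).
        { right. rewrite fact_simpl, mult_INR. field.
          split; [apply INR_fact_neq_0 | apply not_0_INR; lia]. }
        rewrite Rpow_mult_distr.
        replace ((M + 1) * B * ((L + 1) ^ S k * (M + 1) ^ S k / INR (fact (S k)))) with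
          (((M + 1) * B * / INR (fact (S k))) * ((L + 1) ^ S k * (M + 1) ^ S k)) by (unfold Rdiv; ring).
        apply Rmult_le_compat.
        -- repeat apply Rmult_le_pos; lra.
        -- apply Rmult_le_pos; apply pow_le; [auto | apply Rabs_pos].
        -- apply Rmult_le_compat_r; [lra|].
           assert (K * (nu ^ 2 * GS ^ 2 * GW + GC ^ 2 * GW) <= B) by (unfold B; nra). nra.
        -- apply Rmult_le_compat; try (apply pow_le; auto; apply Rabs_pos).
           ++ simpl. assert (L ^ k <= (L + 1) ^ k) by (apply pow_incr; lra).
              assert (0 <= (L + 1) ^ k) by (apply pow_le; lra). nra.
           ++ apply pow_incr; split; [apply Rabs_pos | lra].
Qed.

(** * The Sturm-Liouville problem *)

Definition geom_bounded (c : nat -> R) : Prop :=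
  exists A L, 0 <= A /\ 0 <= L /\ forall k, Rabs (c k) <= A * L ^ k.

(** For [c k = l^k] this is the solution [u]. Leaving [c] free covers, with real series only, the
    real and imaginary parts of [u] for complex [l] ([powRe], [powIm]) and its derivative in [l]
    ([powDer]). *)
Definition solU (nu delta r : R) (c : nat -> R) (t : R) : R :=
  Series (fun k => c k * picU nu delta r k t).
Definition solV (nu delta r : R) (c : nat -> R) (t : R) : R :=
  Series (fun k => c k * picV nu delta r k t).

Lemma geom_bounded_shift (c : nat -> R) : geom_bounded c -> geom_bounded (fun k => c (S k)).
Proof.
  intros [A [L [HA [HL H]]]]. exists (A * L), L. repeat split; try nra.
  intros k. eapply Rle_trans; [apply H|]. simpl. right; ring.
Qed.

Lemma geom_pic_bound (nu delta r M : R) (c : nat -> R) : 0 <= M -> geom_bounded c ->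
  exists m : nat -> R, ex_series m /\ forall k t, Rabs t <= M ->
    Rabs (c k * picU nu delta r k t) <= m k /\ Rabs (c k * picV nu delta r k t) <= m k.
Proof.
  intros HM [A [L [HA [HL Hc]]]].
  destruct (pic_bound nu delta r M HM) as [B [rho [HB [Hrho H]]]].
  exists (fun k => A * B * ((L * rho) ^ k / INR (fact k))). split.
  - apply ex_series_scal_R, ex_series_exp.
  - intros k t Ht. destruct (H k t Ht) as [H1 H2]. rewrite Rpow_mult_distr, !Rabs_mult.
    replace (A * B * (L ^ k * rho ^ k / INR (fact k))) with
      ((A * L ^ k) * (B * (rho ^ k / INR (fact k)))) by (unfold Rdiv; ring).
    split; apply Rmult_le_compat; auto; apply Rabs_pos.
Qed.

Lemma ex_series_sol (nu delta r : R) (c : nat -> R) (t : R) : geom_bounded c ->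
  ex_series (fun k => c k * picU nu delta r k t) /\
  ex_series (fun k => c k * picV nu delta r k t).
Proof.
  intros Hc. destruct (geom_pic_bound nu delta r (Rabs t) c (Rabs_pos t) Hc) as [m [Hm H]].
  split; eapply ex_series_le_R; try exact Hm; intros k; apply (H k t (Rle_refl _)).
Qed.

Lemma is_derive_solU (nu delta r : R) (c : nat -> R) (t : R) : geom_bounded c ->
  is_derive (solU nu delta r c) t (solV nu delta r c t).
Proof.
  intros Hc.
  destruct (geom_pic_bound nu delta r (Rabs t + 1) c) as [m [Hm H]]; auto.
  { pose proof (Rabs_pos t); lra. }
  apply (is_derive_Series (fun k t => c k * picU nu delta r k t)
    (fun k t => c k * picV nu delta r k t) m t 1); auto; [lra | | |].
  - intros k y _. apply is_derive_scal, is_derive_picU.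
  - intros k y Hy. apply H. pose proof (Rabs_triang (y - t) t).
    replace (y - t + t) with y in * by ring. lra.
  - apply ex_series_sol, Hc.
Qed.

(** Multiplication by the spectral parameter appears as the shift of [c]; for powers of [l] the
    shift is a factor [l]. *)
Lemma is_derive_solV (nu delta r : R) (c : nat -> R) (t : R) : geom_bounded c ->
  is_derive (solV nu delta r c) t
    (nu ^ 2 * solU nu delta r c t - wgt r t * solU nu delta r (fun k => c (S k)) t).
Proof.
  intros Hc. pose proof (geom_bounded_shift c Hc) as Hc'.
  pose proof (Rabs_pos t) as Ht.
  destruct (geom_pic_bound nu delta r (Rabs t + 1) c) as [m [Hm H]]; auto; [lra|].
  destruct (geom_pic_bound nu delta r (Rabs t + 1) (fun k => c (S k))) as [m' [Hm' H']]; auto; [lra|].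
  destruct (bounded_on_compact (wgt r) (Rabs t + 1)) as [G [HG HW]]; [lra| |].
  { intros x; exact (is_derive_continuous _ _ _ (is_derive_wgt r x)). }
  assert (Hexp : ex_series (fun k => c k * picU_pred nu delta r k t)).
  { apply ex_series_incr_1. apply (ex_series_sol nu delta r (fun k => c (S k)) t Hc'). }
  eapply is_derive_eq.
  - apply (is_derive_Series (fun k t => c k * picV nu delta r k t)
      (fun k t => c k * (nu ^ 2 * picU nu delta r k t - wgt r t * picU_pred nu delta r k t))
      (* The second majorant is delayed by one index, to match [picU_pred]. *)
      (fun k => nu ^ 2 * m k + G * (match k with O => 0 | S k => m' k end)) t 1); [lra | | | |].
    + intros k y _. apply is_derive_scal, is_derive_picV.
    + intros k y Hy.
      assert (Hy' : Rabs y <= Rabs t + 1).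
      { pose proof (Rabs_triang (y - t) t). replace (y - t + t) with y in * by ring. lra. }
      replace (c k * (nu ^ 2 * picU nu delta r k y - wgt r y * picU_pred nu delta r k y)) with
        (nu ^ 2 * (c k * picU nu delta r k y) - wgt r y * (c k * picU_pred nu delta r k y)) by ring.
      unfold Rminus. eapply Rle_trans; [apply Rabs_triang|].
      rewrite Rabs_Ropp, (Rabs_mult (nu ^ 2)), (Rabs_mult (wgt r y)).
      rewrite (Rabs_pos_eq (nu ^ 2)) by apply pow2_ge_0.
      apply Rplus_le_compat.
      * apply Rmult_le_compat_l; [apply pow2_ge_0 | apply H, Hy'].
      * apply Rmult_le_compat; try apply Rabs_pos; [apply HW, Hy'|].
        destruct k as [|k]; simpl.
        -- rewrite Rmult_0_r, Rabs_R0; lra.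
        -- apply (H' k y Hy').
    + apply (ex_series_plus (fun k => nu ^ 2 * m k)).
      * apply ex_series_scal_R, Hm.
      * apply ex_series_scal_R. apply ex_series_incr_1. exact Hm'.
    + apply ex_series_sol, Hc.
  - unfold solU.
    rewrite (Series_ext _ (fun k => nu ^ 2 * (c k * picU nu delta r k t)
      - wgt r t * (c k * picU_pred nu delta r k t))) by (intros k; ring).
    rewrite Series_minus, !Series_scal_l.
    + rewrite (Series_incr_1 (fun k => c k * picU_pred nu delta r k t)) by auto.
      simpl. ring.
    + apply ex_series_scal_R, ex_series_sol, Hc.
    + apply ex_series_scal_R, Hexp.
Qed.

Lemma Series_first (a : nat -> R) : (forall k, a (S k) = 0) -> Series a = a O.
Proof.
  intros H.
  assert (E : ex_series (fun k => a (S k))).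
  { apply ex_series_ext with (fun k => 0 * (1 ^ k / INR (fact k))).
    - intros k; rewrite H; apply Rmult_0_l.
    - apply ex_series_scal_R, ex_series_exp. }
  rewrite Series_incr_1 by (apply ex_series_incr_1; auto).
  rewrite (Series_ext _ (fun k => 0 * (1 ^ k / INR (fact k)))) by (intros k; rewrite H; ring).
  rewrite Series_scal_l. ring.
Qed.

Lemma sol_init (nu delta r : R) (c : nat -> R) :
  solU nu delta r c 0 = c O /\ solV nu delta r c 0 = delta * c O.
Proof.
  unfold solU, solV. split.
  - rewrite Series_first; [rewrite (proj1 (pic_init nu delta r 0)); ring|].
    intros k. rewrite (proj1 (pic_init nu delta r (S k))). ring.
  - rewrite Series_first; [rewrite (proj2 (pic_init nu delta r 0)); ring|].
    intros k. rewrite (proj2 (pic_init nu delta r (S k))). ring.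
Qed.

Lemma solU_ext (nu delta r : R) (c d : nat -> R) (t : R) :
  (forall k, c k = d k) -> solU nu delta r c t = solU nu delta r d t.
Proof. intros H. apply Series_ext. intros k; rewrite H; reflexivity. Qed.

Lemma solU_comb (nu delta r : R) (c d : nat -> R) (a b t : R) :
  geom_bounded c -> geom_bounded d ->
  solU nu delta r (fun k => a * c k + b * d k) t = a * solU nu delta r c t + b * solU nu delta r d t.
Proof.
  intros Hc Hd. unfold solU.
  rewrite (Series_ext _ (fun k => a * (c k * picU nu delta r k t) + b * (d k * picU nu delta r k t)))
    by (intros k; ring).
  rewrite Series_plus, !Series_scal_l; auto; apply ex_series_scal_R, ex_series_sol; auto.
Qed.

(** Stands in for the positivity of the integrals in the Sturm-Liouville identities: the positive
    slope lifts [f] strictly above 0 at once, and it never decreases afterwards. *)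
Lemma strictly_pos_of_derive (f df : R -> R) (T : R) : 0 < T -> f 0 = 0 ->
  (forall t, 0 <= t <= T -> is_derive f t (df t)) ->
  (forall t, 0 <= t <= T -> 0 <= df t) -> 0 < df 0 -> 0 < f T.
Proof.
  intros HT f0 Hd Hp H0.
  assert (Mono : forall s, 0 <= s <= T -> f s <= f T).
  { intros s Hs. destruct (MVT_gen f s T df) as [c [Hc E]].
    - intros x Hx. rewrite Rmin_left, Rmax_right in Hx by lra. apply Hd; lra.
    - intros x Hx. rewrite Rmin_left, Rmax_right in Hx by lra.
      apply continuity_pt_filterlim. eapply is_derive_continuous, Hd; lra.
    - rewrite Rmin_left, Rmax_right in Hc by lra.
      assert (0 <= df c) by (apply Hp; lra). nra. }
  pose proof (Hd 0 ltac:(lra)) as D. apply is_derive_Reals in D.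
  destruct (D (df 0) H0) as [d Hdel].
  pose proof (cond_pos d) as Hdp.
  set (h := Rmin (d / 2) T).
  assert (Hh : 0 < h <= T) by (unfold h, Rmin; destruct (Rle_dec (d / 2) T); lra).
  assert (Hh2 : h < d) by (unfold h, Rmin; destruct (Rle_dec (d / 2) T); lra).
  specialize (Hdel h ltac:(lra)). rewrite Rabs_pos_eq in Hdel by lra.
  specialize (Hdel Hh2). rewrite Rplus_0_l, f0, Rminus_0_r in Hdel.
  apply Rabs_lt_between in Hdel.
  assert (0 < f h / h) by lra.
  assert (0 < f h).
  { replace (f h) with (f h / h * h) by (field; lra). apply Rmult_lt_0_compat; lra. }
  pose proof (Mono h ltac:(lra)). lra.
Qed.

Definition solW (nu delta r : R) (c : nat -> R) (t : R) : R :=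
  solV nu delta r c t - delta * solU nu delta r c t.

Lemma is_derive_solU_W (nu delta r : R) (c : nat -> R) (t : R) : geom_bounded c ->
  is_derive (solU nu delta r c) t (solW nu delta r c t + delta * solU nu delta r c t).
Proof.
  intros Hc. eapply is_derive_eq; [apply is_derive_solU, Hc|]. unfold solW; ring.
Qed.

Lemma is_derive_solW (nu delta r : R) (c : nat -> R) (t : R) : geom_bounded c ->
  is_derive (solW nu delta r c) t
    ((nu ^ 2 - delta ^ 2) * solU nu delta r c t
     - wgt r t * solU nu delta r (fun k => c (S k)) t - delta * solW nu delta r c t).
Proof.
  intros Hc. unfold solW. eapply is_derive_eq.
  - apply is_derive_minus_R; [apply is_derive_solV, Hc | apply is_derive_scal, is_derive_solU, Hc].
  - ring.
Qed.

Lemma solW_0 (nu delta r : R) (c : nat -> R) : solW nu delta r c 0 = 0.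
Proof. unfold solW. destruct (sol_init nu delta r c) as [-> ->]. ring. Qed.

(** * Reality, sign and simplicity of the eigenvalues *)

Definition powRe (l : C) (k : nat) : R := Re (l ^ k)%C.
Definition powIm (l : C) (k : nat) : R := Im (l ^ k)%C.

Lemma im_le_Cmod (z : C) : Rabs (Im z) <= Cmod z.
Proof. eapply Rle_trans; [apply Rmax_r | apply Rmax_Cmod]. Qed.

Lemma geom_bounded_powRe (l : C) : geom_bounded (powRe l).
Proof.
  exists 1, (Cmod l). repeat split; [lra | apply Cmod_ge_0 |].
  intros k. unfold powRe. rewrite Rmult_1_l, <- Cmod_pow. apply re_le_Cmod.
Qed.

Lemma geom_bounded_powIm (l : C) : geom_bounded (powIm l).
Proof.
  exists 1, (Cmod l). repeat split; [lra | apply Cmod_ge_0 |].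
  intros k. unfold powIm. rewrite Rmult_1_l, <- Cmod_pow. apply im_le_Cmod.
Qed.

Lemma powRe_S (l : C) (k : nat) : powRe l (S k) = Re l * powRe l k + - Im l * powIm l k.
Proof. unfold powRe, powIm. rewrite Cpow_S. unfold Re, Im, Cmult; simpl. ring. Qed.

Lemma powIm_S (l : C) (k : nat) : powIm l (S k) = Re l * powIm l k + Im l * powRe l k.
Proof. unfold powRe, powIm. rewrite Cpow_S. unfold Re, Im, Cmult; simpl. ring. Qed.

(* With [u = uR + i uI] and [w = u' - delta u], the product [conj u * w] vanishes at both ends
   and has derivative [|w|^2 + (nu^2 - delta^2) |u|^2 - l wgt |u|^2]. *)
Lemma eigenvalue_real_nonneg (nu delta r T : R) (l : C) : 0 < r -> 0 < T -> Rabs delta <= nu ->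
  solW nu delta r (powRe l) T = 0 -> solW nu delta r (powIm l) T = 0 ->
  Im l = 0 /\ 0 <= Re l.
Proof.
  intros Hr HT Hnu HR HI.
  pose proof (geom_bounded_powRe l) as GR. pose proof (geom_bounded_powIm l) as GI.
  set (uR := solU nu delta r (powRe l)) in *. set (uI := solU nu delta r (powIm l)) in *.
  set (wR := solW nu delta r (powRe l)) in *. set (wI := solW nu delta r (powIm l)) in *.
  set (mu := nu ^ 2 - delta ^ 2).
  (* Here [|delta| <= nu] makes the potential term nonnegative. *)
  assert (Hmu : 0 <= mu).
  { unfold mu. rewrite <- (pow2_abs delta). pose proof (Rabs_pos delta). nra. }
  assert (DuR : forall t, is_derive uR t (wR t + delta * uR t)) by (intros t; apply is_derive_solU_W, GR).
  assert (DuI : forall t, is_derive uI t (wI t + delta * uI t)) by (intros t; apply is_derive_solU_W, GI).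
  assert (DwR : forall t, is_derive wR t
    (mu * uR t - wgt r t * (Re l * uR t - Im l * uI t) - delta * wR t)).
  { intros t. eapply is_derive_eq; [apply is_derive_solW, GR|].
    rewrite (solU_ext _ _ _ (fun k => powRe l (S k)) (fun k => Re l * powRe l k + - Im l * powIm l k)) by apply powRe_S.
    rewrite solU_comb by auto. fold uR uI wR mu. ring. }
  assert (DwI : forall t, is_derive wI t
    (mu * uI t - wgt r t * (Re l * uI t + Im l * uR t) - delta * wI t)).
  { intros t. eapply is_derive_eq; [apply is_derive_solW, GI|].
    rewrite (solU_ext _ _ _ (fun k => powIm l (S k)) (fun k => Re l * powIm l k + Im l * powRe l k)) by apply powIm_S.
    rewrite solU_comb by auto. fold uR uI wI mu. ring. }
  assert (uR0 : uR 0 = 1) by (unfold uR; rewrite (proj1 (sol_init nu delta r _)); reflexivity).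
  assert (uI0 : uI 0 = 0) by (unfold uI; rewrite (proj1 (sol_init nu delta r _)); reflexivity).
  assert (wR0 : wR 0 = 0) by apply solW_0.
  assert (wI0 : wI 0 = 0) by apply solW_0.
  assert (We : forall t, 0 < wgt r t) by (intros t; apply wgt_pos, Hr).
  (* The imaginary part of [conj u * w], with a factor [s] that will be [- Im l]: the derivative
     becomes [(Im l)^2 wgt |u|^2], nonnegative whatever the sign of [Im l]. *)
  assert (DIm : forall s t, is_derive (fun t => s * (uR t * wI t - uI t * wR t)) t
    (- s * Im l * (wgt r t * (uR t ^ 2 + uI t ^ 2)))).
  { intros s t. eapply is_derive_eq.
    - apply is_derive_scal, is_derive_minus_R; apply is_derive_mult_R; auto.
    - ring. }
  assert (DRe : forall t, is_derive (fun t => uR t * wR t + uI t * wI t) t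
    (wR t ^ 2 + wI t ^ 2 + mu * (uR t ^ 2 + uI t ^ 2)
      - Re l * (wgt r t * (uR t ^ 2 + uI t ^ 2)))).
  { intros t. assert (D : is_derive (fun t => uR t * wR t + uI t * wI t) t
      ((wR t + delta * uR t) * wR t + uR t * (mu * uR t - wgt r t * (Re l * uR t - Im l * uI t) - delta * wR t)
       + ((wI t + delta * uI t) * wI t + uI t * (mu * uI t - wgt r t * (Re l * uI t + Im l * uR t) - delta * wI t)))).
    { apply is_derive_plus_R; apply is_derive_mult_R; auto. }
    eapply is_derive_eq; [exact D|]. ring. }
  assert (HIm : Im l = 0).
  { destruct (Req_dec (Im l) 0) as [|h]; auto. exfalso.
    assert (P : 0 < (fun t => - Im l * (uR t * wI t - uI t * wR t)) T).
    { refine (strictly_pos_of_derive (fun t => - Im l * (uR t * wI t - uI t * wR t))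
        (fun t => - - Im l * Im l * (wgt r t * (uR t ^ 2 + uI t ^ 2))) T HT _ _ _ _); cbv beta.
      - rewrite wR0, wI0; ring.
      - intros t _. apply DIm.
      - intros t _. replace (- - Im l * Im l) with (Im l ^ 2) by ring.
        apply Rmult_le_pos; [apply pow2_ge_0|]. apply Rmult_le_pos; [apply Rlt_le, We|].
        pose proof (pow2_ge_0 (uR t)). pose proof (pow2_ge_0 (uI t)). lra.
      - rewrite uR0, uI0. pose proof (We 0).
        replace (- - Im l * Im l * (wgt r 0 * (1 ^ 2 + 0 ^ 2))) with (Im l ^ 2 * wgt r 0) by ring.
        apply Rmult_lt_0_compat; auto. apply pow2_gt_0; auto. }
    cbv beta in P. rewrite HR, HI in P. lra. }
  split; [exact HIm|].
  (* If [Re l < 0], every term of the derivative of the real part is nonnegative, and [u 0 = 1]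
     makes it positive at 0. *)
  destruct (Rle_dec 0 (Re l)) as [|h]; auto. exfalso.
  assert (P : 0 < (fun t => uR t * wR t + uI t * wI t) T).
  { refine (strictly_pos_of_derive (fun t => uR t * wR t + uI t * wI t)
      (fun t => wR t ^ 2 + wI t ^ 2 + mu * (uR t ^ 2 + uI t ^ 2)
        - Re l * (wgt r t * (uR t ^ 2 + uI t ^ 2))) T HT _ _ _ _); cbv beta.
    - rewrite wR0, wI0; ring.
    - intros t _. apply DRe.
    - intros t _.
      pose proof (pow2_ge_0 (uR t)). pose proof (pow2_ge_0 (uI t)).
      pose proof (pow2_ge_0 (wR t)). pose proof (pow2_ge_0 (wI t)).
      assert (0 <= mu * (uR t ^ 2 + uI t ^ 2)) by (apply Rmult_le_pos; lra).
      assert (0 <= - Re l * (wgt r t * (uR t ^ 2 + uI t ^ 2))).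
      { apply Rmult_le_pos; [lra|]. apply Rmult_le_pos; [apply Rlt_le, We | lra]. }
      lra.
    - rewrite uR0, uI0, wR0, wI0. pose proof (We 0). nra. }
  cbv beta in P. rewrite HR, HI in P. lra.
Qed.

Definition powDer (a : R) (k : nat) : R := INR k * a ^ pred k.

Lemma geom_bounded_pow (a : R) : geom_bounded (pow a).
Proof.
  exists 1, (Rabs a). repeat split; [lra | apply Rabs_pos |].
  intros k. rewrite Rmult_1_l, RPow_abs. lra.
Qed.

Lemma geom_bounded_powDer (a : R) : geom_bounded (powDer a).
Proof.
  pose proof (Rabs_pos a) as Ha.
  (* [2 ^ k] absorbs the factor [k], and the base [|a| + 1 >= 1] absorbs the missing power. *)
  exists 1, (2 * (Rabs a + 1)). repeat split; [lra | lra |].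
  intros k. unfold powDer. rewrite Rmult_1_l, Rabs_mult, <- RPow_abs, Rpow_mult_distr.
  pose proof (pos_INR k). pose proof (INR_le_pow2 k).
  apply Rmult_le_compat; try apply Rabs_pos.
  - apply pow_le; auto.
  - rewrite Rabs_pos_eq; lra.
  - apply Rle_trans with ((Rabs a + 1) ^ pred k).
    + apply pow_incr; lra.
    + apply Rle_pow; [lra | lia].
Qed.

Lemma powDer_S (a : R) (k : nat) : powDer a (S k) = a * powDer a k + 1 * a ^ k.
Proof.
  unfold powDer. rewrite S_INR. simpl pred. destruct k as [|k]; [simpl; ring|].
  simpl pred. simpl (a ^ S k). ring.
Qed.

(* With [ul] the derivative of [u] in [l], [u wl - w ul] has derivative [- wgt u^2]. *)
Lemma eigenvalue_simple (nu delta r T a : R) : 0 < r -> 0 < T ->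
  solW nu delta r (pow a) T = 0 -> solW nu delta r (powDer a) T <> 0.
Proof.
  intros Hr HT H0 H1.
  pose proof (geom_bounded_pow a) as G. pose proof (geom_bounded_powDer a) as GD.
  set (u := solU nu delta r (pow a)) in *. set (ud := solU nu delta r (powDer a)) in *.
  set (w := solW nu delta r (pow a)) in *. set (wd := solW nu delta r (powDer a)) in *.
  assert (Du : forall t, is_derive u t (w t + delta * u t)) by (intros t; apply is_derive_solU_W, G).
  assert (Dud : forall t, is_derive ud t (wd t + delta * ud t)) by (intros t; apply is_derive_solU_W, GD).
  assert (Dw : forall t, is_derive w t
    ((nu ^ 2 - delta ^ 2) * u t - wgt r t * (a * u t) - delta * w t)).
  { intros t. eapply is_derive_eq; [apply is_derive_solW, G|].
    rewrite (solU_ext _ _ _ (fun k => a ^ S k) (fun k => a * a ^ k + 0 * a ^ k)) by (intros k; simpl; ring).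
    rewrite solU_comb by auto. fold u w. ring. }
  assert (Dwd : forall t, is_derive wd t
    ((nu ^ 2 - delta ^ 2) * ud t - wgt r t * (a * ud t + u t) - delta * wd t)).
  { intros t. eapply is_derive_eq; [apply is_derive_solW, GD|].
    rewrite (solU_ext _ _ _ (fun k => powDer a (S k)) (fun k => a * powDer a k + 1 * a ^ k)) by apply powDer_S.
    rewrite solU_comb by auto. fold u ud wd. ring. }
  assert (P : 0 < (fun t => w t * ud t - u t * wd t) T).
  { refine (strictly_pos_of_derive (fun t => w t * ud t - u t * wd t)
      (fun t => wgt r t * u t ^ 2) T HT _ _ _ _); cbv beta.
    - unfold w, wd. rewrite !solW_0. ring.
    - intros t _.
      assert (D : is_derive (fun t => w t * ud t - u t * wd t) t
        (((nu ^ 2 - delta ^ 2) * u t - wgt r t * (a * u t) - delta * w t) * ud t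
         + w t * (wd t + delta * ud t)
         - ((w t + delta * u t) * wd t
         + u t * ((nu ^ 2 - delta ^ 2) * ud t - wgt r t * (a * ud t + u t) - delta * wd t)))).
      { apply is_derive_minus_R; apply is_derive_mult_R; auto. }
      eapply is_derive_eq; [exact D|]. ring.
    - intros t _. apply Rmult_le_pos; [apply Rlt_le, wgt_pos, Hr | apply pow2_ge_0].
    - unfold u. rewrite (proj1 (sol_init nu delta r _)).
      apply Rmult_lt_0_compat; [apply wgt_pos, Hr | simpl; lra]. }
  cbv beta in P. rewrite H0, H1 in P. lra.
Qed.

(** * The characteristic function [F] and its relation with [htilde_pos] *)

Definition charcoef (nu delta r T : R) (k : nat) : R :=
  picV nu delta r k T - delta * picU nu delta r k T.

Lemma entire_charcoef (nu delta r T : R) : entire_coef (charcoef nu delta r T).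
Proof.
  destruct (pic_bound nu delta r (Rabs T) (Rabs_pos T)) as [B [rho [HB [Hr H]]]].
  pose proof (Rabs_pos delta) as Hd.
  exists ((1 + Rabs delta) * B), rho. repeat split; auto; [nra|].
  intros k. destruct (H k T (Rle_refl _)) as [H1 H2]. unfold charcoef, Rminus.
  eapply Rle_trans; [apply Rabs_triang|]. rewrite Rabs_Ropp, Rabs_mult.
  pose proof (Rabs_pos (picU nu delta r k T)). nra.
Qed.

Lemma solW_charcoef (nu delta r T : R) (c : nat -> R) : geom_bounded c ->
  solW nu delta r c T = Series (fun k => c k * charcoef nu delta r T k).
Proof.
  intros Hc. unfold solW, solU, solV, charcoef.
  destruct (ex_series_sol nu delta r c T Hc) as [E1 E2].
  rewrite <- Series_scal_l, <- Series_minus; auto.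
  - apply Series_ext. intros k; ring.
  - apply ex_series_scal_R, E1.
Qed.

Lemma charfun_simple (nu delta r T a : R) : 0 < r -> 0 < T ->
  PSeries (charcoef nu delta r T) a = 0 ->
  PSeries (PS_derive (charcoef nu delta r T)) a <> 0.
Proof.
  intros Hr HT H0.
  assert (E0 : PSeries (charcoef nu delta r T) a = solW nu delta r (pow a) T).
  { rewrite solW_charcoef by apply geom_bounded_pow. apply Series_ext. intros k; ring. }
  assert (E1 : PSeries (PS_derive (charcoef nu delta r T)) a = solW nu delta r (powDer a) T).
  { rewrite solW_charcoef by apply geom_bounded_powDer.
    rewrite (Series_incr_1_aux (fun k => powDer a k * charcoef nu delta r T k)).
    - apply Series_ext. intros k. unfold PS_derive, powDer. simpl pred. ring.
    - unfold powDer; simpl; ring. }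
  rewrite E1. apply eigenvalue_simple; auto. rewrite <- E0; exact H0.
Qed.

(** For [l = 0] and [nu = |delta|] the solution is [exp (delta t)], which satisfies [u' = delta u]
    throughout. *)
Lemma charcoef_0 (nu delta r T : R) : nu = Rabs delta -> charcoef nu delta r T 0 = 0.
Proof.
  intros h. unfold charcoef. simpl picU. cbn [picV].
  replace (nu ^ 2) with (delta ^ 2) by (rewrite h, pow2_abs; reflexivity). ring.
Qed.

Lemma ln_ratio_pos (a b : R) : 0 < a -> a < b -> 0 < ln (b / a).
Proof.
  intros Ha Hb. rewrite <- ln_1. apply ln_increasing; [lra|].
  apply (Rmult_lt_reg_r a); auto. unfold Rdiv. rewrite Rmult_assoc, Rinv_l; lra.
Qed.

(* The Wronskians of [u] with [BesselJ nu (t x)] and [BesselY nu (t x)] are constant in [t];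
   eliminating [u] at the outer end leaves the Wronskian [c] of the two Bessel functions. *)
Lemma htilde_pos_charfun (rin rout delta nu : R) : 0 < rin -> rin < rout -> 0 <= nu ->
  exists c, c <> 0 /\ forall x, 0 < x ->
    htilde_pos rin rout nu delta x =
    c * PSeries (charcoef nu delta rin (ln (rout / rin))) (x ^ 2) / x ^ 2.
Proof.
  intros Hr HR Hnu. set (T := ln (rout / rin)).
  assert (HT : 0 < T) by (apply ln_ratio_pos; auto).
  destruct (bessel_fundamental nu Hnu) as [J1 [Y1 [c [Hc [HJ [HY HW]]]]]].
  exists (c / (rin * rout)). split.
  { apply Rmult_integral_contrapositive_currified; auto. apply Rinv_neq_0_compat. nra. }
  intros x Hx.
  set (u := solU nu delta rin (pow (x ^ 2))). set (v := solV nu delta rin (pow (x ^ 2))).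
  pose proof (geom_bounded_pow (x ^ 2)) as G.
  assert (Key : forall f f1, bessel_sol nu f f1 ->
    u T * f1 (rout * x) - v T * f (rout * x) = f1 (rin * x) - delta * f (rin * x)).
  { intros f f1 Hf.
    (* [f1 (rin * exp t * x)] is the [t]-derivative of [f (rin * exp t * x)], so [D] is the
       Wronskian of two solutions of the equation with [l = x^2]. *)
    set (D := fun t => u t * f1 (rin * exp t * x) - v t * f (rin * exp t * x)).
    assert (DD : D 0 = D T).
    { apply (eq_is_derive (V := R_NormedModule) D 0 T); auto. intros t _.
      assert (Hy : 0 < rin * exp t * x).
      { apply Rmult_lt_0_compat; auto. apply Rmult_lt_0_compat; auto. apply exp_pos. }
      destruct (Hf _ Hy) as [F F1].
      assert (Dy : is_derive (fun t => rin * exp t * x) t (rin * exp t * x)).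
      { auto_derive; [auto|]. ring. }
      unfold D. eapply is_derive_eq.
      - apply is_derive_minus_R; apply is_derive_mult_R.
        + apply is_derive_solU, G.
        + apply (is_derive_comp_R f1 (fun t => rin * exp t * x)); [exact F1 | exact Dy].
        + apply is_derive_solV, G.
        + apply (is_derive_comp_R f (fun t => rin * exp t * x)); [exact F | exact Dy].
      - cbv beta.
        rewrite (solU_ext nu delta rin (fun k => (x ^ 2) ^ S k) (fun k => x ^ 2 * (x ^ 2) ^ k + 0 * (x ^ 2) ^ k))
          by (intros k; simpl; ring).
        rewrite solU_comb by auto. unfold wgt.
        replace (exp (2 * t)) with (exp t * exp t) by (rewrite <- exp_plus; f_equal; ring).
        change (solU nu delta rin (pow (x ^ 2)) t) with (u t).
        change (solV nu delta rin (pow (x ^ 2)) t) with (v t).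
        generalize (f (rin * exp t * x)) (f1 (rin * exp t * x)) (u t) (v t). intros a a1 b b1.
        pose proof (exp_pos t) as He.
        transitivity 0; [|reflexivity]. field. repeat split; lra. }
    unfold D in DD. rewrite exp_0, Rmult_1_r in DD.
    replace (rin * exp T) with rout in DD.
    2: { unfold T. rewrite exp_ln by (apply Rdiv_lt_0_compat; lra). field; lra. }
    rewrite <- DD. unfold u, v. destruct (sol_init nu delta rin (pow (x ^ 2))) as [-> ->].
    simpl. ring. }
  pose proof (Key _ _ HJ) as KJ. pose proof (Key _ _ HY) as KY.
  assert (HRx : 0 < rout * x) by (apply Rmult_lt_0_compat; lra).
  assert (Hrx : 0 < rin * x) by (apply Rmult_lt_0_compat; lra).
  pose proof (HW _ HRx) as W.
  assert (E0 : PSeries (charcoef nu delta rin T) (x ^ 2) = v T - delta * u T).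
  { transitivity (solW nu delta rin (pow (x ^ 2)) T); [|reflexivity].
    rewrite solW_charcoef by apply G. apply Series_ext. intros k; ring. }
  rewrite E0.
  unfold htilde_pos, BesselJ', BesselY'.
  rewrite !(Derive_bessel_sol nu _ _ _ HJ), !(Derive_bessel_sol nu _ _ _ HY) by auto.
  set (JR := BesselJ nu (rout * x)) in *. set (YR := BesselY nu (rout * x)) in *.
  set (Jr := BesselJ nu (rin * x)) in *. set (Yr := BesselY nu (rin * x)) in *.
  set (JR1 := J1 (rout * x)) in *. set (YR1 := Y1 (rout * x)) in *.
  set (Jr1 := J1 (rin * x)) in *. set (Yr1 := Y1 (rin * x)) in *.
  (* [htilde_pos] is the 2 by 2 determinant of the boundary values [f1 - delta f] of both Bessel
     functions at both radii. Rewriting the inner values by [KJ] and [KY] leaves [(v - delta u)]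
     times the outer Wronskian. *)
  transitivity (((JR1 - delta * JR) * (Yr1 - delta * Yr) - (Jr1 - delta * Jr) * (YR1 - delta * YR))
    / (rin * rout * x ^ 2)); [field; repeat split; lra|].
  rewrite <- KJ, <- KY, <- W. field. repeat split; lra.
Qed.

(** * Complex power series *)

Lemma Cmod_le_Rabs (z : C) : Cmod z <= Rabs (Re z) + Rabs (Im z).
Proof.
  replace z with (RtoC (Re z) + Ci * RtoC (Im z))%C at 1.
  - eapply Rle_trans; [apply Cmod_triangle|].
    rewrite Cmod_mult, Cmod_Ci, !Cmod_R. lra.
  - destruct z as [a b]. unfold Re, Im, RtoC, Ci, Cplus, Cmult; simpl. f_equal; ring.
Qed.

Definition sumC (x : nat -> C) (n : nat) : C := sum_n (G := C_AbelianMonoid) x n.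

Lemma sumC_0 (x : nat -> C) : sumC x 0 = x O.
Proof. apply (sum_O (G := C_AbelianMonoid)). Qed.

Lemma sumC_S (x : nat -> C) (n : nat) : sumC x (S n) = (sumC x n + x (S n))%C.
Proof. apply (sum_Sn (G := C_AbelianMonoid)). Qed.

Definition is_seriesC (x : nat -> C) (l : C) : Prop :=
  is_series (K := C_AbsRing) (V := C_NormedModule) x l.

Lemma is_seriesC_eps (x : nat -> C) (l : C) :
  is_seriesC x l <-> forall eps : posreal, eventually (fun n => Cmod (sumC x n - l)%C < eps).
Proof.
  apply (filterlim_locally_ball_norm (K := C_AbsRing) (U := C_NormedModule) (F := eventually)).
Qed.

Lemma is_seriesC_unique (x : nat -> C) (l l' : C) : is_seriesC x l -> is_seriesC x l' -> l = l'.
Proof. intros H H'. apply (filterlim_locally_unique _ _ _ H H'). Qed.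

Lemma is_seriesC_ext (x y : nat -> C) (l : C) :
  (forall k, x k = y k) -> is_seriesC x l -> is_seriesC y l.
Proof. intros H. apply (is_series_ext (K := C_AbsRing) (V := C_NormedModule) x y l H). Qed.

(** A total, componentwise sum, so that real results on [Series] apply; [csum_correct] identifies it
    with the limit in [C] under absolute summability. *)
Definition csum (x : nat -> C) : C := (Series (fun k => Re (x k)), Series (fun k => Im (x k))).

Definition abs_summable (x : nat -> C) : Prop := ex_series (fun k => Cmod (x k)).

Lemma abs_summable_Re (x : nat -> C) : abs_summable x -> ex_series (fun k => Re (x k)).
Proof. apply ex_series_le_R. intros k; apply re_le_Cmod. Qed.

Lemma abs_summable_Im (x : nat -> C) : abs_summable x -> ex_series (fun k => Im (x k)).
Proof. apply ex_series_le_R. intros k; apply im_le_Cmod. Qed.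

Lemma abs_summable_le (x : nat -> C) (m : nat -> R) :
  (forall k, Cmod (x k) <= m k) -> ex_series m -> abs_summable x.
Proof.
  intros H. apply ex_series_le_R. intros k. rewrite Rabs_pos_eq by apply Cmod_ge_0. auto.
Qed.

Lemma csum_correct (x : nat -> C) : abs_summable x -> is_seriesC x (csum x).
Proof.
  intros H. apply is_seriesC_eps. intros eps.
  pose proof (Series_correct _ (abs_summable_Re x H)) as HR.
  pose proof (Series_correct _ (abs_summable_Im x H)) as HI.
  pose proof (proj1 (filterlim_locally_ball_norm (K := R_AbsRing) (U := R_NormedModule) (F := eventually) _ _) HR) as HR'.
  pose proof (proj1 (filterlim_locally_ball_norm (K := R_AbsRing) (U := R_NormedModule) (F := eventually) _ _) HI) as HI'.
  assert (E : forall n, Re (sumC x n) = sum_n (fun k => Re (x k)) n /\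
    Im (sumC x n) = sum_n (fun k => Im (x k)) n).
  { induction n as [|n [IH1 IH2]].
    - rewrite sumC_0, !sum_O. auto.
    - rewrite sumC_S, !sum_Sn, <- IH1, <- IH2. split; reflexivity. }
  assert (He : 0 < eps / 2) by (pose proof (cond_pos eps); lra).
  generalize (filter_and _ _ (HR' (mkposreal _ He)) (HI' (mkposreal _ He))).
  apply filter_imp. intros n [H1 H2]. destruct (E n) as [E1 E2].
  eapply Rle_lt_trans; [apply Cmod_le_Rabs|].
  change (Rabs (sum_n (fun k => Re (x k)) n - Series (fun k => Re (x k))) < eps / 2) in H1.
  change (Rabs (sum_n (fun k => Im (x k)) n - Series (fun k => Im (x k))) < eps / 2) in H2.
  rewrite <- E1 in H1. rewrite <- E2 in H2.
  change (Rabs (Re (sumC x n) - Series (fun k => Re (x k)))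
    + Rabs (Im (sumC x n) - Series (fun k => Im (x k))) < eps). lra.
Qed.

Lemma csum_unique (x : nat -> C) (l : C) : abs_summable x -> is_seriesC x l -> l = csum x.
Proof. intros H Hl. eapply is_seriesC_unique; [exact Hl | apply csum_correct, H]. Qed.

(** The factor 2 comes from bounding the two components separately. *)
Lemma Cmod_csum_le (x : nat -> C) (m : nat -> R) :
  (forall k, Cmod (x k) <= m k) -> ex_series m -> Cmod (csum x) <= 2 * Series m.
Proof.
  intros H Hm. eapply Rle_trans; [apply Cmod_le_Rabs|].
  assert (Rabs (Re (csum x)) <= 1 * Series m).
  { apply Series_bound; auto. intros k. rewrite Rmult_1_l.
    eapply Rle_trans; [apply re_le_Cmod | apply H]. }
  assert (Rabs (Im (csum x)) <= 1 * Series m).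
  { apply Series_bound; auto. intros k. rewrite Rmult_1_l.
    eapply Rle_trans; [apply im_le_Cmod | apply H]. }
  lra.
Qed.

Lemma csum_ext (x y : nat -> C) : (forall k, x k = y k) -> csum x = csum y.
Proof. intros H. unfold csum. f_equal; apply Series_ext; intros k; rewrite H; reflexivity. Qed.

Lemma csum_plus (x y : nat -> C) : abs_summable x -> abs_summable y ->
  csum (fun k => x k + y k)%C = (csum x + csum y)%C.
Proof.
  intros Hx Hy. apply injective_projections.
  - apply (Series_plus (fun k => Re (x k)) (fun k => Re (y k))); apply abs_summable_Re; auto.
  - apply (Series_plus (fun k => Im (x k)) (fun k => Im (y k))); apply abs_summable_Im; auto.
Qed.

Lemma csum_scal (c : C) (x : nat -> C) : abs_summable x ->
  csum (fun k => c * x k)%C = (c * csum x)%C.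
Proof.
  intros Hx.
  pose proof (abs_summable_Re x Hx). pose proof (abs_summable_Im x Hx).
  apply injective_projections.
  - change (Series (fun k => Re c * Re (x k) - Im c * Im (x k)) =
      Re c * Series (fun k => Re (x k)) - Im c * Series (fun k => Im (x k))).
    rewrite <- !Series_scal_l. apply Series_minus; apply ex_series_scal_R; auto.
  - change (Series (fun k => Re c * Im (x k) + Im c * Re (x k)) =
      Re c * Series (fun k => Im (x k)) + Im c * Series (fun k => Re (x k))).
    rewrite <- !Series_scal_l. apply Series_plus; apply ex_series_scal_R; auto.
Qed.

Lemma abs_summable_scal (c : C) (x : nat -> C) : abs_summable x -> abs_summable (fun k => c * x k)%C.
Proof.
  intros H. apply abs_summable_le with (fun k => Cmod c * Cmod (x k)).
  - intros k; rewrite Cmod_mult; lra.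
  - apply ex_series_scal_R, H.
Qed.

Definition is_pseriesC (a : nat -> C) (w l : C) : Prop :=
  is_pseries (K := C_AbsRing) (V := C_NormedModule) a w l.

Lemma pow_n_Cpow (w : C) (k : nat) : pow_n (K := C_AbsRing) w k = (w ^ k)%C.
Proof. induction k as [|k IH]; [reflexivity|]. simpl. rewrite IH. reflexivity. Qed.

Lemma is_pseriesC_iff (a : nat -> C) (w l : C) :
  is_pseriesC a w l <-> is_seriesC (fun k => w ^ k * a k)%C l.
Proof.
  assert (E : forall k, Cmult (pow_n (K := C_AbsRing) w k) (a k) = (w ^ k * a k)%C).
  { intros k. apply (f_equal (fun u => u * a k)%C), pow_n_Cpow. }
  split; apply is_seriesC_ext; intros k; [apply E | symmetry; apply E].
Qed.

Lemma is_lim_half_pow (K : R) : 0 <= K -> forall eps : posreal,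
  eventually (fun n => K * (/ 2) ^ n < eps).
Proof.
  intros HK eps. pose proof (cond_pos eps) as He.
  destruct (pow_lt_1_zero (/ 2)) with (y := eps / (K + 1)) as [N HN].
  - rewrite Rabs_pos_eq; lra.
  - apply Rdiv_lt_0_compat; lra.
  - exists N. intros n Hn. specialize (HN n Hn).
    rewrite Rabs_pos_eq in HN by (apply pow_le; lra).
    apply Rle_lt_trans with ((K + 1) * (/ 2) ^ n).
    + apply Rmult_le_compat_r; [apply pow_le; lra | lra].
    + apply (Rmult_lt_compat_l (K + 1)) in HN; [|lra].
      replace ((K + 1) * (eps / (K + 1))) with (pos eps) in HN by (field; lra). exact HN.
Qed.

(* [shift_coef z n m] is the coefficient of [w^m] in [(z + w)^n]. *)
Fixpoint shift_coef (z : C) (n m : nat) : C :=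
  match n, m with
  | O, O => 1
  | O, S _ => 0
  | S n, O => z * shift_coef z n O
  | S n, S m => z * shift_coef z n (S m) + shift_coef z n m
  end%C.

Lemma shift_coef_bound (z : C) (n m : nat) : Cmod (shift_coef z n m) <= (Cmod z + 1) ^ n.
Proof.
  pose proof (Cmod_ge_0 z) as Hz.
  revert m; induction n as [|n IH]; intros m.
  - destruct m; simpl; [rewrite Cmod_1 | rewrite Cmod_0]; lra.
  - assert (0 <= (Cmod z + 1) ^ n) by (apply pow_le; lra).
    destruct m as [|m]; simpl.
    + rewrite Cmod_mult. specialize (IH O). pose proof (Cmod_ge_0 (shift_coef z n 0)). nra.
    + eapply Rle_trans; [apply Cmod_triangle|]. rewrite Cmod_mult.
      pose proof (IH m). pose proof (IH (S m)).
      pose proof (Cmod_ge_0 (shift_coef z n (S m))). nra.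
Qed.

Definition shift_trunc (z w : C) (n M : nat) : C := sumC (fun m => w ^ m * shift_coef z n m)%C M.

Lemma shift_trunc_S0 (z w : C) (n : nat) :
  shift_trunc z w (S n) 0 = (z * shift_trunc z w n 0)%C.
Proof. unfold shift_trunc. rewrite !sumC_0. simpl. ring. Qed.

Lemma shift_trunc_SS (z w : C) (n M : nat) :
  shift_trunc z w (S n) (S M) = (z * shift_trunc z w n (S M) + w * shift_trunc z w n M)%C.
Proof.
  induction M as [|M IH].
  - unfold shift_trunc. rewrite !sumC_S, !sumC_0. simpl. ring.
  - unfold shift_trunc in *. rewrite sumC_S, IH.
    rewrite (sumC_S _ (S M)), (sumC_S (fun m => (w ^ m * shift_coef z n m)%C) M).
    simpl. ring.
Qed.

Lemma shift_trunc_0 (z w : C) (M : nat) : shift_trunc z w 0 M = RtoC 1.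
Proof.
  unfold shift_trunc. induction M as [|M IH].
  - rewrite sumC_0. simpl. ring.
  - rewrite sumC_S, IH. simpl. ring.
Qed.

(** The remainder only has monomials of degree above [M] in [w], and doubling [|w|] multiplies each
    by at least [2^M]. The induction on [n] by Pascal's rule realises this, with a rate in [M] that
    is uniform in [n]. *)
Lemma shift_remainder (z w : C) (n M : nat) :
  Cmod ((z + w) ^ n - shift_trunc z w n M)%C <= (/ 2) ^ M * (Cmod z + 2 * Cmod w) ^ n.
Proof.
  pose proof (Cmod_ge_0 z) as Hz. pose proof (Cmod_ge_0 w) as Hw.
  assert (HM : forall M, 0 < (/ 2) ^ M) by (intros; apply pow_lt; lra).
  revert M; induction n as [|n IH]; intros M.
  - rewrite shift_trunc_0. simpl. replace (RtoC 1 - RtoC 1)%C with (RtoC 0) by ring.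
    rewrite Cmod_0. pose proof (HM M). lra.
  - set (Q := Cmod z + 2 * Cmod w) in *.
    assert (HQ : 0 <= Q ^ n) by (apply pow_le; unfold Q; lra).
    destruct M as [|M].
    + rewrite shift_trunc_S0, Cpow_S.
      replace ((z + w) * (z + w) ^ n - z * shift_trunc z w n 0)%C with
        (z * ((z + w) ^ n - shift_trunc z w n 0) + w * (z + w) ^ n)%C by ring.
      eapply Rle_trans; [apply Cmod_triangle|]. rewrite !Cmod_mult, Cmod_pow.
      specialize (IH O). simpl in IH |- *. rewrite Rmult_1_l in *.
      assert (Cmod (z + w) ^ n <= Q ^ n).
      { apply pow_incr. split; [apply Cmod_ge_0|]. pose proof (Cmod_triangle z w). unfold Q; lra. }
      apply Rle_trans with (Cmod z * Q ^ n + Cmod w * Q ^ n).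
      * apply Rplus_le_compat; apply Rmult_le_compat_l; auto.
      * assert (Cmod z + Cmod w <= Q) by (unfold Q; lra). nra.
    + rewrite shift_trunc_SS, Cpow_S.
      replace ((z + w) * (z + w) ^ n - (z * shift_trunc z w n (S M) + w * shift_trunc z w n M))%C with
        (z * ((z + w) ^ n - shift_trunc z w n (S M)) + w * ((z + w) ^ n - shift_trunc z w n M))%C by ring.
      eapply Rle_trans; [apply Cmod_triangle|]. rewrite !Cmod_mult.
      pose proof (IH (S M)) as I1. pose proof (IH M) as I2.
      apply (Rmult_le_compat_l (Cmod z)) in I1; auto.
      apply (Rmult_le_compat_l (Cmod w)) in I2; auto.
      eapply Rle_trans; [apply Rplus_le_compat; [exact I1 | exact I2]|].
      right. unfold Q. simpl. fold Q. unfold Q. field.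
Qed.

(* Comparing with the truncated expansions avoids exchanging two infinite summations. *)
Lemma analytic_even_series (g : nat -> R) (z : C) :
  (forall rho, ex_series (fun k => Rabs (g k) * rho ^ (2 * k))) ->
  analytic_at (fun z => csum (fun k => g k * z ^ (2 * k))%C) z.
Proof.
  intros Hg.
  exists (fun m => csum (fun k => g k * shift_coef z (2 * k) m)%C), 1.
  split; [lra|]. intros w' _. set (w := (w' - z)%C).
  replace w' with (z + w)%C by (unfold w; ring). clearbody w. clear w'.
  apply is_pseriesC_iff.
  assert (S1 : forall m, abs_summable (fun k => g k * shift_coef z (2 * k) m)%C).
  { intros m. apply abs_summable_le with (fun k => Rabs (g k) * (Cmod z + 1) ^ (2 * k)); auto.
    intros k. rewrite Cmod_mult, Cmod_R. apply Rmult_le_compat_l; [apply Rabs_pos|].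
    apply shift_coef_bound. }
  assert (S2 : abs_summable (fun k => g k * (z + w) ^ (2 * k))%C).
  { apply abs_summable_le with (fun k => Rabs (g k) * Cmod (z + w) ^ (2 * k)); auto.
    intros k. rewrite Cmod_mult, Cmod_R, Cmod_pow. lra. }
  assert (HP : forall M, abs_summable (fun k => g k * shift_trunc z w (2 * k) M)%C /\
    sumC (fun m => w ^ m * csum (fun k => g k * shift_coef z (2 * k) m))%C M =
    csum (fun k => g k * shift_trunc z w (2 * k) M)%C).
  { assert (T : forall m, abs_summable (fun k => w ^ m * (g k * shift_coef z (2 * k) m))%C).
    { intros m. apply abs_summable_scal, S1. }
    induction M as [|M [IH1 IH2]].
    - assert (E : forall k, (w ^ 0 * (g k * shift_coef z (2 * k) 0) = g k * shift_trunc z w (2 * k) 0)%C).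
      { intros k. unfold shift_trunc. rewrite sumC_0. ring. }
      split.
      + apply abs_summable_le with (fun k => Cmod (w ^ 0 * (g k * shift_coef z (2 * k) 0))%C); [|apply T].
        intros k. rewrite E. lra.
      + rewrite sumC_0, <- (csum_scal (w ^ 0)%C) by apply S1. apply csum_ext, E.
    - assert (E : forall k, (g k * shift_trunc z w (2 * k) M + w ^ S M * (g k * shift_coef z (2 * k) (S M))
        = g k * shift_trunc z w (2 * k) (S M))%C).
      { intros k. unfold shift_trunc. rewrite sumC_S. ring. }
      split.
      + apply abs_summable_le with (fun k => Cmod (g k * shift_trunc z w (2 * k) M)%C
          + Cmod (w ^ S M * (g k * shift_coef z (2 * k) (S M)))%C).
        * intros k. rewrite <- E. apply Cmod_triangle.
        * apply (ex_series_plus (fun k => Cmod (g k * shift_trunc z w (2 * k) M)%C)); [exact IH1 | apply T].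
      + rewrite sumC_S, IH2, <- (csum_scal (w ^ S M)%C), <- csum_plus by auto.
        apply csum_ext, E. }
  apply is_seriesC_eps. intros eps.
  set (Q := Cmod z + 2 * Cmod w).
  set (K := Series (fun k => Rabs (g k) * Q ^ (2 * k))).
  assert (HK : 0 <= K).
  { assert (0 <= Cmod (csum (fun _ => RtoC 0))) by apply Cmod_ge_0.
    assert (Cmod (csum (fun _ => RtoC 0)) <= 2 * K); [|lra].
    apply Cmod_csum_le; [|apply Hg]. intros k. rewrite Cmod_0.
    apply Rmult_le_pos; [apply Rabs_pos|]. apply pow_le. unfold Q.
    pose proof (Cmod_ge_0 z). pose proof (Cmod_ge_0 w). lra. }
  generalize (is_lim_half_pow (2 * K) ltac:(lra) eps). apply filter_imp. intros M HM.
  destruct (HP M) as [S3 ->].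
  eapply Rle_lt_trans; [|exact HM].
  replace (csum (fun k => g k * shift_trunc z w (2 * k) M)%C - csum (fun k => g k * (z + w) ^ (2 * k))%C)%C
    with (- (csum (fun k => g k * (z + w) ^ (2 * k))%C + (- RtoC 1) * csum (fun k => g k * shift_trunc z w (2 * k) M)%C))%C by ring.
  rewrite Cmod_opp, <- csum_scal, <- csum_plus by auto using abs_summable_scal.
  replace (2 * K * (/ 2) ^ M) with (2 * ((/ 2) ^ M * K)) by ring.
  unfold K. rewrite <- Series_scal_l. apply Cmod_csum_le.
  - intros k.
    replace (g k * (z + w) ^ (2 * k) + - RtoC 1 * (g k * shift_trunc z w (2 * k) M))%C with
      (g k * ((z + w) ^ (2 * k) - shift_trunc z w (2 * k) M))%C by ring.
    rewrite Cmod_mult, Cmod_R.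
    replace ((/ 2) ^ M * (Rabs (g k) * Q ^ (2 * k))) with (Rabs (g k) * ((/ 2) ^ M * Q ^ (2 * k))) by ring.
    apply Rmult_le_compat_l; [apply Rabs_pos|]. apply shift_remainder.
  - apply ex_series_scal_R, Hg.
Qed.

(** The derivative of the geometric series in [q = - w / z]. Its partial sums times [(z + w)^2] have
    the closed form [HP]. The radius [|z| / 4] gives [|q| <= 1/4], so that [(M + 1) |q|^M] is at
    most [2^(-M)]. *)
Lemma analytic_inv_sqr (z : C) : z <> RtoC 0 -> analytic_at (fun z => / (z * z))%C z.
Proof.
  intros Hz. pose proof (proj1 (Cmod_gt_0 z) Hz) as Hm.
  exists (fun m => (RtoC (INR m + 1) * (- / z) ^ m * / (z * z))%C), (Cmod z / 4).
  split; [lra|]. intros w' Hw. set (w := (w' - z)%C) in *.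
  replace w' with (z + w)%C by (unfold w; ring). clearbody w. clear w'.
  apply is_pseriesC_iff.
  set (q := (- / z * w)%C).
  assert (Hq : Cmod q <= / 4).
  { unfold q. rewrite Cmod_mult, Cmod_opp, Cmod_inv by auto.
    apply (Rmult_le_reg_l (Cmod z)); auto. rewrite <- Rmult_assoc, Rinv_r by lra. lra. }
  assert (Hq1 : (RtoC 1 - q)%C <> RtoC 0).
  { intros h. assert (q = RtoC 1) by (replace q with (RtoC 1 - (RtoC 1 - q))%C by ring; rewrite h; ring).
    rewrite H, Cmod_1 in Hq. lra. }
  assert (Hzw : (z + w = z * (RtoC 1 - q))%C) by (unfold q; field; auto).
  set (P := fun M => sumC (fun m => w ^ m * (RtoC (INR m + 1) * (- / z) ^ m * / (z * z)))%C M).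
  assert (HP : forall M, ((z + w) * (z + w) * P M =
    RtoC 1 - (INR M + 2) * q ^ S M + (INR M + 1) * q ^ S (S M))%C).
  { induction M as [|M IH].
    - unfold P. rewrite sumC_0, Hzw. simpl. rewrite !RtoC_plus. field. auto.
    - unfold P in *. rewrite sumC_S, Cmult_plus_distr_l, IH, Hzw, S_INR.
      replace (w ^ S M * ((INR M + 1 + 1)%R * (- / z) ^ S M * / (z * z)))%C with
        ((INR M + 1 + 1)%R * q ^ S M * / (z * z))%C
        by (unfold q; rewrite Cpow_mult_l; ring).
      rewrite !RtoC_plus. simpl. field. auto. }
  apply is_seriesC_eps. intros eps.
  set (K := 4 * / (Cmod (z + w) * Cmod (z + w))).
  assert (Hzw0 : (z + w)%C <> RtoC 0).
  { rewrite Hzw. apply Cmult_neq_0; auto. }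
  pose proof (proj1 (Cmod_gt_0 _) Hzw0) as Hzwp.
  assert (HK : 0 <= K).
  { unfold K. apply Rmult_le_pos; [lra|]. left. apply Rinv_0_lt_compat. nra. }
  generalize (is_lim_half_pow K HK eps). apply filter_imp. intros M HM.
  eapply Rle_lt_trans; [|exact HM]. fold (P M).
  replace (P M - / ((z + w) * (z + w)))%C with
    (((INR M + 1) * q ^ S (S M) - (INR M + 2) * q ^ S M) * / ((z + w) * (z + w)))%C.
  2: { replace ((INR M + 1) * q ^ S (S M) - (INR M + 2) * q ^ S M)%C with
         ((z + w) * (z + w) * P M - RtoC 1)%C by (rewrite HP; ring).
       field. auto. }
  rewrite Cmod_mult, Cmod_inv, Cmod_mult by (apply Cmult_neq_0; auto).
  unfold K. rewrite Rmult_assoc, (Rmult_comm (/ _)), <- Rmult_assoc.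
  apply Rmult_le_compat_r; [left; apply Rinv_0_lt_compat; nra|].
  unfold Cminus. eapply Rle_trans; [apply Cmod_triangle|].
  pose proof (pos_INR M) as HMp. pose proof (INR_le_pow2 M) as H2.
  rewrite Cmod_opp, !Cmod_mult, !Cmod_pow, <- !RtoC_plus, !Cmod_R, !Rabs_pos_eq by lra.
  pose proof (Cmod_ge_0 q) as Hq0.
  assert (HqM : Cmod q ^ M <= (/ 4) ^ M) by (apply pow_incr; lra).
  assert (HqM0 : 0 <= Cmod q ^ M) by (apply pow_le; auto).
  assert (E4 : (/ 4) ^ M * 2 ^ M = (/ 2) ^ M).
  { rewrite <- Rpow_mult_distr. f_equal. lra. }
  assert (Hprod : (INR M + 1) * Cmod q ^ M <= (/ 2) ^ M).
  { rewrite <- E4, Rmult_comm. apply Rmult_le_compat; lra. }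
  change (Cmod q ^ S (S M)) with (Cmod q * (Cmod q * Cmod q ^ M)).
  change (Cmod q ^ S M) with (Cmod q * Cmod q ^ M).
  set (X := Cmod q ^ M) in *. set (N := INR M) in *.
  assert (0 <= (N + 1) * X) by nra.
  assert ((N + 1) * (Cmod q * (Cmod q * X)) <= (N + 1) * X) by
    (replace ((N + 1) * (Cmod q * (Cmod q * X))) with (Cmod q * Cmod q * ((N + 1) * X)) by ring;
     assert (Cmod q * Cmod q <= 1) by nra; nra).
  assert ((N + 2) * (Cmod q * X) <= 2 * ((N + 1) * X)) by nra.
  lra.
Qed.

Lemma analytic_at_plus (f g : C -> C) (z : C) :
  analytic_at f z -> analytic_at g z -> analytic_at (fun z => f z + g z)%C z.
Proof.
  intros [a [e [He Ha]]] [b [e' [He' Hb]]].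
  exists (PS_plus (K := C_AbsRing) (V := C_NormedModule) a b), (Rmin e e').
  split; [apply Rmin_glb_lt; auto|]. intros w Hw.
  apply (is_pseries_plus (K := C_AbsRing) (V := C_NormedModule) a b).
  - apply Ha. eapply Rlt_le_trans; [exact Hw | apply Rmin_l].
  - apply Hb. eapply Rlt_le_trans; [exact Hw | apply Rmin_r].
Qed.

Lemma analytic_at_scal (c : C) (f : C -> C) (z : C) :
  analytic_at f z -> analytic_at (fun z => c * f z)%C z.
Proof.
  intros [a [e [He Ha]]].
  exists (PS_scal (K := C_AbsRing) (V := C_NormedModule) c a), e.
  split; auto. intros w Hw.
  apply (is_pseries_scal (K := C_AbsRing) (V := C_NormedModule) c a).
  - apply Cmult_comm.
  - apply Ha, Hw.
Qed.

(** * The identity theorem *)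

Lemma is_seriesC_terms_bounded (x : nat -> C) (l : C) :
  is_seriesC x l -> exists B, 0 <= B /\ forall k, Cmod (x k) <= B.
Proof.
  intros H.
  destruct (filterlim_bounded (K := C_AbsRing) (V := C_NormedModule) (sumC x)) as [M HM].
  { exists l. exact H. }
  assert (HM' : forall n, Cmod (sumC x n) <= M) by exact HM.
  assert (0 <= M) by (eapply Rle_trans; [apply Cmod_ge_0 | apply (HM' O)]).
  exists (M + M). split; [lra|]. intros [|k].
  - rewrite <- sumC_0. pose proof (HM' O). lra.
  - replace (x (S k)) with (sumC x (S k) + - sumC x k)%C by (rewrite sumC_S; ring).
    eapply Rle_trans; [apply Cmod_triangle|]. rewrite Cmod_opp.
    pose proof (HM' (S k)). pose proof (HM' k). lra.
Qed.

Definition represents (a : nat -> C) (phi : C -> C) (e : R) : Prop :=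
  0 < e /\ forall w, Cmod w < e -> is_pseriesC a w (phi w).

(** The terms at [e / 2] are bounded, so those at radius [e / 4] are dominated by a geometric
    series. Applied to a quotient [psi] in [phi = a 0 + w psi], this plays the role of continuity at
    the centre. *)
Lemma represents_bounded (a : nat -> C) (phi : C -> C) (e : R) : represents a phi e ->
  exists rho K, 0 < rho /\ rho <= e /\ 0 <= K /\ forall w, Cmod w < rho -> Cmod (phi w) <= K.
Proof.
  intros [He H].
  destruct (is_seriesC_terms_bounded (fun k => RtoC (e / 2) ^ k * a k)%C (phi (RtoC (e / 2)))) as [B [HB Hb]].
  { apply is_pseriesC_iff, H. rewrite Cmod_R, Rabs_pos_eq; lra. }
  assert (Hgeo : ex_series (fun k => B * (/ 2) ^ k)).
  { apply ex_series_scal_R, ex_series_geom. rewrite Rabs_pos_eq; lra. }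
  exists (e / 4), (2 * Series (fun k => B * (/ 2) ^ k)).
  assert (Main : forall w, Cmod w < e / 4 -> Cmod (phi w) <= 2 * Series (fun k => B * (/ 2) ^ k)).
  { intros w Hw.
    assert (Hk : forall k, Cmod (w ^ k * a k)%C <= B * (/ 2) ^ k).
    { intros k. rewrite Cmod_mult, Cmod_pow. specialize (Hb k).
      rewrite Cmod_mult, Cmod_pow, Cmod_R, (Rabs_pos_eq (e / 2)) in Hb by lra.
      assert (Cmod w ^ k <= (/ 2) ^ k * (e / 2) ^ k).
      { rewrite <- Rpow_mult_distr. apply pow_incr. split; [apply Cmod_ge_0 | lra]. }
      assert (0 <= (/ 2) ^ k) by (apply pow_le; lra).
      pose proof (Cmod_ge_0 (a k)). nra. }
    rewrite (csum_unique (fun k => w ^ k * a k)%C (phi w)).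
    - apply Cmod_csum_le; auto.
    - eapply abs_summable_le; [exact Hk | exact Hgeo].
    - apply is_pseriesC_iff, H. lra. }
  repeat split; auto; try lra.
  eapply Rle_trans; [apply Cmod_ge_0 | apply (Main (RtoC 0))]. rewrite Cmod_0. lra.
Qed.

Lemma represents_0 (a : nat -> C) (phi : C -> C) (e : R) : represents a phi e -> phi (RtoC 0) = a O.
Proof.
  intros [He H].
  assert (H0 : is_pseriesC a (RtoC 0) (phi (RtoC 0))) by (apply H; rewrite Cmod_0; auto).
  apply (filterlim_locally_unique _ _ _ H0).
  apply (is_pseries_0 (K := C_AbsRing) (V := C_NormedModule) a).
Qed.

Lemma represents_tail (a : nat -> C) (phi : C -> C) (e : R) : represents a phi e ->
  exists psi, represents (fun k => a (S k)) psi e /\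
    forall w, Cmod w < e -> phi w = (a O + w * psi w)%C.
Proof.
  intros HR. pose proof (represents_0 _ _ _ HR) as H0. destruct HR as [He H].
  exists (fun w => if excluded_middle_informative (w = RtoC 0) then a 1%nat
                   else (/ w * (phi w - a O))%C).
  split; [split; auto|].
  - intros w Hw. destruct (excluded_middle_informative (w = RtoC 0)) as [->|h].
    + apply (is_pseries_0 (K := C_AbsRing) (V := C_NormedModule) (fun k => a (S k))).
    + apply (is_pseries_decr_1 (K := C_AbsRing) (V := C_NormedModule) a w (/ w)%C (phi w)); [|apply H, Hw].
      apply Cinv_l, h.
  - intros w Hw. destruct (excluded_middle_informative (w = RtoC 0)) as [->|h].
    + rewrite H0. ring.
    + field. auto.
Qed.

Definition zeros_cluster (phi : C -> C) : Prop :=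
  forall eps, 0 < eps -> exists w, w <> RtoC 0 /\ Cmod w < eps /\ phi w = RtoC 0.

(** At a small zero [w] one has [a 0 = - w psi w] with [psi] bounded, hence [a 0 = 0]. Then the
    nonzero zeros of [phi] are zeros of [psi], and the induction continues with the shifted
    series. *)
Lemma represents_zeros (n : nat) : forall (a : nat -> C) (phi : C -> C) (e : R),
  represents a phi e -> zeros_cluster phi -> a n = RtoC 0.
Proof.
  induction n as [|n IH]; intros a phi e HR HZ;
    destruct (represents_tail a phi e HR) as [psi [HR' E]].
  all: assert (A0 : a O = RtoC 0).
  1, 3: apply Cmod_eq_0; destruct (represents_bounded _ _ _ HR') as [rho [K [Hrho [Hre [HK Hb]]]]];
    destruct (Rle_lt_dec (Cmod (a O)) 0) as [h|h]; [apply Rle_antisym; auto; apply Cmod_ge_0|];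
    exfalso; destruct (HZ (Rmin rho (Cmod (a O) / (K + 1)))) as [w [_ [Hw Hz]]];
    [ apply Rmin_glb_lt; auto; apply Rdiv_lt_0_compat; lra |];
    assert (W1 : Cmod w < rho) by (eapply Rlt_le_trans; [exact Hw | apply Rmin_l]);
    assert (W2 : Cmod w < Cmod (a O) / (K + 1)) by (eapply Rlt_le_trans; [exact Hw | apply Rmin_r]);
    assert (Ea : a O = (- (w * psi w))%C) by (rewrite E in Hz by lra;
      replace (a O) with ((a O + w * psi w) - w * psi w)%C by ring; rewrite Hz; ring);
    pose proof (f_equal Cmod Ea) as Em; rewrite Cmod_opp, Cmod_mult in Em;
    pose proof (Hb w W1) as Hbw; pose proof (Cmod_ge_0 w) as Hw0;
    apply (Rmult_lt_compat_r (K + 1)) in W2; [|lra];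
    replace (Cmod (a O) / (K + 1) * (K + 1)) with (Cmod (a O)) in W2 by (field; lra);
    pose proof (Cmod_ge_0 (psi w)); nra.
  - exact A0.
  - apply (IH (fun k => a (S k)) psi e HR').
    destruct HR as [He _].
    intros eps Heps. destruct (HZ (Rmin eps e)) as [w [Hw0 [Hw Hz]]].
    { apply Rmin_glb_lt; auto. }
    exists w. split; auto. split; [eapply Rlt_le_trans; [exact Hw | apply Rmin_l]|].
    rewrite E, A0 in Hz by (eapply Rlt_le_trans; [exact Hw | apply Rmin_r]).
    replace (psi w) with (/ w * (RtoC 0 + w * psi w))%C by (field; auto).
    rewrite Hz. ring.
Qed.

Definition near_zero (D : C -> C) (z : C) : Prop :=
  exists e, 0 < e /\ forall w, Cmod (w - z)%C < e -> D w = RtoC 0.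

Lemma analytic_represents (D : C -> C) (z : C) : analytic_at D z ->
  exists a e, represents a (fun w => D (z + w)%C) e.
Proof.
  intros [a [e [He H]]]. exists a, e. split; auto.
  intros w Hw. specialize (H (z + w)%C).
  replace (z + w - z)%C with w in H by ring. apply H, Hw.
Qed.

Lemma near_zero_of_accumulation (D : C -> C) (z : C) : analytic_at D z ->
  (forall eps, 0 < eps -> exists w, w <> z /\ Cmod (w - z)%C < eps /\ D w = RtoC 0) ->
  near_zero D z.
Proof.
  intros HA HZ. destruct (analytic_represents D z HA) as [a [e HR]].
  assert (Ha : forall n, a n = RtoC 0).
  { intros n. apply (represents_zeros n a _ e HR).
    intros eps Heps. destruct (HZ eps Heps) as [w [H1 [H2 H3]]].
    exists (w - z)%C. split; [|split]; auto.
    - intros h. apply H1. replace w with ((w - z) + z)%C by ring. rewrite h. ring.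
    - replace (z + (w - z))%C with w by ring. auto. }
  destruct HR as [He H]. exists e. split; auto. intros w Hw.
  specialize (H (w - z)%C Hw). replace (z + (w - z))%C with w in H by ring.
  apply is_pseriesC_iff in H.
  apply (is_seriesC_ext _ (fun _ => RtoC 0)) in H; [|intros k; rewrite Ha; apply Cmult_0_r].
  eapply is_seriesC_unique; [exact H|].
  apply is_seriesC_eps. intros eps. exists O. intros n _.
  assert (E : sumC (fun _ => RtoC 0) n = RtoC 0).
  { induction n as [|n IH]; [apply sumC_0|]. rewrite sumC_S, IH. ring. }
  rewrite E. replace (RtoC 0 - RtoC 0)%C with (RtoC 0) by ring. rewrite Cmod_0. apply cond_pos.
Qed.

(** Connectedness of the segment, by a supremum: the limit parameter [m] is an accumulation point of
    zeros, so [D] vanishes near it, and this pushes past [m] unless [m = 1]. *)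
Lemma near_zero_segment (D : C -> C) (z0 z1 : C) :
  (forall t, 0 <= t <= 1 -> analytic_at D (z0 + RtoC t * (z1 - z0))%C) ->
  near_zero D z0 -> near_zero D z1.
Proof.
  intros HA H0.
  destruct (excluded_middle_informative (z1 = z0)) as [->|Hne]; auto.
  set (d := (z1 - z0)%C) in *.
  assert (Hd0 : d <> RtoC 0).
  { intros h. apply Hne. replace z1 with (d + z0)%C by (unfold d; ring). rewrite h; ring. }
  pose proof (proj1 (Cmod_gt_0 d) Hd0) as Hd.
  set (gam := fun t : R => (z0 + RtoC t * d)%C).
  assert (Hgam : forall s t, Cmod (gam s - gam t)%C = Rabs (s - t) * Cmod d).
  { intros s t. replace (gam s - gam t)%C with (RtoC (s - t) * d)%C
      by (unfold gam; rewrite RtoC_minus; ring).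
    rewrite Cmod_mult, Cmod_R. reflexivity. }
  set (E := fun t => 0 <= t <= 1 /\ forall s, 0 <= s <= t -> near_zero D (gam s)).
  assert (g0 : gam 0 = z0) by (unfold gam; ring).
  assert (E0 : E 0).
  { split; [lra|]. intros s Hs. replace s with 0 by lra. rewrite g0. auto. }
  destruct (completeness E) as [m [Hub Hlub]].
  { exists 1. intros t [Ht _]. lra. }
  { exists 0. exact E0. }
  assert (Hm0 : 0 <= m) by (apply Hub, E0).
  assert (Hm1 : m <= 1) by (apply Hlub; intros t [Ht _]; lra).
  assert (Below : forall s, 0 <= s < m -> near_zero D (gam s)).
  { intros s Hs.
    destruct (Classical_Prop.classic (exists t, E t /\ s < t)) as [[t [[_ Ht] Hst]]|h].
    - apply Ht. lra.
    - exfalso. assert (m <= s); [|lra]. apply Hlub. intros t Ht.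
      destruct (Rle_lt_dec t s) as [|h']; auto. exfalso; apply h; exists t; auto. }
  assert (Nm : near_zero D (gam m)).
  { destruct (Req_dec m 0) as [->|Hmne]; [rewrite g0; auto|].
    apply near_zero_of_accumulation; [apply HA; lra|].
    intros eps Heps.
    set (h := Rmin (m / 2) (eps / (2 * Cmod d))).
    assert (Hh : 0 < h) by (unfold h; apply Rmin_glb_lt; [lra | apply Rdiv_lt_0_compat; lra]).
    assert (Hh1 : h <= m / 2) by apply Rmin_l.
    assert (Hh2 : h <= eps / (2 * Cmod d)) by apply Rmin_r.
    exists (gam (m - h)). split; [|split].
    - intros Heq. pose proof (Hgam (m - h) m) as G. rewrite Heq in G.
      replace (gam m - gam m)%C with (RtoC 0) in G by ring. rewrite Cmod_0 in G.
      replace (m - h - m) with (- h) in G by ring. rewrite Rabs_Ropp, Rabs_pos_eq in G by lra. nra.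
    - rewrite Hgam. replace (m - h - m) with (- h) by ring. rewrite Rabs_Ropp, Rabs_pos_eq by lra.
      apply Rle_lt_trans with (eps / (2 * Cmod d) * Cmod d).
      + apply Rmult_le_compat_r; lra.
      + replace (eps / (2 * Cmod d) * Cmod d) with (eps / 2) by (field; lra). lra.
    - destruct (Below (m - h)) as [e [He H]]; [lra|]. apply H.
      replace (gam (m - h)%R - gam (m - h)%R)%C with (RtoC 0) by ring. rewrite Cmod_0; auto. }
  destruct Nm as [e [He Hnear]].
  destruct (Rle_lt_dec 1 m) as [h|h].
  - replace z1 with (gam m); [exists e; auto|].
    replace m with 1 by lra. unfold gam, d. ring.
  - exfalso. set (h' := Rmin (1 - m) (e / (2 * Cmod d))).
    assert (Hh : 0 < h') by (unfold h'; apply Rmin_glb_lt; [lra | apply Rdiv_lt_0_compat; lra]).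
    assert (Hh1 : h' <= 1 - m) by apply Rmin_l.
    assert (Hh2 : h' <= e / (2 * Cmod d)) by apply Rmin_r.
    assert (m + h' <= m); [|lra]. apply Hub. split; [lra|]. intros s Hs.
    destruct (Rlt_le_dec s m) as [hs|hs]; [apply Below; lra|].
    assert (Hdist : Cmod (gam s - gam m)%C <= e / 2).
    { rewrite Hgam, Rabs_pos_eq by lra.
      apply Rle_trans with (e / (2 * Cmod d) * Cmod d).
      - apply Rmult_le_compat_r; lra.
      - right; field; lra. }
    exists (e / 2). split; [lra|]. intros w Hw. apply Hnear.
    replace (w - gam m)%C with ((w - gam s) + (gam s - gam m))%C by ring.
    eapply Rle_lt_trans; [apply Cmod_triangle|]. lra.
Qed.

Lemma analytic_at_ext (f g : C -> C) (z : C) :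
  (forall w, f w = g w) -> analytic_at f z -> analytic_at g z.
Proof.
  intros E [a [e [He H]]]. exists a, e. split; auto. intros w Hw. rewrite <- E. auto.
Qed.

(** Broken lines avoiding 0: a non-real point is reached from 1 by one segment, a real point through
    [Ci]. *)
Lemma punctured_plane_near_zero (D : C -> C) :
  (forall z, z <> RtoC 0 -> analytic_at D z) ->
  (forall x, 0 < x -> D (RtoC x) = RtoC 0) ->
  forall z, z <> RtoC 0 -> near_zero D z.
Proof.
  intros HA HZ.
  assert (N1 : near_zero D (RtoC 1)).
  { apply near_zero_of_accumulation.
    - apply HA. intros h; inversion h; lra.
    - intros eps Heps. exists (RtoC (1 + eps / 2)). split; [|split].
      + intros h. inversion h. lra.
      + rewrite <- RtoC_minus, Cmod_R, Rabs_pos_eq; lra.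
      + apply HZ. lra. }
  assert (Seg : forall a b : C, (forall t, 0 <= t <= 1 -> (a + RtoC t * (b - a))%C <> RtoC 0) ->
    near_zero D a -> near_zero D b).
  { intros a b H. apply near_zero_segment. intros t Ht. apply HA, H, Ht. }
  intros [x y] Hz.
  destruct (Req_dec y 0) as [->|Hy].
  - assert (Hx : x <> 0) by (intros ->; apply Hz; reflexivity).
    apply (Seg Ci).
    + intros t Ht h. unfold Ci, RtoC, Cplus, Cminus, Cmult, Copp in h. simpl in h.
      pose proof (f_equal fst h) as h1; pose proof (f_equal snd h) as h2; simpl in h1, h2.
      assert (t = 1) by lra. subst t. apply Hx. lra.
    + apply (Seg (RtoC 1)); auto.
      intros t Ht h. unfold Ci, RtoC, Cplus, Cminus, Cmult, Copp in h. simpl in h.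
      pose proof (f_equal fst h) as h1; pose proof (f_equal snd h) as h2; simpl in h1, h2. lra.
  - apply (Seg (RtoC 1)); auto.
    intros t Ht h. unfold RtoC, Cplus, Cminus, Cmult, Copp in h. simpl in h.
    pose proof (f_equal fst h) as h1; pose proof (f_equal snd h) as h2; simpl in h1, h2.
    assert (t * y = 0) by lra. apply Rmult_integral in H. destruct H as [->|]; [lra | auto].
Qed.

(** * First-order Taylor estimates and derivatives *)

Lemma analytic_taylor1 (f : C -> C) (z : C) : analytic_at f z ->
  exists (l : C) (K rho : R), 0 < rho /\ 0 <= K /\ forall w, Cmod (w - z)%C < rho ->
    Cmod (f w - f z - (w - z) * l)%C <= K * Cmod (w - z)%C ^ 2.
Proof.
  intros HA. destruct (analytic_represents f z HA) as [a [e HR]].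
  destruct (represents_tail _ _ _ HR) as [psi [HR1 E1]].
  destruct (represents_tail _ _ _ HR1) as [chi [HR2 E2]].
  destruct (represents_bounded _ _ _ HR2) as [rho [K [Hrho [Hre [HK Hb]]]]].
  pose proof (represents_0 _ _ _ HR) as E0. simpl in E0.
  replace (z + RtoC 0)%C with z in E0 by ring.
  exists (a 1%nat), K, rho. split; auto. split; auto. intros w Hw.
  specialize (E1 (w - z)%C ltac:(lra)). specialize (E2 (w - z)%C ltac:(lra)). simpl in E1.
  replace (z + (w - z))%C with w in E1 by ring.
  rewrite E0, E1, E2.
  replace (a 0%nat + (w - z) * (a 1%nat + (w - z) * chi (w - z)) - a 0%nat - (w - z) * a 1%nat)%C
    with ((w - z) ^ 2 * chi (w - z))%C by (simpl; ring).
  rewrite Cmod_mult, Cmod_pow, Rmult_comm.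
  apply Rmult_le_compat_r; [apply pow_le, Cmod_ge_0 | apply Hb, Hw].
Qed.

Lemma taylor1_is_derive (f : C -> C) (z l : C) (K rho : R) : 0 < rho -> 0 <= K ->
  (forall w, Cmod (w - z)%C < rho ->
    Cmod (f w - f z - (w - z) * l)%C <= K * Cmod (w - z)%C ^ 2) ->
  is_derive (K := C_AbsRing) (V := C_NormedModule) f z l.
Proof.
  intros Hrho HK H. split.
  - apply (is_linear_scal_l (K := C_AbsRing) (V := C_NormedModule) l).
  - intros x Hx.
    apply (is_filter_lim_locally_unique (K := C_AbsRing) (V := AbsRing_NormedModule C_AbsRing)) in Hx.
    subst x. intros eps. pose proof (cond_pos eps) as He.
    assert (Hd : 0 < Rmin rho (eps / (K + 1))).
    { apply Rmin_glb_lt; auto. apply Rdiv_lt_0_compat; lra. }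
    exists (mkposreal _ Hd). intros w Hw.
    change (Cmod (w - z)%C < Rmin rho (eps / (K + 1))) in Hw.
    change (Cmod (f w - f z - (w - z) * l)%C <= eps * Cmod (w - z)%C).
    assert (W1 : Cmod (w - z)%C < rho) by (eapply Rlt_le_trans; [exact Hw | apply Rmin_l]).
    assert (W2 : Cmod (w - z)%C < eps / (K + 1)) by (eapply Rlt_le_trans; [exact Hw | apply Rmin_r]).
    eapply Rle_trans; [apply H, W1|].
    apply (Rmult_lt_compat_r (K + 1)) in W2; [|lra].
    replace (eps / (K + 1) * (K + 1)) with (pos eps) in W2 by (field; lra).
    pose proof (Cmod_ge_0 (w - z)%C). simpl. nra.
Qed.

(** Brings a complex derivative back to the real line: at a zero where the complex derivative is 0,
    the restriction to the reals is quadratically small, so its real derivative vanishes as well. *)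
Lemma derive_0_of_quadratic (k : R -> R) (x d K rho : R) : is_derive k x d ->
  0 < rho -> 0 <= K -> (forall y, Rabs (y - x) < rho -> Rabs (k y) <= K * (y - x) ^ 2) -> d = 0.
Proof.
  intros Hd Hrho HK H.
  destruct (Req_dec d 0) as [|Hne]; auto. exfalso.
  assert (Hdp : 0 < Rabs d) by (apply Rabs_pos_lt; auto).
  assert (k0 : k x = 0).
  { assert (A : Rabs (k x) <= K * (x - x) ^ 2) by (apply H; replace (x - x) with 0 by ring; rewrite Rabs_R0; auto).
    replace (K * (x - x) ^ 2) with 0 in A by ring. pose proof (Rabs_pos (k x)).
    apply Rabs_eq_0. lra. }
  apply is_derive_Reals in Hd. destruct (Hd (Rabs d / 2)) as [del Hdel]; [lra|].
  pose proof (cond_pos del) as Hdel0.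
  set (h := Rmin (Rmin (del / 2) (rho / 2)) (Rabs d / (2 * (K + 1)))).
  assert (Hq : 0 < Rabs d / (2 * (K + 1))) by (apply Rdiv_lt_0_compat; lra).
  assert (Hh : 0 < h) by (unfold h; repeat apply Rmin_glb_lt; lra).
  assert (Hh1 : h <= del / 2) by (unfold h; eapply Rle_trans; [apply Rmin_l | apply Rmin_l]).
  assert (Hh2 : h <= rho / 2) by (unfold h; eapply Rle_trans; [apply Rmin_l | apply Rmin_r]).
  assert (Hh3 : h <= Rabs d / (2 * (K + 1))) by apply Rmin_r.
  specialize (Hdel h ltac:(lra)). rewrite (Rabs_pos_eq h) in Hdel by lra.
  specialize (Hdel ltac:(lra)). rewrite k0, Rminus_0_r in Hdel.
  specialize (H (x + h)). replace (x + h - x) with h in H by ring.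
  rewrite (Rabs_pos_eq h) in H by lra. specialize (H ltac:(lra)).
  assert (B : Rabs (k (x + h) / h) <= K * h).
  { unfold Rdiv. rewrite Rabs_mult, (Rabs_pos_eq (/ h)) by (left; apply Rinv_0_lt_compat; auto).
    apply (Rmult_le_reg_r h); auto. rewrite Rmult_assoc, Rinv_l by lra. lra. }
  assert (K * h <= Rabs d / 2).
  { apply Rle_trans with ((K + 1) * (Rabs d / (2 * (K + 1)))).
    - apply Rmult_le_compat; lra.
    - right; field; lra. }
  pose proof (Rabs_triang_inv d (k (x + h) / h)). rewrite Rabs_minus_sym in Hdel. lra.
Qed.

(** * Zeros of the extension *)

(** [c F (z^2) / z^2] with its only polar term split off; the remaining even series is entire, and
    gives the right value at 0 when [f 0 = 0]. *)
Definition even_laurent (c : R) (f : nat -> R) (z : C) : C :=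
  (c * (f O * / (z * z) + csum (fun k => f (S k) * z ^ (2 * k))))%C.

Lemma entire_even_summable (f : nat -> R) (rho : R) : entire_coef f ->
  ex_series (fun k => Rabs (f k) * rho ^ (2 * k)).
Proof.
  intros H. apply ex_series_ext with (fun k => Rabs (f k) * Rabs (rho ^ 2) ^ k).
  - intros k. rewrite (Rabs_pos_eq (rho ^ 2)), <- pow_mult by apply pow2_ge_0. reflexivity.
  - apply entire_ex_series_Rabs, H.
Qed.

Lemma entire_coef_shift (f : nat -> R) : entire_coef f -> entire_coef (fun k => f (S k)).
Proof.
  intros [B [rho [HB [Hr H]]]]. exists (B * rho), rho. repeat split; auto; [nra|].
  intros k. eapply Rle_trans; [apply H|]. rewrite Rmult_assoc.
  apply Rmult_le_compat_l; auto. rewrite fact_simpl, mult_INR.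
  pose proof (INR_fact_lt_0 k) as Hf. pose proof (pos_INR k) as Hk.
  assert (H1 : 0 < INR (S k)) by (apply lt_0_INR; lia).
  assert (H2 : / INR (S k) <= 1).
  { rewrite <- Rinv_1. apply Rinv_le_contravar; [lra|]. rewrite S_INR; lra. }
  replace (rho ^ S k / (INR (S k) * INR (fact k))) with
    (rho * (rho ^ k / INR (fact k)) * / INR (S k)) by (simpl; field; split; simpl in *; lra).
  assert (0 <= rho * (rho ^ k / INR (fact k))).
  { apply Rmult_le_pos; auto. apply pow_div_fact_pos; auto. }
  rewrite <- (Rmult_1_r (rho * (rho ^ k / INR (fact k)))) at 2.
  apply Rmult_le_compat_l; auto.
Qed.

Lemma analytic_even_laurent (c : R) (f : nat -> R) (z : C) : entire_coef f ->
  f O = 0 \/ z <> RtoC 0 -> analytic_at (even_laurent c f) z.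
Proof.
  intros Hf Hz.
  assert (HG : analytic_at (fun z => csum (fun k => f (S k) * z ^ (2 * k))%C) z).
  { apply (analytic_even_series (fun k => f (S k))). intros rho.
    apply (entire_even_summable (fun k => f (S k))), entire_coef_shift, Hf. }
  destruct Hz as [h|h].
  - apply analytic_at_ext with (fun z => c * csum (fun k => f (S k) * z ^ (2 * k)))%C.
    + intros w. unfold even_laurent. rewrite h. ring.
    + apply analytic_at_scal, HG.
  - apply analytic_at_scal, analytic_at_plus; [|exact HG].
    apply analytic_at_scal, analytic_inv_sqr, h.
Qed.

Lemma even_laurent_real (c : R) (f : nat -> R) (y : R) : entire_coef f -> y <> 0 ->
  even_laurent c f (RtoC y) = RtoC (c * PSeries f (y ^ 2) / y ^ 2).
Proof.
  intros Hf Hy.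
  assert (E : csum (fun k => f (S k) * RtoC y ^ (2 * k))%C =
    RtoC (PSeries (fun k => f (S k)) (y ^ 2))).
  { assert (T : forall k, (f (S k) * RtoC y ^ (2 * k))%C = RtoC (f (S k) * (y ^ 2) ^ k)).
    { intros k. rewrite <- RtoC_pow, <- RtoC_mult, pow_mult. reflexivity. }
    rewrite (csum_ext _ _ T). apply injective_projections; simpl.
    - apply Series_ext. reflexivity.
    - rewrite Series_first; reflexivity. }
  unfold even_laurent. rewrite E.
  rewrite (PSeries_decr_1 f) by (apply entire_ex_pseries, Hf).
  change (PS_decr_1 f) with (fun k => f (S k)).
  set (P := PSeries (fun k => f (S k)) (y ^ 2)).
  replace (c * (f O + y ^ 2 * P) / y ^ 2) with (c * (f O * / (y * y) + P)) by (field; auto).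
  rewrite RtoC_mult, RtoC_plus, RtoC_mult, RtoC_inv, RtoC_mult by nra. reflexivity.
Qed.

(** Multiplying by [l = z^2] gives [F l = 0]. As the coefficients are real, its two components are
    series in the real and imaginary parts of [l^k], the form that [solW_charcoef] accepts. *)
Lemma even_laurent_zero (c : R) (f : nat -> R) (z : C) : entire_coef f -> c <> 0 ->
  z <> RtoC 0 -> even_laurent c f z = RtoC 0 ->
  Series (fun k => powRe (z * z)%C k * f k) = 0 /\ Series (fun k => powIm (z * z)%C k * f k) = 0.
Proof.
  intros Hf Hc Hz H.
  set (l := (z * z)%C).
  assert (Hl : l <> RtoC 0) by (apply Cmult_neq_0; auto).
  assert (S0 : abs_summable (fun k => f k * l ^ k)%C).
  { apply abs_summable_le with (fun k => Rabs (f k) * Rabs (Cmod l) ^ k).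
    - intros k. rewrite Cmod_mult, Cmod_R, Cmod_pow, (Rabs_pos_eq (Cmod l)) by apply Cmod_ge_0. lra.
    - apply entire_ex_series_Rabs, Hf. }
  assert (S1 : abs_summable (fun k => f (S k) * l ^ k)%C).
  { apply abs_summable_le with (fun k => Rabs (f (S k)) * Rabs (Cmod l) ^ k).
    - intros k. rewrite Cmod_mult, Cmod_R, Cmod_pow, (Rabs_pos_eq (Cmod l)) by apply Cmod_ge_0. lra.
    - apply (entire_ex_series_Rabs (fun k => f (S k))), entire_coef_shift, Hf. }
  assert (E : csum (fun k => f k * l ^ k)%C = (f O + l * csum (fun k => f (S k) * l ^ k))%C).
  { rewrite <- csum_scal by auto.
    rewrite (csum_ext (fun k => l * (f (S k) * l ^ k))%C (fun k => f (S k) * l ^ S k)%C)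
      by (intros k; rewrite Cpow_S; ring).
    apply injective_projections.
    - change (Series (fun k => Re (f k * l ^ k)%C) =
        f O + Series (fun k => Re (f (S k) * l ^ S k)%C)).
      rewrite Series_incr_1 by (apply (abs_summable_Re _ S0)). f_equal. simpl. ring.
    - change (Series (fun k => Im (f k * l ^ k)%C) =
        0 + Series (fun k => Im (f (S k) * l ^ S k)%C)).
      rewrite Series_incr_1 by (apply (abs_summable_Im _ S0)). f_equal. simpl. ring. }
  assert (F : (RtoC c * csum (fun k => f k * l ^ k)%C = l * even_laurent c f z)%C).
  { rewrite E. unfold even_laurent.
    rewrite (csum_ext (fun k => f (S k) * z ^ (2 * k))%C (fun k => f (S k) * l ^ k)%C).
    - fold l. field. auto.
    - intros k. rewrite Cpow_mult_r. unfold l. simpl. f_equal. f_equal. ring. }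
  rewrite H, Cmult_0_r in F.
  assert (Z : csum (fun k => f k * l ^ k)%C = RtoC 0).
  { assert (Hc' : RtoC c <> RtoC 0) by (intros h; inversion h; auto).
    replace (csum (fun k => f k * l ^ k)%C) with (/ RtoC c * (RtoC c * csum (fun k => f k * l ^ k)%C))%C
      by (field; auto).
    rewrite F. ring. }
  split.
  - transitivity (fst (csum (fun k => f k * l ^ k)%C)); [|rewrite Z; reflexivity].
    simpl. apply Series_ext. intros k. unfold powRe. fold l. unfold Re; simpl. ring.
  - transitivity (snd (csum (fun k => f k * l ^ k)%C)); [|rewrite Z; reflexivity].
    simpl. apply Series_ext. intros k. unfold powIm. fold l. unfold Im; simpl. ring.
Qed.

(** The value is [c] times the derivative of [F] at 0; the factor [f 0 = 0] kills the polar term,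
    whatever value the inverse takes at 0. *)
Lemma even_laurent_0 (c : R) (f : nat -> R) : f O = 0 ->
  even_laurent c f (RtoC 0) = RtoC (c * f 1%nat).
Proof.
  intros h. unfold even_laurent. rewrite h.
  replace (csum (fun k => f (S k) * RtoC 0 ^ (2 * k))%C) with (RtoC (f 1%nat)).
  - rewrite RtoC_mult. ring.
  - apply injective_projections; simpl; symmetry.
    + rewrite Series_first; [simpl; ring|]. intros k.
      replace (RtoC 0 ^ (S k + (S k + 0)))%C with (RtoC 0) by (simpl; ring). simpl. ring.
    + rewrite Series_first; [simpl; ring|]. intros k.
      replace (RtoC 0 ^ (S k + (S k + 0)))%C with (RtoC 0) by (simpl; ring). simpl. ring.
Qed.

(** [even_laurent] witnesses that an extension exists, which activates the specification of
    [epsilon]; the identity theorem applied to the difference [D] then identifies the two. *)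
Lemma htilde_eq_even_laurent (rin rout delta nu : R) :
  0 < rin -> rin < rout -> Rabs delta <= nu ->
  exists c, c <> 0 /\
    is_htilde_extension rin rout nu delta (htilde rin rout nu delta) /\
    forall z, htilde_domain nu delta z -> htilde rin rout nu delta z =
      even_laurent c (charcoef nu delta rin (ln (rout / rin))) z.
Proof.
  intros Hr HR Hnu. pose proof (Rabs_pos delta) as Hd.
  destruct (htilde_pos_charfun rin rout delta nu Hr HR ltac:(lra)) as [c [Hc Hh]].
  set (f := charcoef nu delta rin (ln (rout / rin))) in *.
  assert (Hf : entire_coef f) by apply entire_charcoef.
  assert (f0 : nu = Rabs delta -> f O = 0) by apply charcoef_0.
  assert (HA : forall z, htilde_domain nu delta z -> analytic_at (even_laurent c f) z).
  { intros z [h|h]; apply analytic_even_laurent; auto. }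
  assert (HP : forall x, 0 < x -> even_laurent c f (RtoC x) = RtoC (htilde_pos rin rout nu delta x)).
  { intros x Hx. rewrite Hh, even_laurent_real by (auto; lra). reflexivity. }
  assert (Hext : is_htilde_extension rin rout nu delta (htilde rin rout nu delta)).
  { unfold htilde. apply epsilon_spec. exists (even_laurent c f). split; auto. }
  exists c. split; auto. split; auto.
  destruct Hext as [HA' HP'].
  set (H := htilde rin rout nu delta) in *.
  set (D := fun z => (H z + (- RtoC 1) * even_laurent c f z)%C).
  assert (DA : forall z, htilde_domain nu delta z -> analytic_at D z).
  { intros z Hz. apply analytic_at_plus; [|apply analytic_at_scal]; auto. }
  assert (DP : forall x, 0 < x -> D (RtoC x) = RtoC 0).
  { intros x Hx. unfold D. rewrite HP, HP' by auto. ring. }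
  assert (DN : forall z, htilde_domain nu delta z -> near_zero D z).
  { intros z Hz. destruct (excluded_middle_informative (z = RtoC 0)) as [->|Hne].
    (* When 0 belongs to the domain, the positive reals already accumulate there. *)
    - apply near_zero_of_accumulation; [apply DA, Hz|].
      intros eps Heps. exists (RtoC (eps / 2)). split; [|split].
      + intros h. inversion h. lra.
      + rewrite <- RtoC_minus, Cmod_R, Rminus_0_r, Rabs_pos_eq; lra.
      + apply DP. lra.
    - apply punctured_plane_near_zero; auto. intros w Hw. apply DA. right; auto. }
  intros z Hz. destruct (DN z Hz) as [e [He Hn]].
  assert (D0 : D z = RtoC 0).
  { apply Hn. replace (z - z)%C with (RtoC 0) by ring. rewrite Cmod_0; auto. }
  unfold D in D0.
  replace (H z) with ((H z + - RtoC 1 * even_laurent c f z) + even_laurent c f z)%C by ring.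
  rewrite D0. ring.
Qed.

Theorem theorem3p3 (rin rout : R) (hr : 0 < rin) (hR : rin < rout)
    (delta nu : R) (hnu : Rabs delta <= nu) :
  forall z : C, htilde_domain nu delta z ->
    htilde rin rout nu delta z = RtoC 0 ->
    Im z = 0 /\ simple_zero (htilde rin rout nu delta) z.
Proof.
  intros z Hz Hz0.
  destruct (htilde_eq_even_laurent rin rout delta nu hr hR hnu) as [c [Hc [[HA _] HE]]].
  set (H := htilde rin rout nu delta) in *.
  set (T := ln (rout / rin)) in *.
  assert (HT : 0 < T) by (apply ln_ratio_pos; auto).
  set (f := charcoef nu delta rin T) in *.
  assert (Hf : entire_coef f) by apply entire_charcoef.
  destruct (excluded_middle_informative (z = RtoC 0)) as [->|Hne].
  (* Here [nu = |delta|] and [F 0 = 0]; a zero of [htilde] at 0 would force [F' 0 = 0] too, against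
     simplicity. So 0 is never a zero. *)
  - exfalso. destruct Hz as [h|h]; [|auto].
    assert (f0 : f O = 0) by (apply charcoef_0; auto).
    rewrite HE, even_laurent_0 in Hz0 by (auto; left; auto).
    pose proof (f_equal fst Hz0) as Hz1. simpl in Hz1.
    apply (charfun_simple nu delta rin T 0 hr HT).
    + fold f. rewrite PSeries_0. exact f0.
    + fold f. rewrite PSeries_0. unfold PS_derive. simpl. rewrite Rmult_1_l.
      apply Rmult_integral in Hz1. destruct Hz1; [contradiction | auto].
  - assert (HL : even_laurent c f z = RtoC 0) by (rewrite <- HE; auto).
    destruct (even_laurent_zero c f z Hf Hc Hne HL) as [ZR ZI].
    destruct (eigenvalue_real_nonneg nu delta rin T (z * z)%C) as [HI HRe]; auto.
    { rewrite solW_charcoef by apply geom_bounded_powRe. exact ZR. }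
    { rewrite solW_charcoef by apply geom_bounded_powIm. exact ZI. }
    assert (Hreal : Im z = 0).
    (* [z^2] is real and nonnegative: [x y = 0] and [x^2 >= y^2], which forces [y = 0]. *)
    { destruct z as [x y]. unfold Im, Re, Cmult in *. simpl in *.
      destruct (Req_dec y 0) as [|hy]; auto. exfalso.
      assert (x = 0) by nra. subst x. nra. }
    split; [exact Hreal|]. split; [exact Hz0|].
    destruct (analytic_taylor1 H z (HA z Hz)) as [l [K [rho [Hrho [HK Ht]]]]].
    exists l. split; [apply (taylor1_is_derive H z l K rho); auto|].
    intros ->.
    set (x := Re z).
    assert (Ez : z = RtoC x) by (destruct z; unfold x, RtoC, Re, Im in *; simpl in *; subst; reflexivity).
    assert (Hx : x <> 0) by (intros h; apply Hne; rewrite Ez, h; reflexivity).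
    set (k := fun y => c * PSeries f (y ^ 2) / y ^ 2).
    assert (Hk : forall y, y <> 0 -> H (RtoC y) = RtoC (k y)).
    { intros y Hy. rewrite HE.
      - apply even_laurent_real; auto.
      - right. intros h. inversion h. auto. }
    assert (Fx : PSeries f (x ^ 2) = 0).
    { assert (kx : k x = 0).
      { rewrite Ez, Hk in Hz0 by auto. inversion Hz0. reflexivity. }
      unfold k in kx. apply (Rmult_eq_reg_l (c / x ^ 2)).
      - rewrite Rmult_0_r, <- kx. field. auto.
      - apply Rmult_integral_contrapositive_currified; auto. apply Rinv_neq_0_compat, pow_nonzero, Hx. }
    set (F1 := PSeries (PS_derive f) (x ^ 2)).
    (* Since [F (x^2) = 0], only the derivative of the numerator contributes. *)
    assert (Dk : is_derive k x (c * F1 * 2 / x)).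
    { unfold k. eapply is_derive_eq.
      - apply is_derive_mult_R.
        + apply is_derive_scal.
          apply (is_derive_comp_R (PSeries f) (fun y => y ^ 2)).
          * apply is_derive_PSeries, entire_CV_radius, Hf.
          * auto_derive; [auto | reflexivity].
        + auto_derive; [|reflexivity]. nra.
      - cbv beta. rewrite Fx. fold F1. simpl. field. auto. }
    assert (D0 : c * F1 * 2 / x = 0).
    (* The radius [|x|] keeps [y] away from 0, where [Hk] does not apply. *)
    { apply (derive_0_of_quadratic k x _ K (Rmin rho (Rabs x))); auto.
      - apply Rmin_glb_lt; auto. apply Rabs_pos_lt; auto.
      - intros y Hy.
        assert (Hy1 : Rabs (y - x) < rho) by (eapply Rlt_le_trans; [exact Hy | apply Rmin_l]).
        assert (Hy2 : Rabs (y - x) < Rabs x) by (eapply Rlt_le_trans; [exact Hy | apply Rmin_r]).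
        assert (Hy0 : y <> 0).
        { intros ->. rewrite Rminus_0_l, Rabs_Ropp in Hy2. lra. }
        assert (E : Cmod (RtoC y - z)%C = Rabs (y - x)) by (rewrite Ez, <- RtoC_minus, Cmod_R; reflexivity).
        specialize (Ht (RtoC y)). rewrite E in Ht. specialize (Ht Hy1).
        rewrite Hz0, Hk in Ht by auto.
        replace (RtoC (k y) - RtoC 0 - (RtoC y - z) * RtoC 0)%C with (RtoC (k y)) in Ht by ring.
        rewrite Cmod_R, pow2_abs in Ht. exact Ht. }
    apply (charfun_simple nu delta rin T (x ^ 2) hr HT); [exact Fx|].
    fold f F1.
    apply (Rmult_eq_reg_l (c * 2 / x)).
    + rewrite Rmult_0_r, <- D0. field. auto.
    + apply Rmult_integral_contrapositive_currified; [lra | apply Rinv_neq_0_compat; auto].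
Qed.
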